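(* Let $a>0$, $\lambda\in\mathbb{R}$ with $4\lambda+a\ge0$, let $1<p\le q<\infty$, and let $\beta,\gamma\in\mathbb{R}$. Then Pitt's inequality $$\bigl\|\rho^{-\gamma}H_{\lambda,a}(f)(\rho)\bigr\|_{q,d\nu_{\lambda,a}}\le c\,\bigl\|r^{\beta}f(r)\bigr\|_{p,d\nu_{\lambda,a}}$$ holds for general monotone functions $f\in GM$ (for every $f\in GM$ with finite right-hand side norm, with a finite constant $c$ that depends on $f$ at most through its $GM$ constants) if and only if $$\beta-\gamma=(2\lambda+a)\Bigl(\frac1{p'}-\frac1q\Bigr)$$ and $$\Bigl(\frac12-\frac1p\Bigr)\Bigl(2\lambda+\frac a2\Bigr)-\frac a{2p}<\beta<\frac{2\lambda+a}{p'}.$$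
   Context: $\mathbb{R}_+=[0,\infty)$, and $p'$ is the Hölder conjugate of $p$. General monotone functions: a function $f$ on $(0,\infty)$ that is of locally bounded variation on $[\varepsilon,\infty)$ for every $\varepsilon>0$ is general monotone, written $f\in GM$, if it vanishes at infinity and there exist constants $C>0$ and $c_0>1$ (the $GM$ constants of $f$) such that for every $r>0$ $$\int_r^\infty|df(u)|\le C\int_{r/c_0}^\infty|f(u)|\,\frac{du}{u},$$ where $\int|df(u)|$ is the Riemann–Stieltjes integral (total variation). For a Bessel function $J_\mu$ of the first kind, $j_\mu(t)=2^\mu\Gamma(\mu+1)t^{-\mu}J_\mu(t)$, so $j_\mu(0)=1$. The measure is $d\nu_{\lambda,a}(r)=b_{\lambda,a}r^{2\lambda+a-1}\,dr$ on $\mathbb{R}_+$, where $b_{\lambda,a}^{-1}=\int_0^\infty e^{-t^a/a}t^{2\lambda+a-1}\,dt=a^{2\lambda/a}\Gamma(2\lambda/a+1)$, and $\|f\|_{p,d\nu_{\lambda,a}}=\bigl(\int_{\mathbb{R}_+}|f(r)|^p\,d\nu_{\lambda,a}(r)\bigr)^{1/p}$. The $a$-deformed Hankel transform (for $4\lambda+a\ge0$) is $$H_{\lambda,a}(f)(\rho)=\int_{\mathbb{R}_+}f(r)\,j_{2\lambda/a}\Bigl(\frac2a(\rho r)^{a/2}\Bigr)\,d\nu_{\lambda,a}(r),\qquad\rho>0,$$ understood as an improper integral, i.e. as $\lim_{A\to0+,\,B\to\infty}\int_A^B$. *)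

(* Defs.v *)
From HB Require Import structures.
From mathcomp Require Import all_boot all_order all_algebra.
From mathcomp Require Import all_classical all_reals all_analysis.
From mathcomp Require Import complex.

Set Implicit Arguments.
Unset Strict Implicit.
Unset Printing Implicit Defensive.

Import Order.TTheory GRing.Theory Num.Theory.
Import numFieldNormedType.Exports.
Import ComplexField.Normc.

Local Open Scope classical_set_scope.
Local Open Scope ring_scope.

(** Functions "on (0,oo)" are total functions [R -> R[i]] of which only the
    values at positive reals are ever used. *)

Section BoundedVariation.
Context {R : realType}.
Implicit Types (f : R -> R[i]) (a b r : R) (s : seq R).

(** The complex-valued analogues of [variation] and [total_variation], which
    the library provides for real-valued functions only. *)
Definition cvariation a b f s : R :=
  let F := f \o nth b (a :: s) in
  \sum_(0 <= n < size s) normc (F n.+1 - F n).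

Definition ctotal_variation a b f : \bar R :=
  ereal_sup [set (cvariation a b f s)%:E | s in itv_partition a b].

(** [int_r^oo |df(u)|] *)
Definition tail_variation r f : \bar R :=
  ereal_sup [set ctotal_variation r b f | b in `[r, +oo[].

(** Locally of bounded variation on [[eps, oo[] for every [eps > 0]. *)
Definition locally_BV f : Prop :=
  forall a b, 0 < a -> a <= b -> (ctotal_variation a b f < +oo)%E.

(** [f] is general monotone with GM constants [C] and [c0]; the inequality is
    between elements of [0, +oo], either side of which may be infinite. *)
Definition general_monotone (C c0 : R) f : Prop :=
  [/\ locally_BV f,
      normc (f x) @[x --> +oo] --> (0 : R) &
      forall r, 0 < r ->
        (tail_variation r f <=
         C%:E * \int[lebesgue_measure]_(u in `[(r / c0)%R, +oo[)
                  (normc (f u) / u)%:E)%E].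

End BoundedVariation.

Section Bessel.
Context {R : realType}.
Implicit Types (mu t x : R).

Definition Gamma x : R :=
  \int[lebesgue_measure]_(t in `]0, +oo[) (t `^ (x - 1) * expR (- t)).

(** [J_mu(t)] for [t > 0] and [mu > -1], so that [Gamma] is only taken at
    positive reals. *)
Definition besselJ mu t : R :=
  limn (series (fun k : nat =>
    (-1) ^+ k / (k`!%:R * Gamma (mu + k%:R + 1)) *
    (t / 2) `^ (2 * k%:R + mu))).

Definition bessel_j mu t : R :=
  if t == 0 then 1
  else 2 `^ mu * Gamma (mu + 1) * t `^ (- mu) * besselJ mu t.

End Bessel.

Section Hankel.
Context {R : realType} (lam a : R).
Implicit Types (f g : R -> R[i]) (u : R -> R) (p q beta gamma rho A B : R).

Definition nu_const : R :=
  (\int[lebesgue_measure]_(t in `]0%R, +oo[)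
     (expR (- (t `^ a / a)) * t `^ (2 * lam + a - 1)))^-1.

(** Density of [nu_{lam,a}] with respect to Lebesgue measure on [R_+]. *)
Definition nu_density (r : R) : R := nu_const * r `^ (2 * lam + a - 1).

(** The [L^p(nu_{lam,a})] norm; the endpoint [0] is a null set. *)
Definition nu_norm p f : \bar R :=
  ((\int[lebesgue_measure]_(r in `]0%R, +oo[)
      ((normc (f r)) `^ p * nu_density r)%:E) `^ p^-1)%E.

Definition hankel_trunc u rho (AB : R * R) : R :=
  \int[lebesgue_measure]_(r in `[AB.1, AB.2])
     (u r * bessel_j (2 * lam / a) (2 / a * (rho * r) `^ (a / 2))
      * nu_density r).

(** Joint limit [A -> 0+], [B -> oo]. *)
Definition improper_filter : set_system (R * R) :=
  filter_prod (0 : R)^'+ (pinfty_nbhs R).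

Definition hankel_converges f rho : Prop :=
  cvg (hankel_trunc (fun r => complex.Re (f r)) rho @ improper_filter) /\
  cvg (hankel_trunc (fun r => complex.Im (f r)) rho @ improper_filter).

(** The transform of [f], the integral being taken on real and imaginary
    parts; meaningful at [rho] when [hankel_converges f rho]. *)
Definition hankel f rho : R[i] :=
  Complex (lim (hankel_trunc (fun r => complex.Re (f r)) rho @ improper_filter))
          (lim (hankel_trunc (fun r => complex.Im (f r)) rho @ improper_filter)).

(** Multiplication by the power [r ^ s]. *)
Definition power_weight (s : R) g : R -> R[i] :=
  fun r => real_complex R (r `^ s) * g r.

(** Pitt's inequality for the class GM: the constant [c] is finite and depends
    on [f] only through its GM constants [C], [c0]. The existence of the
    improper integrals defining the left-hand side is part of the claim. *)
Definition Pitt_GM p q beta gamma : Prop :=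
  forall C c0 : R, 0 < C -> 1 < c0 ->
  exists c : R, forall f, general_monotone C c0 f ->
    (nu_norm p (power_weight beta f) < +oo)%E ->
    (forall rho, 0 < rho -> hankel_converges f rho) /\
    (nu_norm q (power_weight (- gamma) (hankel f))
       <= c%:E * nu_norm p (power_weight beta f))%E.

End Hankel.

(* Main.v *)
Require Import Defs.
From mathcomp Require Import all_boot all_order all_algebra.
From mathcomp Require Import all_classical all_reals all_analysis.
From mathcomp Require Import complex.
From mathcomp Require Import measurable_realfun.
From mathcomp Require Import ring lra.

(** Put [del = 2 * lam + a], [kap = lam + a / 4] and [sig = beta + del / p].
    The two inequalities of the theorem say [kap < sig < del], and
    [r `^ beta * f r] has finite norm exactly when [h u = |f u| * u `^ sig]
    belongs to [L ^ p (du / u)].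

    The kernel [k] of the transform is bounded by [1], and the kernel times the
    density of the measure has a primitive of the form [K (rho * r)], up to a
    factor depending on [rho], where [K s] is [s `^ kap] times a bounded
    oscillating function of [s] ([kern_le1], [kprim_bound]). Both facts come
    from energies of solutions of Bessel's equation that are monotone.

    Sufficiency. On [[0, 1 / rho]] the transform is bounded by the integral of
    [|f|] against the measure. On [[1 / rho, oo[] it is integrated by parts over
    dyadic intervals ([bv_by_parts]); the boundary terms and the variation of
    [f] are controlled by the general monotonicity, which bounds both by
    integrals of [|f u| / u] over half-lines. Since [kap < sig < del], the sum
    of all these contributions is at most a constant times [rho `^ (sig - del)]
    times a multiplicative convolution of [h] with the integrable bump
    [theta eta], which behaves like [min (y `^ eta, y `^ (- eta))]. Young's
    inequality on the group of positive reals ([mconv_Lq]) bounds the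
    [L ^ q (drho / rho)] norm of this convolution by the [L ^ p] norm of [h], and
    the scaling relation makes the powers of [rho] match ([pitt_sufficient]).

    Necessity. The inequality is tested on the indicators of [`]s, 2 * s]], all
    of which are general monotone with the same constants. Their transforms are
    explicit, [K (2 * rho * s) - K (rho * s)] up to a power of [rho]. Comparing
    both sides for all [s] forces the scaling relation ([pitt_scaling]). For
    [s = 1], the behaviour [K (2 * rho) - K rho >= c * rho `^ del] near [0] makes
    the left-hand side diverge logarithmically at [rho = 0] unless [sig < del]
    ([pitt_upper]). At infinity [K (2 * rho) - K rho] is [rho `^ kap] times an
    oscillating function which is not small on average, because solutions of
    Bessel's equation at two different frequencies cannot cancel each other
    ([usol_decorrelation]); so the left-hand side diverges logarithmically at
    infinity unless [kap < sig] ([pitt_lower]). *)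

Set Implicit Arguments.
Unset Strict Implicit.
Unset Printing Implicit Defensive.

Import Order.TTheory GRing.Theory Num.Theory.
Import numFieldNormedType.Exports.
Import ComplexField.Normc.

Local Open Scope classical_set_scope.
Local Open Scope ring_scope.

Lemma eq_leW d (T : porderType d) (x y : T) : x = y -> (x <= y)%O.
Proof. by move=> ->. Qed.

(** * One-variable calculus *)

Section Derivatives.
Context {R : realType}.
Implicit Types (f g df : R -> R) (x y a b : R).

Lemma der_add f g x a b : is_derive x 1 f a -> is_derive x 1 g b ->
  is_derive x 1 (fun y => f y + g y) (a + b).
Proof. by move=> fa gb; exact: is_deriveD. Qed.

Lemma der_opp f x a : is_derive x 1 f a -> is_derive x 1 (fun y => - f y) (- a).
Proof. by move=> fa; exact: is_deriveN. Qed.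

Lemma der_sub f g x a b : is_derive x 1 f a -> is_derive x 1 g b ->
  is_derive x 1 (fun y => f y - g y) (a - b).
Proof. by move=> fa gb; exact: is_deriveB. Qed.

Lemma der_mul f g x a b : is_derive x 1 f a -> is_derive x 1 g b ->
  is_derive x 1 (fun y => f y * g y) (f x * b + g x * a).
Proof. by move=> fa gb; exact: is_deriveM. Qed.

Lemma der_scale k f x a : is_derive x 1 f a ->
  is_derive x 1 (fun y => k * f y) (k * a).
Proof. by move=> fa; exact: is_deriveZ. Qed.

Lemma der_comp f g x a b : is_derive x 1 g b -> is_derive (g x) 1 f a ->
  is_derive x 1 (fun y => f (g y)) (a * b).
Proof. by move=> gb fa; exact: (is_derive1_comp (f := f) (g := g)). Qed.

Lemma der_sqr f x a : is_derive x 1 f a ->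
  is_derive x 1 (fun y => f y ^+ 2) (2 * f x * a).
Proof.
move=> fa; apply: (is_derive_eq (der_mul fa fa)); ring.
Qed.

Lemma der_id x : is_derive x 1 (fun y : R => y) 1.
Proof. exact: is_derive_id. Qed.

Lemma der_cst (k x : R) : is_derive x 1 (fun _ : R => k) 0.
Proof. exact: is_derive_cst. Qed.

Lemma der_inv f x a : is_derive x 1 f a -> f x != 0 ->
  is_derive x 1 (fun y => (f y)^-1) (- a / f x ^+ 2).
Proof.
move=> fa fx0; apply: (is_derive_eq (is_deriveV fx0 fa)).
by rewrite /GRing.scale/=; field.
Qed.

Lemma for_continuous_comp f g x : {for x, continuous g} ->
  {for g x, continuous f} -> {for x, continuous (fun y => f (g y))}.
Proof. by move=> cg cf; exact: continuous_comp. Qed.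

Lemma der_cont f x a : is_derive x 1 f a -> {for x, continuous f}.
Proof.
move=> [fx _]; apply: differentiable_continuous; exact/derivable1_diffP.
Qed.

Lemma der_within f df a b :
  (forall x, a <= x -> x <= b -> is_derive x 1 f (df x)) ->
  {within `[a, b], continuous f}.
Proof.
move=> dfE; apply: continuous_in_subspaceT => x; rewrite inE/= in_itv/=.
by move=> /andP[ax xb]; apply: der_cont (dfE _ ax xb).
Qed.

Lemma der_ge0_le f df a b : a <= b ->
  (forall x, a <= x -> x <= b -> is_derive x 1 f (df x)) ->
  (forall x, a <= x -> x <= b -> 0 <= df x) -> f a <= f b.
Proof.
move=> ab dfE df0; have [||c] := @MVT_segment _ f df a b ab.
- by move=> x; rewrite in_itv/= => /andP[/ltW ax /ltW xb]; exact: dfE.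
- exact: der_within dfE.
rewrite in_itv/= => /andP[ac cb] fE.
by rewrite -subr_ge0 fE mulr_ge0 ?df0 ?subr_ge0.
Qed.

Lemma der_le0_le f df a b : a <= b ->
  (forall x, a <= x -> x <= b -> is_derive x 1 f (df x)) ->
  (forall x, a <= x -> x <= b -> df x <= 0) -> f b <= f a.
Proof.
move=> ab dfE df0; rewrite -lerN2.
apply: (@der_ge0_le (fun x => - f x) (fun x => - df x)) => // x ax xb.
  by have := dfE x ax xb => ?; exact: is_deriveN.
by rewrite oppr_ge0 df0.
Qed.

End Derivatives.

(** * The Bessel series *)

Section BesselSeries.
Context {R : realType}.
Implicit Types (m n z t : R) (k : nat).

Definition poch m k : R := \prod_(i < k) (m + 1 + i%:R).

Definition bcoef m k : R := (- 4^-1) ^+ k / (k`!%:R * poch m k).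

(** The normalized Bessel function as a function of the square of its
    argument, [j_m t = phi m (t ^+ 2)]; in that variable it is an entire
    function. *)
Definition phi m z : R := limn (pseries (bcoef m) z).

Lemma poch_gt0 m k : -1 < m -> 0 < poch m k.
Proof.
move=> m1; apply: prodr_gt0 => i _; rewrite ltr_pwDl ?ler0n //; lra.
Qed.

Lemma pochS m k : poch m k.+1 = poch m k * (m + 1 + k%:R).
Proof. by rewrite /poch big_ord_recr. Qed.

Lemma poch_shift m k : poch m k.+1 = (m + 1) * poch (m + 1) k.
Proof.
rewrite /poch big_ord_recl addr0; congr (_ * _); apply: eq_bigr => i _.
by rewrite lift0 -natr1; ring.
Qed.

(** The coefficients are dominated by those of the exponential series at
    [|z| / (4 * e)], since each factor of [poch m k] is at least [e]. *)
Lemma cvg_phi m z : -1 < m -> cvgn (pseries (bcoef m) z).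
Proof.
move=> m1; pose e : R := Num.min (m + 1) 1.
have e0 : 0 < e by rewrite lt_min ltr01 andbT; lra.
have pe k : e ^+ k <= poch m k.
  elim: k => [|k IH]; first by rewrite expr0 /poch big_ord0.
  rewrite exprSr pochS; apply: ler_pM => //; [exact/exprn_ge0/ltW|exact: ltW|].
  by apply: (@le_trans _ _ (m + 1)); rewrite ?lerDl// /e ge_min lexx.
apply: normed_cvg.
apply: (@series_le_cvg _ _ (exp_coeff (`|z| / (4 * e)))) => //.
- by move=> k; exact: normr_ge0.
- move=> k; apply: exp_coeff_ge0; apply: divr_ge0 => //.
  by apply: mulr_ge0 => //; exact: ltW.
- move=> k; rewrite /exp_coeff/= normrM normrX /bcoef normrM normrX normrN.
  rewrite !normfV (gtr0_norm (_ : 0 < 4))//.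
  rewrite (@gtr0_norm _ (_ * poch m k)); last first.
    by rewrite mulr_gt0 ?poch_gt0// ltr0n fact_gt0.
  rewrite expr_div_n exprMn exprVn.
  rewrite [leLHS](_ : _ = `|z| ^+ k / 4 ^+ k / k`!%:R * (poch m k)^-1); last first.
    by rewrite invfM; ring.
  rewrite [leRHS](_ : _ = `|z| ^+ k / 4 ^+ k / k`!%:R * (e ^+ k)^-1); last first.
    by rewrite invfM; ring.
  apply: ler_wpM2l; first by rewrite !divr_ge0 ?exprn_ge0.
  by rewrite lef_pV2 ?posrE ?exprn_gt0 ?poch_gt0.
- exact: is_cvg_series_exp_coeff.
Qed.

Lemma bcoef_diffs m k : -1 < m ->
  pseries_diffs (bcoef m) k = - (4 * (m + 1))^-1 * bcoef (m + 1) k.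
Proof.
move=> m1; rewrite /pseries_diffs /bcoef poch_shift exprSr factS natrM.
have p0 : poch (m + 1) k != 0 by rewrite gt_eqF// poch_gt0//; lra.
have f0 : (k`!%:R : R) != 0 by rewrite pnatr_eq0 -lt0n fact_gt0.
field; rewrite p0 f0 gt_eqF/=; last lra.
by rewrite nat1r pnatr_eq0.
Qed.

Lemma pseriesZ (c : R) (u : nat -> R) z :
  pseries (fun k => c * u k) z = (fun N => c * pseries u z N).
Proof.
apply/funext => N; rewrite /pseries /series/= mulr_sumr.
by apply: eq_bigr => i _; rewrite mulrA.
Qed.

Lemma cvg_cstM (c l : R) (u : nat -> R) : u @ \oo --> l ->
  (fun N => c * u N) @ \oo --> c * l.
Proof. by move=> ul; apply: cvgM ul; exact: cvg_cst. Qed.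

Lemma lim_cstM (c : R) (u : nat -> R) : cvgn u ->
  limn (fun N => c * u N) = c * limn u.
Proof. by move=> cu; apply/cvg_lim => //; exact: cvg_cstM. Qed.

Lemma der_phi m z : -1 < m ->
  is_derive z 1 (phi m) (- (4 * (m + 1))^-1 * phi (m + 1) z).
Proof.
move=> m1; have m2 : -1 < m + 1 by lra.
have E1 : pseries_diffs (bcoef m) = fun k => - (4 * (m + 1))^-1 * bcoef (m + 1) k.
  by apply/funext => k; rewrite bcoef_diffs.
have E2 : pseries_diffs (pseries_diffs (bcoef m)) = fun k =>
   (- (4 * (m + 1))^-1 * - (4 * (m + 1 + 1))^-1) * bcoef (m + 1 + 1) k.
  apply/funext => k; rewrite E1.
  by have := bcoef_diffs k m2; rewrite /pseries_diffs => H; rewrite mulrCA H mulrA.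
have D : is_derive z 1 (phi m) (limn (pseries (pseries_diffs (bcoef m)) z)).
  apply: (@pseries_snd_diffs _ (bcoef m) (`|z| + 1) z).
  - exact: cvg_phi.
  - by rewrite E1 pseriesZ; apply: cvgP; apply: cvg_cstM; exact: cvg_phi.
  - by rewrite E2 pseriesZ; apply: cvgP; apply: cvg_cstM; apply: cvg_phi; lra.
  - by rewrite [ltRHS]ger0_norm ?ltrDl// addr_ge0.
by apply: (is_derive_eq D); rewrite E1 pseriesZ lim_cstM//; exact: cvg_phi.
Qed.

(** The contiguity relation of Bessel functions; in terms of derivatives it
    is the Bessel equation. *)
Lemma phi_rec m z : -1 < m ->
  phi m z = phi (m + 1) z - z / (4 * (m + 1) * (m + 2)) * phi (m + 2) z.
Proof.
move=> m1; have m2 : -1 < m + 1 by lra.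
have m3 : -1 < m + 2 by lra.
have step N : pseries (bcoef m) z N.+1 = pseries (bcoef (m + 1)) z N.+1
   - z / (4 * (m + 1) * (m + 2)) * pseries (bcoef (m + 2)) z N.
  elim: N => [|N IH].
    rewrite /pseries /series/= !big_nat1 big_geq// mulr0 subr0 /bcoef.
    by rewrite /poch !big_ord0.
  have S (w : R) M : pseries (bcoef w) z M.+1
      = pseries (bcoef w) z M + bcoef w M * z ^+ M.
    by rewrite /pseries /series/= big_nat_recr.
  rewrite S IH [in RHS]S [X in _ = _ - _ * X]S.
  suff -> : bcoef m N.+1 * z ^+ N.+1 = bcoef (m + 1) N.+1 * z ^+ N.+1
     - z / (4 * (m + 1) * (m + 2)) * (bcoef (m + 2) N * z ^+ N).
    ring.
  rewrite /bcoef (pochS (m + 1)) !poch_shift exprSr factS natrM (exprSr z).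
  have := @poch_shift (m + 1) N; rewrite pochS.
  rewrite -[m + 1 + 1]addrA -(natrD _ 1 1) => PE.
  have p2 : poch (m + 2) N != 0 by rewrite gt_eqF// poch_gt0.
  have p1 : poch (m + 1) N != 0 by rewrite gt_eqF// poch_gt0.
  have f0 : (N`!%:R : R) != 0 by rewrite pnatr_eq0 -lt0n fact_gt0.
  have N0 : (N.+1%:R : R) = 1 + N%:R by rewrite nat1r.
  have Nge : 0 <= (N%:R : R) by [].
  have -> : poch (m + 2) N = poch (m + 1) N * (m + 2 + N%:R) / (m + 2).
    by rewrite PE; field; lra.
  rewrite N0; field; rewrite p1 f0 ?gt_eqF//=; lra.
have c1 : (fun N => pseries (bcoef m) z N.+1) @ \oo --> phi m z.
  by rewrite (cvg_shiftS (pseries (bcoef m) z)); exact: cvg_phi.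
suff c2 : (fun N => pseries (bcoef m) z N.+1) @ \oo -->
    phi (m + 1) z - z / (4 * (m + 1) * (m + 2)) * phi (m + 2) z.
  exact: (cvg_unique _ c1 c2).
under eq_fun do rewrite step; apply: cvgB.
  by rewrite (cvg_shiftS (pseries (bcoef (m + 1)) z)); exact: cvg_phi.
by apply: cvg_cstM; exact: cvg_phi.
Qed.

Lemma phi0 m : phi m 0 = 1.
Proof.
rewrite /phi; apply/cvg_lim => //.
rewrite -(cvg_shiftS (pseries (bcoef m) 0)).
have -> : [sequence pseries (bcoef m) 0 n.+1]_n = fun=> 1.
  apply/funext => N; rewrite /pseries /series/= big_mkord big_ord_recl/=.
  rewrite big1 ?addr0; last by move=> i _; rewrite expr0n/= mulr0.
  by rewrite /bcoef /poch big_ord0 !expr0 fact0 !mulr1 divr1.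
exact: cvg_cst.
Qed.

End BesselSeries.

(** * Bounds and oscillation of Bessel functions *)

Section BesselBounds.
Context {R : realType}.
Implicit Types (m n z t : R).

Lemma powRS (t r s : R) : 0 < t -> r = s + 1 -> t `^ r = t * t `^ s.
Proof.
move=> t0 ->; rewrite powRD; last by apply/implyP => _; rewrite gt_eqF.
by rewrite powRr1 ?ltW// mulrC.
Qed.

Definition dphi m z : R := - (4 * (m + 1))^-1 * phi (m + 1) z.

(** Bessel's equation in the squared variable. *)
Lemma der_dphi m z : -1 < m -> exists2 d,
  is_derive z 1 (dphi m) d & z * d = - (m + 1) * dphi m z - phi m z / 4.
Proof.
move=> m1; have m2 : -1 < m + 1 by lra.
exists (- (4 * (m + 1))^-1 * dphi (m + 1) z).
  by apply: der_scale; exact: der_phi.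
rewrite (phi_rec z m1) /dphi -addrA -(natrD _ 1 1); field; lra.
Qed.

Lemma der_phiE m z : -1 < m -> is_derive z 1 (phi m) (dphi m z).
Proof. exact: der_phi. Qed.

Lemma continuous_phi m : -1 < m -> continuous (phi m).
Proof. by move=> m1 z; exact: der_cont (der_phi z m1). Qed.

(** The energy [v ^+ 2 + v' ^+ 2] of [v t = phi m (t ^+ 2)], in the variable
    [z = t ^+ 2]. *)
Definition energy m z : R := phi m z ^+ 2 + 4 * (z * dphi m z ^+ 2).

Lemma der_energy m z : -1 < m ->
  is_derive z 1 (energy m) (- (8 * m + 4) * dphi m z ^+ 2).
Proof.
move=> m1; have [d dd zd] := der_dphi z m1; have dp := der_phiE z m1.
apply: (is_derive_eq (der_add (der_sqr dp) (der_scale 4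
  (der_mul (der_id z) (der_sqr dd))))).
have -> : z * (2 * dphi m z * d) = 2 * dphi m z * (z * d) by ring.
by rewrite zd; field.
Qed.

Lemma energy0 m : energy m 0 = 1.
Proof. by rewrite /energy phi0 mul0r mulr0 addr0 expr1n. Qed.

(** The energy is [1] at [0] and does not increase for [m >= -1 / 2]. *)
Lemma phi_le1 m z : -1 / 2 <= m -> 0 <= z -> `|phi m z| <= 1.
Proof.
move=> m1 z0; have m1' : -1 < m by lra.
suff : phi m z ^+ 2 <= 1 by rewrite -real_normK ?num_real// expr_le1.
rewrite -(energy0 m); apply: (@le_trans _ _ (energy m z)).
  by rewrite /energy lerDl; apply: mulr_ge0 => //; apply: mulr_ge0 => //; exact: sqr_ge0.
apply: (@der_le0_le _ (energy m) (fun z => - (8 * m + 4) * dphi m z ^+ 2)) => // x x0 xz.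
  exact: der_energy.
by rewrite mulNr oppr_le0 mulr_ge0 ?sqr_ge0//; lra.
Qed.

(** The energy decays at most like a power, as
    [- z * energy' <= (2 * m + 1) * energy]; hence [phi m] and its derivative
    have no common zero. *)
Lemma energy_gt0 m z : -1 / 2 <= m -> 0 <= z -> 0 < energy m z.
Proof.
move=> m1; rewrite le_eqVlt => /predU1P[<-|z0]; first by rewrite energy0.
have m1' : -1 < m by lra.
have ce : continuous (energy m).
  by move=> x; exact: der_cont (der_energy x m1').
have : \forall y \near (0 : R), 0 < energy m y.
  have : energy m y @[y --> (0 : R)] --> energy m 0 by exact: ce.
  by rewrite energy0 => /cvgr_gt; apply.
move=> /nbhs_ballP[e/= e0 eP].
pose y := Num.min (e / 2) z.
have y0 : 0 < y by rewrite lt_min z0 divr_gt0.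
have yz : y <= z by rewrite ge_min lexx orbT.
have Ey : 0 < energy m y.
  apply: eP; rewrite /ball/= sub0r normrN gtr0_norm//.
  by rewrite gt_min ltr_pdivrMr// ltr_pMr// ltr1n.
pose G x := x `^ (2 * m + 1) * energy m x.
have : G y <= G z.
  apply: (@der_ge0_le _ G (fun x => x `^ (2 * m + 1) * (- (8 * m + 4) * dphi m x ^+ 2)
     + energy m x * ((2 * m + 1) * x `^ (2 * m + 1 - 1)))) => // x yx xz.
    have x0 : 0 < x by exact: lt_le_trans yx.
    by apply: der_mul; [exact: is_derive1_powR | exact: der_energy].
  have x0 : 0 < x by exact: lt_le_trans yx.
  rewrite (powRS (r := 2 * m + 1) (s := 2 * m + 1 - 1)) //; last by ring.
  rewrite [leRHS](_ : _ = (2 * m + 1) * x `^ (2 * m + 1 - 1) * phi m x ^+ 2); last first.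
    by rewrite /energy; ring.
  apply: mulr_ge0; last exact: sqr_ge0.
  by apply: mulr_ge0; [lra | exact: powR_ge0].
move=> Gyz; have : 0 < G z.
  by apply: lt_le_trans Gyz; rewrite mulr_gt0 ?powR_gt0.
by rewrite pmulr_rgt0// powR_gt0.
Qed.

(** [usol n t] is [sqrt t * J_n t] up to a constant: it solves
    [u'' = - (1 - (n ^+ 2 - 1 / 4) / t ^+ 2) * u]. *)
Definition usol n t : R := t `^ (n + 1 / 2) * phi n (t ^+ 2).

Definition dusol n t : R :=
  t `^ (n - 1 / 2) * ((n + 1 / 2) * phi n (t ^+ 2) + 2 * t ^+ 2 * dphi n (t ^+ 2)).

Definition wcoef n t : R := 1 - (n ^+ 2 - 1 / 4) / t ^+ 2.

Lemma der_usol n t : -1 < n -> 0 < t -> is_derive t 1 (usol n) (dusol n t).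
Proof.
move=> n1 t0; have dt2 := der_sqr (der_id t).
apply: (is_derive_eq (der_mul (is_derive1_powR (n + 1 / 2) t0)
  (der_comp dt2 (der_phiE (t ^+ 2) n1)))).
rewrite /dusol (powRS (r := n + 1 / 2) (s := n - 1 / 2)) //; last by field.
rewrite (_ : n + 1 / 2 - 1 = n - 1 / 2); last by field.
ring.
Qed.

Lemma der_dusol n t : -1 < n -> 0 < t ->
  is_derive t 1 (dusol n) (- (wcoef n t * usol n t)).
Proof.
move=> n1 t0; have dt2 := der_sqr (der_id t).
have [d dd zd] := der_dphi (t ^+ 2) n1.
apply: (is_derive_eq (der_mul (is_derive1_powR (n - 1 / 2) t0)
  (der_add (der_scale (n + 1 / 2) (der_comp dt2 (der_phiE (t ^+ 2) n1)))
    (der_mul (der_scale 2 dt2) (der_comp dt2 dd))))).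
rewrite /wcoef /usol (powRS (r := n + 1 / 2) (s := n - 1 / 2)) //; last by field.
rewrite (powRS (r := n - 1 / 2) (s := n - 1 / 2 - 1)) //; last by field.
have -> : 2 * t ^+ 2 * (d * (2 * t * 1)) = 4 * t * (t ^+ 2 * d) by ring.
by rewrite zd; field; rewrite gt_eqF.
Qed.

Lemma der_wcoef n t : 0 < t ->
  is_derive t 1 (wcoef n) (2 * (n ^+ 2 - 1 / 4) / t ^+ 3).
Proof.
move=> t0; have dt2 := der_sqr (der_id t).
have t20 : t ^+ 2 != 0 by rewrite expf_neq0// gt_eqF.
apply: (is_derive_eq (der_sub (der_cst 1 t) (der_scale (n ^+ 2 - 1 / 4) (der_inv dt2 t20)))).
by field; rewrite gt_eqF.
Qed.

(** From this point on [wcoef n] is at least [1 / 2]. *)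
Definition tstart n : R := 2 * n + 1.

Lemma tstart_ge2 n : 1 / 2 <= n -> 2 <= tstart n.
Proof. by rewrite /tstart => ?; lra. Qed.

Lemma wcoef_bnd n t : 1 / 2 <= n -> tstart n <= t -> 1 / 2 <= wcoef n t <= 1.
Proof.
rewrite /tstart => n1 tn; have t0 : 0 < t by lra.
have H : (n ^+ 2 - 1 / 4) / t ^+ 2 <= 1 / 2.
  by rewrite ler_pdivrMr ?exprn_gt0//; nra.
have H' : 0 <= (n ^+ 2 - 1 / 4) / t ^+ 2.
  by rewrite divr_ge0 ?sqr_ge0//; nra.
by rewrite /wcoef; lra.
Qed.

(** With [w] the coefficient of the equation, which increases,
    [u ^+ 2 + u' ^+ 2 / w] decreases. *)
Lemma usol_bounded n : 1 / 2 <= n -> exists2 M, 1 <= M &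
  (forall t, 0 < t -> `|usol n t| <= M) /\
  (forall t, tstart n <= t -> `|dusol n t| <= M).
Proof.
move=> n1; have n1' : -1 < n by lra.
pose t0 := tstart n; have t02 : 2 <= t0 by exact: tstart_ge2.
pose E t := usol n t ^+ 2 + dusol n t ^+ 2 / wcoef n t.
have EP t : t0 <= t -> E t <= E t0.
  move=> tt0; apply: (@der_le0_le _ E (fun t =>
    - (dusol n t ^+ 2 * (2 * (n ^+ 2 - 1 / 4) / t ^+ 3) / wcoef n t ^+ 2))) => //.
    move=> x x0 xt; have xgt0 : 0 < x by lra.
    have /andP[w1 w2] := wcoef_bnd n1 x0.
    have w0 : wcoef n x != 0 by rewrite gt_eqF//; lra.
    have dW := der_inv (der_wcoef n xgt0) w0.
    apply: (is_derive_eq (der_add (der_sqr (der_usol n1' xgt0))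
      (der_mul (der_sqr (der_dusol n1' xgt0)) dW))).
    move: (n ^+ 2 - 1 / 4) => c; move: (usol n x) (dusol n x) (wcoef n x) w0 => u du w w0.
    by field; rewrite w0 gt_eqF.
  move=> x x0 xt; rewrite oppr_le0 divr_ge0 ?sqr_ge0// mulr_ge0 ?sqr_ge0//.
  rewrite divr_ge0 ?exprn_ge0//; last by lra.
  by rewrite mulr_ge0//; nra.
have E0 : 0 <= E t0.
  have /andP[w1 w2] := wcoef_bnd n1 (lexx t0).
  by rewrite addr_ge0 ?sqr_ge0// divr_ge0 ?sqr_ge0//; lra.
have uE t : t0 <= t -> usol n t ^+ 2 <= E t0.
  move=> tt0; apply: le_trans (EP _ tt0).
  have /andP[w1 w2] := wcoef_bnd n1 tt0.
  by rewrite lerDl divr_ge0 ?sqr_ge0//; lra.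
have duE t : t0 <= t -> dusol n t ^+ 2 <= E t0.
  move=> tt0; apply: le_trans (EP _ tt0).
  have /andP[w1 w2] := wcoef_bnd n1 tt0.
  apply: (@le_trans _ _ (dusol n t ^+ 2 / wcoef n t)); last by rewrite lerDr sqr_ge0.
  by rewrite ler_pdivlMr; [have := sqr_ge0 (dusol n t); nra | lra].
exists (1 + E t0 + t0 `^ (n + 1 / 2)).
  by rewrite -addrA lerDl addr_ge0// powR_ge0.
have S (x : R) : x ^+ 2 <= E t0 -> `|x| <= 1 + E t0.
  move=> xE; have : `|x| ^+ 2 <= E t0 by rewrite real_normK ?num_real.
  by move=> ?; have := sqr_ge0 (`|x| - 1); nra.
split=> t t1; last first.
  by rewrite (le_trans (S _ (duE _ t1)))// lerDl powR_ge0.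
have [tt0|tt0] := leP t0 t.
  by rewrite (le_trans (S _ (uE _ tt0)))// lerDl powR_ge0.
rewrite (@le_trans _ _ (t0 `^ (n + 1 / 2)))//; last by rewrite lerDr addr_ge0.
rewrite /usol normrM ger0_norm ?powR_ge0// -[leRHS]mulr1 ler_pM ?powR_ge0//.
  by rewrite ge0_ler_powR ?nnegrE ?ltW//; lra.
by rewrite phi_le1 ?sqr_ge0//; lra.
Qed.

(** Here the increase of [w] makes [u' ^+ 2 + w * u ^+ 2] increase, and it is
    positive at [tstart n] because [phi n] has only simple zeros. *)
Lemma usol_amplitude n : 1 / 2 <= n -> exists2 F0, 0 < F0 &
  forall t, tstart n <= t -> F0 <= dusol n t ^+ 2 + wcoef n t * usol n t ^+ 2.
Proof.
move=> n1; have n1' : -1 < n by lra.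
pose t0 := tstart n; have t02 : 2 <= t0 by exact: tstart_ge2.
pose F t := dusol n t ^+ 2 + wcoef n t * usol n t ^+ 2.
exists (F t0); last first.
  move=> t tt0; apply: (@der_ge0_le _ F (fun t =>
    usol n t ^+ 2 * (2 * (n ^+ 2 - 1 / 4) / t ^+ 3))) => // x x0 xt.
    have xgt0 : 0 < x by lra.
    apply: (is_derive_eq (der_add (der_sqr (der_dusol n1' xgt0))
      (der_mul (der_wcoef n xgt0) (der_sqr (der_usol n1' xgt0))))).
    ring.
  rewrite mulr_ge0 ?sqr_ge0// divr_ge0 ?exprn_ge0//; last by lra.
  by rewrite mulr_ge0//; nra.
have /andP[w1 w2] := wcoef_bnd n1 (lexx t0).
have t0gt0 : 0 < t0 by lra.
have wge0 : 0 <= wcoef n t0 * usol n t0 ^+ 2.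
  by apply: mulr_ge0; [lra | exact: sqr_ge0].
have Fge0 : 0 <= F t0 by apply: addr_ge0 => //; exact: sqr_ge0.
rewrite lt_neqAle Fge0 andbT eq_sym; apply/negP => /eqP F0.
have /andP[] : (dusol n t0 ^+ 2 == 0) && (wcoef n t0 * usol n t0 ^+ 2 == 0).
  by rewrite -paddr_eq0 ?sqr_ge0//; exact/eqP.
rewrite sqrf_eq0 => /eqP du0; rewrite mulf_eq0 => /orP[/eqP|]; first lra.
rewrite sqrf_eq0 => /eqP us0.
have tpow r : t0 `^ r != 0 by rewrite gt_eqF// powR_gt0.
have u0 : phi n (t0 ^+ 2) = 0 by apply: (mulfI (tpow (n + 1 / 2))); rewrite mulr0.
have d0 : dphi n (t0 ^+ 2) = 0.
  have t2 : 2 * t0 ^+ 2 != 0 by rewrite mulf_neq0// expf_neq0// gt_eqF.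
  apply: (mulfI t2); apply: (mulfI (tpow (n - 1 / 2))); rewrite !mulr0 -[RHS]du0.
  by rewrite /dusol u0 mulr0 add0r.
have := @energy_gt0 n (t0 ^+ 2) _ (sqr_ge0 _).
by rewrite /energy u0 d0 expr0n/= !mulr0 addr0 ltxx => H; suff: false by []; apply: H; lra.
Qed.

(** Solutions at two different frequencies decorrelate: the Wronskian of
    [usol n t] and [usol n (S * t)] is a primitive of a multiple of their
    product. So [usol n (S * t)] cannot cancel [usol n t] on average, which
    the derivative of the bounded function [Q] quantifies. *)
Lemma usol_decorrelation n S A : 1 / 2 <= n -> 1 < S -> exists F0 M B : R,
  [/\ 0 < F0, 0 < M & exists Q dQ : R -> R, forall t, tstart n <= t ->
  [/\ is_derive t 1 Q (dQ t), `|Q t| <= B &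
    F0 <= dQ t + M * `|A * usol n (S * t) - usol n t| ]].
Proof.
move=> n1 S1; have n1' : -1 < n by lra.
have [M M1 [uM duM]] := usol_bounded n1.
have [F0 F00 FP] := usol_amplitude n1.
have t02 := tstart_ge2 n1.
exists (F0 / 2), M, (M ^+ 2 + `|A / (1 - S ^+ 2)| * (S * M ^+ 2 + M ^+ 2)).
split; [by rewrite divr_gt0 | by apply: lt_le_trans M1|].
pose u2 t := usol n (S * t); pose du2 t := S * dusol n (S * t).
exists (fun t => 2^-1 * (usol n t * dusol n t)
   + A / (1 - S ^+ 2) * (usol n t * du2 t - dusol n t * u2 t)).
exists (fun t => 2^-1 * (dusol n t ^+ 2 - wcoef n t * usol n t ^+ 2)
   + A * (usol n t * u2 t)).
move=> t tt0; have tgt0 : 0 < t by lra.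
have Stt : t <= S * t by rewrite ler_pMl// ltW.
have Stgt0 : 0 < S * t by lra.
have dSt : is_derive t 1 (fun y : R => S * y) (S * 1) := der_scale S (der_id t).
have dcoef : S ^+ 2 * wcoef n (S * t) = S ^+ 2 - 1 + wcoef n t.
  by rewrite /wcoef; field; rewrite !gt_eqF//; lra.
split.
- apply: (is_derive_eq (der_add
    (der_scale 2^-1 (der_mul (der_usol n1' tgt0) (der_dusol n1' tgt0)))
    (der_scale (A / (1 - S ^+ 2)) (der_sub
       (der_mul (der_usol n1' tgt0) (der_scale S (der_comp dSt (der_dusol n1' Stgt0))))
       (der_mul (der_dusol n1' tgt0) (der_comp dSt (der_usol n1' Stgt0))))))).
  rewrite [X in _ + A / _ * X](_ : _ = (1 - S ^+ 2) * (usol n t * u2 t)); last first.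
    rewrite /u2 /du2 [LHS](_ : _ = usol n t * usol n (S * t) *
      (wcoef n t - S ^+ 2 * wcoef n (S * t))); last by ring.
    by rewrite dcoef; ring.
  by field; rewrite lt_eqF//; nra.
- have H1 := uM _ tgt0; have H2 := uM _ Stgt0; have H3 := duM _ tt0.
  have H4 := duM _ (le_trans tt0 Stt).
  have S0 : 0 < S by lra.
  rewrite (le_trans (ler_normD _ _))// lerD//.
    rewrite normrM (normrM (usol n t)) ger0_norm//.
    have : `|usol n t| * `|dusol n t| <= M ^+ 2 by rewrite expr2; apply: ler_pM.
    have : 0 <= `|usol n t| * `|dusol n t| by rewrite mulr_ge0.
    by move: (`|usol n t| * `|dusol n t|) (M ^+ 2) => x y; lra.
  rewrite normrM ler_wpM2l// (le_trans (ler_normB _ _))// lerD//.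
    rewrite /du2 (normrM (usol n t)) (normrM S) (gtr0_norm S0) mulrCA.
    by apply: ler_wpM2l; [exact: ltW | rewrite expr2; apply: ler_pM].
  by rewrite (normrM (dusol n t)) expr2; apply: ler_pM.
- have /andP[w1 w2] := wcoef_bnd n1 tt0.
  have := FP _ tt0; set u := usol n t; set du := dusol n t; set w := wcoef n t.
  move=> Fdu.
  have : - ((A * u2 t - u) * u) <= M * `|A * u2 t - u|.
    apply: le_trans (ler_norm _) _; rewrite normrN normrM mulrC.
    by apply: ler_wpM2r => //; exact: uM.
  rewrite -/(u2 t); set v := `|_|; move=> H.
  have : 0 <= (1 - w) * u ^+ 2 by apply: mulr_ge0; [rewrite subr_ge0 | exact: sqr_ge0].
  by move: (u2 t) (M * v) H => y z; nra.
Qed.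

End BesselBounds.

(** * Integrals on the half-line *)

Section IntegralsOnHalfLine.
Context {R : realType}.
Implicit Types (eta rho s x y u A B : R).
Notation mu := (@lebesgue_measure R).
Local Notation D0 := (`]0%R, +oo[%classic : set R).

(** No measurability is required, which matters for the transform: it is only
    defined as a limit. *)
Lemma le_integral_ge0 (D : set R) (f g : R -> \bar R) : measurable D ->
  (forall x, D x -> 0 <= f x)%E -> (forall x, D x -> f x <= g x)%E ->
  (\int[mu]_(x in D) f x <= \int[mu]_(x in D) g x)%E.
Proof.
move=> mD f0 fg; rewrite !ge0_integralE//; last first.
  by move=> x Dx; apply: le_trans (fg _ Dx); exact: f0.
apply: ereal_sup_le => _ /= [h hf <-]; exists h => // x.
apply: le_trans (hf x) _; rewrite /patch; case: ifPn => // /set_mem; exact: fg.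
Qed.

(** Compact intervals exhausting the positive half-line, used to pass from the
    fundamental theorem of calculus to improper integrals. *)
Definition exhaust (n : nat) : set R := `[n.+1%:R^-1, n.+1%:R]%classic.

Lemma exhaust_gt0 n x : exhaust n x -> 0 < x.
Proof. by rewrite /exhaust/= in_itv/= => /andP[+ _]; apply: lt_le_trans. Qed.

Lemma exhaust_bigcup : \bigcup_n exhaust n = D0.
Proof.
apply/seteqP; split => [x [n _ /exhaust_gt0 x0]|x] /=.
  by rewrite in_itv/= x0.
rewrite in_itv/= andbT => x0.
exists (maxn (Num.truncn x) (Num.truncn x^-1)) => //; rewrite /exhaust/= in_itv/=.
have H (y : R) k : (Num.truncn y <= k)%N -> y <= k.+1%:R.
  by move=> yk; rewrite (le_trans (ltW (truncnS_gt y)))// ler_nat ltnS.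
apply/andP; split; last by apply: H; rewrite leq_maxl.
by rewrite -[leRHS]invrK lef_pV2 ?posrE ?invr_gt0//; apply: H; rewrite leq_maxr.
Qed.

Lemma exhaust_mono : nondecreasing_seq exhaust.
Proof.
move=> m n mn; apply/subsetPset => x; rewrite /exhaust/= !in_itv/= => /andP[x1 x2].
apply/andP; split; last by rewrite (le_trans x2)// ler_nat ltnS.
by apply: le_trans x1; rewrite lef_pV2 ?posrE// ler_nat ltnS.
Qed.

Lemma measurable_exhaust n : measurable (exhaust n).
Proof. exact: measurable_itv. Qed.

Lemma exhaust_sub n : exhaust n `<=` D0.
Proof. by move=> x /exhaust_gt0 x0; rewrite /= in_itv/= x0. Qed.

Lemma cvg_exhaust (f : R -> \bar R) : measurable_fun D0 f ->
  (forall x : R, (0 < x)%R -> 0 <= f x)%E ->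
  (\int[mu]_(x in exhaust n) f x)%E @[n --> \oo] --> (\int[mu]_(x in D0) f x)%E.
Proof.
move=> mf f0; rewrite -exhaust_bigcup; apply: ge0_nondecreasing_set_cvg_integral.
- exact: exhaust_mono.
- exact: measurable_exhaust.
- by move=> n; apply: measurable_funS mf => //; exact: exhaust_sub.
- by move=> n x /exhaust_gt0; exact: f0.
Qed.

Lemma integral_le_compact (f : R -> \bar R) M : measurable_fun D0 f ->
  (forall x : R, (0 < x)%R -> 0 <= f x)%E ->
  (forall A B : R, (0 < A)%R -> (A <= B)%R -> \int[mu]_(x in `[A, B]) f x <= M)%E ->
  (\int[mu]_(x in D0) f x <= M)%E.
Proof.
move=> mf f0 fM; have cf := cvg_exhaust mf f0.
rewrite -(cvg_lim _ cf)//; apply: lime_le; first exact: cvgP cf.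
apply: nearW => n; apply: fM; first by [].
by rewrite (@le_trans _ _ 1)// ?invf_le1// ler1n.
Qed.

Lemma FTC2_der (f F : R -> R) (A B : R) : A <= B ->
  (forall x, A <= x -> x <= B -> is_derive x 1 F (f x)) ->
  {within `[A, B], continuous f} ->
  (\int[mu]_(x in `[A, B]) (f x)%:E = (F B - F A)%:E)%E.
Proof.
rewrite le_eqVlt => /predU1P[-> _ _|AB dF cf].
  by rewrite set_itv1 integral_set1 subrr.
have cF x : A <= x -> x <= B -> {for x, continuous F}.
  by move=> Ax xB; exact: der_cont (dF _ Ax xB).
rewrite (@continuous_FTC2 _ f F)//; first split.
- move=> x; rewrite in_itv/= => /andP[/ltW Ax /ltW xB].
  by have [] := dF _ Ax xB.
- by apply: cvg_at_right_filter; apply: cF => //; exact: ltW.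
- by apply: cvg_at_left_filter; apply: cF => //; exact: ltW.
- move=> x; rewrite in_itv/= => /andP[/ltW Ax /ltW xB].
  by have [_] := dF _ Ax xB; rewrite derive1E.
Qed.

Lemma measurable_continuous_gt0 (f : R -> R) :
  (forall x, 0 < x -> {for x, continuous f}) -> measurable_fun D0 f.
Proof.
move=> cf; apply: open_continuous_measurable_fun => //.
by move=> x; rewrite inE/= in_itv/= andbT; exact: cf.
Qed.

Lemma within_gt0 (f : R -> R) A B : 0 < A ->
  (forall x, 0 < x -> {for x, continuous f}) -> {within `[A, B], continuous f}.
Proof.
move=> A0 cf; apply: continuous_in_subspaceT => x; rewrite inE/= in_itv/=.
by move=> /andP[Ax _]; apply: cf; exact: lt_le_trans Ax.
Qed.

Lemma powR_cont (s x : R) : 0 < x -> {for x, continuous (fun y : R => y `^ s)}.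
Proof. by move=> x0; exact: der_cont (is_derive1_powR s x0). Qed.

(** An integrable bump on the multiplicative group of positive reals: it is
    comparable to [y `^ eta] near [0] and to [y `^ (- eta)] near infinity, and
    has an elementary primitive with respect to [dy / y]. *)
Definition theta (eta y : R) : R := y `^ eta / (1 + y `^ eta) ^+ 2.

Lemma theta_ge0 eta y : 0 <= theta eta y.
Proof. by rewrite divr_ge0 ?powR_ge0// sqr_ge0. Qed.

Lemma theta_gt0 eta y : 0 < y -> 0 < theta eta y.
Proof.
by move=> y0; rewrite divr_gt0 ?powR_gt0// exprn_gt0// ltr_wpDr ?powR_ge0.
Qed.

Lemma theta_le1 eta y : theta eta y <= 1.
Proof.
rewrite /theta; have := powR_ge0 y eta; move: (y `^ eta) => t t0.
by rewrite ler_pdivrMr ?mul1r ?exprn_gt0//; nra.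
Qed.

Lemma theta_small eta s y : 0 <= eta -> eta <= s -> 0 < y <= 1 ->
  y `^ s <= 4 * theta eta y.
Proof.
move=> e0 es /andP[y0 y1]; apply: (@le_trans _ _ (y `^ eta)).
  by apply: ger_powR; rewrite ?y0.
have : y `^ eta <= 1 by rewrite -(powRr0 y); apply: ger_powR; rewrite ?y0.
rewrite /theta; have := powR_ge0 y eta; move: (y `^ eta) => t t0 t1.
by rewrite mulrA ler_pdivlMr ?exprn_gt0//; nra.
Qed.

Lemma theta_large eta s y : 0 <= eta -> eta <= s -> 1 <= y ->
  y `^ (- s) <= 4 * theta eta y.
Proof.
move=> e0 es y1; apply: (@le_trans _ _ (y `^ (- eta))).
  by apply: ler_powR => //; rewrite lerN2.
have : 1 <= y `^ eta by rewrite -(powRr0 y); apply: ler_powR.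
rewrite powRN /theta; move: (y `^ eta) => t t1.
rewrite mulrA ler_pdivlMr ?exprn_gt0//; last by lra.
rewrite mulrC -ler_pdivlMr ?invr_gt0 ?invrK; [nra|lra].
Qed.

Lemma theta_le_powR eta y : theta eta y <= y `^ eta.
Proof.
rewrite /theta; have := powR_ge0 y eta; move: (y `^ eta) => t t0.
by rewrite ler_pdivrMr ?exprn_gt0//; nra.
Qed.

Lemma theta_le_powRN eta y : 0 < y -> theta eta y <= y `^ (- eta).
Proof.
move=> y0; rewrite /theta powRN; have := powR_gt0 eta y0.
move: (y `^ eta) => t t0; rewrite ler_pdivrMr ?exprn_gt0//; last by lra.
by rewrite mulrC ler_pdivlMr//; nra.
Qed.

Lemma theta_cont eta x : 0 < x -> {for x, continuous (theta eta)}.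
Proof.
move=> x0; have ce := powR_cont (s := eta) x0.
apply: cvgM; first exact: ce.
apply: cvgV; first by rewrite expf_neq0// gt_eqF// ltr_wpDr ?powR_ge0.
have c1 : {for x, continuous (fun y : R => 1 + y `^ eta)}.
  by apply: cvgD => //; exact: cvg_cst.
by rewrite /continuous_at; under eq_fun do rewrite expr2; rewrite expr2; exact: cvgM.
Qed.

Lemma measurable_theta eta : measurable_fun setT (theta eta).
Proof.
apply: measurable_funM; first exact: measurable_powR.
have m1 : measurable_fun setT (fun y : R => (1 + y `^ eta) ^+ 2).
  by apply: measurable_funX; apply: measurable_funD => //; exact: measurable_powR.
have -> : (fun y : R => ((1 + y `^ eta) ^+ 2)^-1) = fun y => ((1 + y `^ eta) ^+ 2) `^ (-1).
  by apply/funext => y; rewrite powR_inv1// sqr_ge0.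
exact: (measurableT_comp (measurable_powR (-1)) m1).
Qed.

Lemma inv_cont (x : R) : 0 < x -> {for x, continuous (fun y : R => y^-1)}.
Proof. by move=> x0; apply: cvgV; [rewrite gt_eqF | exact: cvg_id]. Qed.

Lemma theta_div_cont eta rho x : 0 < rho -> 0 < x ->
  {for x, continuous (fun u => theta eta (rho * u) / u)}.
Proof.
move=> r0 x0; have rx0 : 0 < rho * x by rewrite mulr_gt0.
have c1 : {for x, continuous (fun u => rho * u)} by exact: mulrl_continuous.
have c2 := for_continuous_comp c1 (theta_cont (eta := eta) rx0).
by apply: cvgM; [exact: c2 | exact: inv_cont].
Qed.

Lemma integral_theta eta rho : 0 < eta -> 0 < rho ->
  (\int[mu]_(u in D0) (theta eta (rho * u) / u)%:E <= (eta^-1)%:E)%E.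
Proof.
move=> e0 r0; have cf x : 0 < x -> {for x, continuous (fun u => theta eta (rho * u) / u)}.
  by move=> x0; exact: theta_div_cont.
apply: integral_le_compact.
- by apply/measurable_EFinP; exact: measurable_continuous_gt0.
- by move=> x x0; rewrite lee_fin divr_ge0 ?theta_ge0// ltW.
move=> A B A0 AB; pose F u := - eta^-1 * (1 + (rho * u) `^ eta)^-1.
have dF x : A <= x -> x <= B -> is_derive x 1 F (theta eta (rho * x) / x).
  move=> Ax xB; have x0 : 0 < x by exact: lt_le_trans Ax.
  have rx0 : 0 < rho * x by rewrite mulr_gt0.
  have d1 := der_comp (der_scale rho (der_id x)) (is_derive1_powR eta rx0).
  have d2 := der_add (der_cst 1 x) d1.
  have n0 : 1 + (rho * x) `^ eta != 0 by rewrite gt_eqF// ltr_wpDr ?powR_ge0.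
  apply: (is_derive_eq (der_scale (- eta^-1) (der_inv d2 n0))).
  rewrite /theta; move: n0.
  rewrite (powRS (r := eta) (s := eta - 1)) //; last by ring.
  by move=> n0; field; rewrite n0 !gt_eqF.
rewrite (FTC2_der AB dF (within_gt0 A0 cf)) lee_fin /F -mulrBr mulNr -mulrN opprB.
have H y : 0 <= (1 + y `^ eta)^-1 <= 1.
  by rewrite invr_ge0 invf_le1 ?lerDl ?powR_ge0 ?addr_ge0 ?powR_ge0 ?ltr_wpDr ?powR_ge0.
by rewrite ler_piMr ?invr_ge0 ?(ltW e0)//; have := H (rho * A); have := H (rho * B); lra.
Qed.

Lemma integral_lty_theta (F : R -> R) eta c : 0 < eta ->
  measurable_fun D0 F ->
  (forall x, 0 < x -> 0 <= F x <= c * (theta eta x / x)) ->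
  (\int[mu]_(x in D0) (F x)%:E < +oo)%E.
Proof.
move=> e0 mF Fle; have c0 : 0 <= c.
  have /andP[F0 F1] := Fle 1 ltr01.
  by have := le_trans F0 F1; rewrite divr1 pmulr_lge0// theta_gt0.
apply: (@le_lt_trans _ _ (\int[mu]_(x in D0) (c%:E * (theta eta (1 * x) / x)%:E))%E).
  apply: le_integral_ge0 => //= x; rewrite in_itv/= andbT => x0.
    by rewrite lee_fin; case/andP: (Fle _ x0).
  by rewrite -EFinM lee_fin mul1r; case/andP: (Fle _ x0).
rewrite ge0_integralZl_EFin//.
- apply: (@le_lt_trans _ _ (c%:E * (eta^-1)%:E)%E); last by rewrite -EFinM ltry.
  by apply: lee_wpmul2l; rewrite ?lee_fin//; exact: integral_theta.
- by move=> x /=; rewrite in_itv/= andbT => x0; rewrite lee_fin divr_ge0 ?theta_ge0// ltW.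
- apply/measurable_EFinP; apply: measurable_continuous_gt0 => x x0.
  exact: theta_div_cont.
Qed.

End IntegralsOnHalfLine.

(** * The Gamma function and the normalization of the kernel *)

Section GammaFunction.
Context {R : realType}.
Implicit Types (a s x t : R).
Notation mu := (@lebesgue_measure R).
Local Notation D0 := (`]0%R, +oo[%classic : set R).

(** The common integrand of [Gamma] ([a = 1]) and of the normalization constant
    of the measure. *)
Definition gexp a s x : R := expR (- (x `^ a / a)) * x `^ (s - 1).

Lemma gexp_ge0 a s x : 0 <= gexp a s x.
Proof. by rewrite mulr_ge0 ?expR_ge0 ?powR_ge0. Qed.

Lemma powRB1 x s : 0 < x -> x `^ (s - 1) = x `^ s / x.
Proof.
move=> x0; rewrite (powRS (r := s) (s := s - 1)) //; last by ring.
by rewrite mulrC mulKf// gt_eqF.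
Qed.

(** The exponential dominates each term of its series. *)
Lemma expRN_le t N : 0 < t -> expR (- t) <= N.+1`!%:R / t ^+ N.+1.
Proof.
move=> t0; have fgt0 : 0 < N.+1`!%:R :> R by rewrite ltr0n fact_gt0.
have := expR_ge1Dxn N (ltW t0); rewrite expRN => H.
rewrite -[leRHS]invrK lef_pV2 ?posrE ?expR_gt0 ?invr_gt0 ?divr_gt0 ?exprn_gt0//.
by rewrite invf_div; apply: le_trans H; rewrite lerDr.
Qed.

Lemma gexp_le_theta a s : 0 < a -> 0 < s -> exists c : R,
  forall x, 0 < x -> 0 <= gexp a s x <= c * (theta s x / x).
Proof.
move=> a0 s0; pose N := Num.truncn (2 * s / a).
have aN : 2 * s <= a * N.+1%:R.
  by rewrite [leRHS]mulrC -ler_pdivrMr// (le_trans (ltW (truncnS_gt _))).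
(* [N] is such that [(x `^ a) ^ (N + 1)] beats [x `^ (2 * s)] for [x > 1] *)
pose K : R := N.+1`!%:R * a ^+ N.+1.
have K0 : 0 <= K by rewrite mulr_ge0// exprn_ge0// ltW.
exists (4 * (1 + K)) => x x0; rewrite gexp_ge0 /gexp powRB1//= (mulrA (expR _)) (mulrA (4 * (1 + K))).
rewrite ler_pM2r ?invr_gt0//.
have [x1|x1] := leP x 1.
  apply: (@le_trans _ _ (x `^ s)).
    rewrite ler_piMl ?powR_ge0// expR_le1 oppr_le0.
    by rewrite divr_ge0 ?powR_ge0// ltW.
  apply: le_trans (theta_small (ltW s0) (lexx s) _) _; first by rewrite x0.
  by rewrite ler_wpM2r ?theta_ge0//; lra.
apply: (@le_trans _ _ (K * x `^ (- s))).
  have -> : x `^ (- s) = x `^ (- (2 * s)) * x `^ s.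
    by rewrite -powRD ?(gt_eqF x0) ?implybT//; congr (_ `^ _); ring.
  rewrite mulrA ler_wpM2r ?powR_ge0//.
  apply: le_trans (expRN_le N _) _; first by rewrite divr_gt0// powR_gt0.
  rewrite /K expr_div_n invf_div mulrA ler_wpM2l// powRN.
  rewrite lef_pV2 ?posrE ?exprn_gt0 ?powR_gt0// -powR_mulrn ?powR_ge0//.
  by rewrite -powRrM; apply: ler_powR => //; exact: ltW.
apply: (@le_trans _ _ (K * (4 * theta s x))).
  by apply: ler_wpM2l => //; apply: theta_large => //; exact: ltW.
by have := theta_ge0 s x; nra.
Qed.

Lemma gexp_cont a s x : 0 < x -> {for x, continuous (gexp a s)}.
Proof.
move=> x0; pose d := der_mul
  (der_comp (der_scale (- a^-1) (is_derive1_powR a x0)) (is_derive_expR _))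
  (is_derive1_powR (s - 1) x0).
suff -> : gexp a s = fun y => expR (- a^-1 * y `^ a) * y `^ (s - 1).
  exact: (der_cont d).
by apply/funext => y; rewrite /gexp mulNr (mulrC _ a^-1).
Qed.

Lemma gexp_lty a s : 0 < a -> 0 < s ->
  (\int[mu]_(x in D0) (gexp a s x)%:E < +oo)%E.
Proof.
move=> a0 s0; have [c gc] := gexp_le_theta a0 s0.
apply: integral_lty_theta gc => //; apply: measurable_continuous_gt0.
exact: gexp_cont.
Qed.

Lemma gexp_integral_gt0 a s : 0 < a -> 0 < s ->
  0 < \int[mu]_(x in D0) gexp a s x.
Proof.
move=> a0 s0; pose m : R := expR (- (2 `^ a / a)) / 2.
have m0 : 0 < m by rewrite divr_gt0// expR_gt0.
apply: fine_gt0; rewrite gexp_lty// andbT.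
apply: (@lt_le_trans _ _ (\int[mu]_(x in `[1%R, 2%R]) m%:E)%E).
  rewrite integral_cst//= lebesgue_measure_itv/= lte_fin ltr1n -EFinB -EFinM lte_fin.
  by apply: mulr_gt0 => //; lra.
apply: (@le_trans _ _ (\int[mu]_(x in `[1%R, 2%R]) (gexp a s x)%:E)%E); last first.
  apply: ge0_subset_integral => //.
  - apply/measurable_EFinP; apply: measurable_continuous_gt0; exact: gexp_cont.
  - by move=> x _; rewrite lee_fin gexp_ge0.
  - by move=> x /=; rewrite !in_itv/= => /andP[x1 _]; rewrite andbT (lt_le_trans _ x1).
apply: le_integral_ge0 => //= x; first by rewrite lee_fin ltW.
rewrite in_itv/= => /andP[x1 x2]; have x0 : 0 < x by exact: lt_le_trans x1.
rewrite lee_fin /m /gexp powRB1// mulrA.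
apply: ler_pM; rewrite ?expR_ge0 ?invr_ge0//; last first.
  by rewrite lef_pV2 ?posrE.
rewrite -[leLHS]mulr1; apply: ler_pM; rewrite ?expR_ge0//.
  rewrite ler_expR lerN2 ler_pM2r ?invr_gt0//.
  by apply: ge0_ler_powR; rewrite ?nnegrE ?(ltW a0)// (ltW x0).
by rewrite -(powRr0 x); apply: ler_powR => //; exact: ltW.
Qed.

Lemma GammaE x : Gamma x = \int[mu]_(t in D0) gexp 1 x t.
Proof.
apply: eq_Rintegral => t; rewrite inE/= in_itv/= andbT => t0.
by rewrite /gexp powRr1 ?(ltW t0)// divr1 mulrC.
Qed.

Lemma Gamma_gt0 x : 0 < x -> 0 < Gamma x.
Proof. by move=> x0; rewrite GammaE gexp_integral_gt0. Qed.

Lemma powRN_cvgy s : 0 < s -> x `^ (- s) @[x --> +oo] --> (0 : R).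
Proof.
move=> s0; apply/cvgr0Pnorm_lt => e e0; pose M := e^-1 `^ s^-1.
have M0 : 0 <= M by exact: powR_ge0.
have Ms : M `^ s = e^-1 by rewrite -powRrM mulVf ?gt_eqF// powRr1// invr_ge0 ltW.
near=> x; have xM : M < x by near: x; apply: nbhs_pinfty_gt; exact: num_real.
have x0 : 0 < x by exact: le_lt_trans xM.
rewrite ger0_norm ?powR_ge0// powRN -[ltRHS]invrK.
rewrite ltf_pV2 ?posrE ?powR_gt0 ?invr_gt0// -Ms.
by apply: gt0_ltr_powR; rewrite ?nnegrE// ltW.
Unshelve. all: by end_near. Qed.

Lemma cvg_exhaust_Rintegral (f : R -> R) :
  (forall x, 0 < x -> {for x, continuous f}) ->
  (forall x, 0 < x -> 0 <= f x) ->
  (\int[mu]_(x in D0) (f x)%:E < +oo)%E ->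
  (\int[mu]_(x in exhaust n) f x) @[n --> \oo] --> \int[mu]_(x in D0) f x.
Proof.
move=> cf f0 foo.
have mf := measurable_continuous_gt0 cf.
have If : (\int[mu]_(x in D0) (f x)%:E)%E \is a fin_num.
  rewrite ge0_fin_numE//; apply: integral_ge0 => x /=.
  by rewrite in_itv/= andbT => x0; rewrite lee_fin f0.
apply: fine_cvg; rewrite fineK//; apply: cvg_exhaust; first exact/measurable_EFinP.
by move=> x x0; rewrite lee_fin f0.
Qed.

Lemma continuous_gt0_integrable (f : R -> R) A B : 0 < A ->
  (forall x, 0 < x -> {for x, continuous f}) ->
  mu.-integrable `[A, B] (EFin \o f).
Proof.
move=> A0 cf; apply: continuous_compact_integrable; first exact: segment_compact.
exact: within_gt0.
Qed.

(** Integration by parts on the exhausting intervals; the boundary terms vanish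
    in the limit because [t `^ x * expR (- t)] is at most a multiple of
    [theta x t]. *)
Lemma GammaD1 x : 0 < x -> Gamma (x + 1) = x * Gamma x.
Proof.
move=> x0; have x10 : 0 < x + 1 by lra.
have [c gc] := gexp_le_theta ltr01 x0.
pose F (t : R) := t `^ x * expR (- t).
have gE y t : 0 < t -> gexp 1 y t = t `^ (y - 1) * expR (- t).
  by move=> t0; rewrite /gexp powRr1 ?(ltW t0)// divr1 mulrC.
have dF t : 0 < t -> is_derive t 1 F (x * gexp 1 x t - gexp 1 (x + 1) t).
  move=> t0; apply: (is_derive_eq (der_mul (is_derive1_powR x t0)
    (der_comp (der_opp (der_id t)) (is_derive_expR (- t))))).
  by rewrite !gE// addrK; ring.
have cx t : 0 < t -> {for t, continuous (gexp 1 x)} by exact: gexp_cont.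
have cx1 t : 0 < t -> {for t, continuous (gexp 1 (x + 1))} by exact: gexp_cont.
have cxx t : 0 < t -> {for t, continuous (fun t => x * gexp 1 x t)}.
  by move=> t0; apply: cvgM; [exact: cvg_cst | exact: cx].
have cd t : 0 < t -> {for t, continuous (fun t => x * gexp 1 x t - gexp 1 (x + 1) t)}.
  by move=> t0; apply: cvgB; [exact: cxx | exact: cx1].
have En n : x * \int[mu]_(t in exhaust n) gexp 1 x t
    - \int[mu]_(t in exhaust n) gexp 1 (x + 1) t = F n.+1%:R - F n.+1%:R^-1.
  have n0 : 0 < n.+1%:R^-1 :> R by rewrite invr_gt0.
  have ne : n.+1%:R^-1 <= n.+1%:R :> R.
    by rewrite (@le_trans _ _ 1)// ?invf_le1// ler1n.
  have I0 : mu.-integrable (exhaust n) (EFin \o gexp 1 x).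
    exact: continuous_gt0_integrable.
  have I1 : mu.-integrable (exhaust n) (EFin \o (fun t => x * gexp 1 x t)).
    exact: continuous_gt0_integrable.
  have I2 : mu.-integrable (exhaust n) (EFin \o gexp 1 (x + 1)).
    exact: continuous_gt0_integrable.
  transitivity (\int[mu]_(t in exhaust n) (x * gexp 1 x t - gexp 1 (x + 1) t)).
    rewrite (RintegralB _ I1 I2); last exact: measurable_exhaust.
    by rewrite (RintegralZl _ _ I0)//; exact: measurable_exhaust.
  have FE := FTC2_der ne (fun t nt _ => dF t (lt_le_trans n0 nt)) (within_gt0 n0 cd).
  by rewrite /Rintegral FE.
have F0 (t : R) : 0 < t -> 0 <= F t <= c * theta x t.
  move=> t0; have /andP[_ Ft1] := gc t t0.
  rewrite mulr_ge0 ?powR_ge0 ?expR_ge0//=.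
  have -> : F t = t * gexp 1 x t by rewrite gE// mulrA -(powRS (r := x))//; ring.
  by rewrite -ler_pdivlMl// mulrC -mulrA.
have c0 : 0 <= c.
  have /andP[F1 F2] := F0 _ ltr01.
  by have := le_trans F1 F2; rewrite pmulr_lge0// theta_gt0.
have cvg0 : x * (\int[mu]_(t in exhaust n) gexp 1 x t)
    - \int[mu]_(t in exhaust n) gexp 1 (x + 1) t @[n --> \oo] --> (0 : R).
  have cn : c * n.+1%:R `^ (- x) @[n --> \oo] --> (0 : R).
    rewrite -(mulr0 c); apply: cvg_cstM.
    rewrite (cvg_shiftS (fun N : nat => N%:R `^ (- x) : R)).
    exact: (cvg_comp _ (fun y : R => y `^ (- x)) (@cvgr_idn R) (powRN_cvgy x0)).
  have cnN : - (c * n.+1%:R `^ (- x)) @[n --> \oo] --> (0 : R).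
    by rewrite -oppr0; apply: cvgN.
  apply: (squeeze_cvgr _ cnN cn); apply: nearW => n; rewrite En.
  have n0 : 0 < n.+1%:R :> R by [].
  have nV0 : 0 < n.+1%:R^-1 :> R by rewrite invr_gt0.
  have /andP[Fa0 Fa] := F0 _ n0; have /andP[Fb0 Fb] := F0 _ nV0.
  have H1 : F n.+1%:R <= c * n.+1%:R `^ (- x).
    by apply: le_trans Fa _; apply: ler_wpM2l => //; exact: theta_le_powRN.
  have H2 : F n.+1%:R^-1 <= c * n.+1%:R `^ (- x).
    apply: le_trans Fb _; apply: ler_wpM2l => //.
    apply: le_trans (theta_le_powR _ _) _.
    by rewrite -[n.+1%:R^-1]powR_inv1// -powRrM mulN1r.
  by lra.
have lim1 : x * (\int[mu]_(t in exhaust n) gexp 1 x t)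
    - \int[mu]_(t in exhaust n) gexp 1 (x + 1) t @[n --> \oo] -->
    x * Gamma x - Gamma (x + 1).
  rewrite !GammaE; apply: cvgB.
    apply: cvg_cstM; apply: cvg_exhaust_Rintegral => //; last exact: gexp_lty.
    by move=> t _; exact: gexp_ge0.
  apply: cvg_exhaust_Rintegral => //; last exact: gexp_lty.
  by move=> t _; exact: gexp_ge0.
have E0 : x * Gamma x - Gamma (x + 1) = 0 by exact: (cvg_unique _ lim1 cvg0).
by apply/esym/eqP; rewrite -subr_eq0 E0.
Qed.

Lemma Gamma_poch (m : R) k : -1 < m -> Gamma (m + k%:R + 1) = poch m k * Gamma (m + 1).
Proof.
move=> m1; elim: k => [|k IH]; first by rewrite /poch big_ord0 mul1r addr0.
rewrite pochS mulrAC -IH -natr1 addrA GammaD1; first by ring.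
by have : 0 <= (k%:R : R) by []; lra.
Qed.

(** By the recursion for [Gamma] the denominators of the two series are
    proportional. *)
Lemma bessel_jE (m t : R) : -1 < m -> 0 < t -> bessel_j m t = phi m (t ^+ 2).
Proof.
move=> m1 t0; rewrite /bessel_j gt_eqF//.
have G0 : Gamma (m + 1) != 0 by rewrite gt_eqF// Gamma_gt0//; lra.
pose C := 2 `^ m * Gamma (m + 1) * t `^ (- m).
have C0 : C != 0 by rewrite !mulf_neq0// gt_eqF// powR_gt0.
have E k : (-1) ^+ k / (k`!%:R * Gamma (m + k%:R + 1)) * (t / 2) `^ (2 * k%:R + m)
    = C^-1 * (bcoef m k * (t ^+ 2) ^+ k).
  have t20 : 0 < t / 2 by rewrite divr_gt0.
  apply: (mulfI C0); rewrite mulVKf// Gamma_poch// /C powRN.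
  have -> : (t / 2) `^ (2 * k%:R + m) = (t / 2) ^+ (2 * k)%N * (t / 2) `^ m.
    rewrite powRD; last by rewrite (gt_eqF t20) implybT.
    by rewrite -powR_mulrn ?natrM// ltW.
  have -> : t `^ m = (t / 2) `^ m * 2 `^ m by rewrite -powRM ?(ltW t20)// divfK.
  have -> : bcoef m k * (t ^+ 2) ^+ k
      = (-1) ^+ k * (t / 2) ^+ (2 * k)%N / (k`!%:R * poch m k).
    rewrite /bcoef mulrAC exprM -!exprMn; congr (_ ^+ _ / _); by field.
  have p0 : poch m k != 0 by rewrite gt_eqF// poch_gt0.
  have f0 : (k`!%:R : R) != 0 by rewrite pnatr_eq0 -lt0n fact_gt0.
  have q0 : (t / 2) `^ m != 0 by rewrite gt_eqF// powR_gt0.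
  have r0 : 2 `^ m != 0 :> R by rewrite gt_eqF// powR_gt0.
  by field; rewrite ?p0 ?f0 ?q0 ?r0 ?G0.
pose u := fun k : nat => (-1) ^+ k / (k`!%:R * Gamma (m + k%:R + 1))
    * (t / 2) `^ (2 * k%:R + m).
have uE : series u = fun N => C^-1 * pseries (bcoef m) (t ^+ 2) N.
  apply/funext => N; rewrite /pseries /series/= mulr_sumr.
  by apply: eq_bigr => i _; exact: E.
rewrite /besselJ -/u uE lim_cstM; last exact: cvg_phi.
by rewrite -/C mulVKf.
Qed.

End GammaFunction.

(** * The Hankel kernel and its primitive *)

Section Kernel.
Context {R : realType} (a lam : R).
Hypotheses (a_gt0 : 0 < a) (lam_a_ge0 : 0 <= 4 * lam + a).
Implicit Types (s r rho : R).

Local Notation mu := (2 * lam / a).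
(** Growth exponents: the measure of [[0, r]] is of the order of [r `^ hdim],
    and the primitive of the kernel grows at most like [s `^ hrate]. *)
Definition hdim : R := 2 * lam + a.
Definition hrate : R := lam + a / 4.
Local Notation del := hdim.
Local Notation kap := hrate.

(** The argument of the Bessel function in the kernel. *)
Definition kvar s : R := 2 / a * s `^ (a / 2).
Definition kern s : R := phi mu (kvar s ^+ 2).

(** A primitive of [kern s * s `^ (del - 1)]. *)
Definition kprim s : R := s `^ del / del * phi (mu + 1) (kvar s ^+ 2).

Lemma mu_ge : -1 / 2 <= mu.
Proof. by rewrite ler_pdivlMr//; move: lam_a_ge0; lra. Qed.

Lemma hdim_gt0 : 0 < del. Proof. by move: a_gt0 lam_a_ge0; rewrite /hdim; lra. Qed.
Lemma hrate_ge0 : 0 <= kap. Proof. by move: lam_a_ge0; rewrite /hrate; lra. Qed.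

Lemma kvar_gt0 s : 0 < s -> 0 < kvar s.
Proof. by move=> s0; rewrite mulr_gt0 ?divr_gt0 ?powR_gt0. Qed.

Lemma der_kvar s : 0 < s -> is_derive s 1 kvar (a / 2 * kvar s / s).
Proof.
move=> s0; apply: (is_derive_eq (der_scale (2 / a) (is_derive1_powR (a / 2) s0))).
by rewrite /kvar powRB1//; ring.
Qed.

Lemma der_kvar2 s : 0 < s ->
  is_derive s 1 (fun y => kvar y ^+ 2) (a * kvar s ^+ 2 / s).
Proof.
move=> s0; apply: (is_derive_eq (der_sqr (der_kvar s0))); by field; rewrite gt_eqF.
Qed.

(** This is the rule [(t ^ n * J_n)' = t ^ n * J_(n - 1)], obtained from the
    contiguity relation. *)
Lemma der_kprim s : 0 < s -> is_derive s 1 kprim (kern s * s `^ (del - 1)).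
Proof.
move=> s0; have m1 := mu_ge; have m1' : -1 < mu + 1 by lra.
have dd := hdim_gt0; have dn : del != 0 by rewrite gt_eqF.
have sn : s != 0 by rewrite gt_eqF.
apply: (is_derive_eq (der_mul
  (der_mul (is_derive1_powR del s0) (der_cst del^-1 s))
  (der_comp (der_kvar2 s0) (der_phiE _ m1')))).
rewrite /kern (phi_rec _ (_ : -1 < mu)); last by lra.
rewrite powRB1// /dphi -[mu + 1 + 1]addrA -(natrD _ 1 1).
set z := kvar s ^+ 2; set p := phi (mu + 1) z; set q := phi (mu + 2) z.
have -> : mu = del / a - 1 by rewrite /hdim; field; rewrite gt_eqF.
have da : del + a != 0 by rewrite gt_eqF// addr_gt0.
by field; rewrite sn (gt_eqF a_gt0)/= !gt_eqF//; move: a_gt0 dd; lra.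
Qed.

Lemma kern_cont s : 0 < s -> {for s, continuous kern}.
Proof.
move=> s0; have m1 : -1 < mu by have := mu_ge; lra.
exact: der_cont (der_comp (der_kvar2 s0) (der_phiE _ m1)).
Qed.

Lemma kern_le1 s : `|kern s| <= 1.
Proof. by apply: phi_le1; [exact: mu_ge | exact: sqr_ge0]. Qed.

Lemma bessel_kern s : 0 < s -> bessel_j mu (kvar s) = kern s.
Proof.
by move=> s0; rewrite bessel_jE ?kvar_gt0//; have := mu_ge; lra.
Qed.

Definition kconst : R := (2 / a) `^ (- (mu + 3 / 2)) / del.

Lemma kconst_gt0 : 0 < kconst.
Proof. by rewrite divr_gt0 ?powR_gt0 ?hdim_gt0// divr_gt0. Qed.

Lemma kprimE s : 0 < s -> kprim s = kconst * s `^ kap * usol (mu + 1) (kvar s).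
Proof.
move=> s0; rewrite /kprim /usol /kconst.
have -> : mu + 1 + 1 / 2 = mu + 3 / 2 by lra.
have a2 : 0 < 2 / a by rewrite divr_gt0.
rewrite [in X in _ = _ * (X * _)]/kvar (powRM _ (ltW a2) (powR_ge0 s _)) -powRrM.
have -> : s `^ del = s `^ kap * s `^ (a / 2 * (mu + 3 / 2)).
  rewrite -powRD; last by rewrite (gt_eqF s0) implybT.
  by congr (_ `^ _); rewrite /hdim /hrate; field; rewrite gt_eqF.
rewrite powRN; have q0 : (2 / a) `^ (mu + 3 / 2) != 0 by rewrite gt_eqF ?powR_gt0.
by field; rewrite q0 gt_eqF// hdim_gt0.
Qed.

Lemma kprim_bound : exists2 C, 0 < C & forall s, 0 < s -> `|kprim s| <= C * s `^ kap.
Proof.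
have n1 : 1 / 2 <= mu + 1 by have := mu_ge; lra.
have [M M1 [uM _]] := usol_bounded n1.
exists (kconst * M); first by rewrite mulr_gt0 ?kconst_gt0//; lra.
move=> s s0; rewrite kprimE// normrM ger0_norm; last first.
  by rewrite mulr_ge0 ?powR_ge0// ltW// kconst_gt0.
rewrite [leRHS]mulrAC; apply: ler_wpM2l; last by apply: uM; exact: kvar_gt0.
by rewrite mulr_ge0 ?powR_ge0// ltW// kconst_gt0.
Qed.

Lemma kvar_sqr s : kvar s ^+ 2 = (2 / a) ^+ 2 * s `^ a.
Proof.
by rewrite /kvar exprMn -(powR_mulrn 2 (powR_ge0 s _)) -powRrM divfK.
Qed.

(** Near [0] the kernel is close to [1], so its integral over [[s, 2 * s]] is
    of the order of [s `^ del]. *)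
Lemma kprim_small : exists e c : R, [/\ 0 < e, 0 < c &
  forall s, 0 < s -> s <= e -> c * s `^ del <= kprim (2 * s) - kprim s].
Proof.
have d0 := hdim_gt0; have m1 : -1 < mu + 1 by have := mu_ge; lra.
have d2 : 1 < 2 `^ del :> R.
  have : 1 `^ del < 2 `^ del :> R by apply: gt0_ltr_powR; rewrite ?nnegrE// ltr1n.
  by rewrite powR1.
pose eta : R := (2 `^ del - 1) / (2 * (2 `^ del + 1)).
have eta0 : 0 < eta by rewrite divr_gt0//; lra.
have : \forall z \near (0 : R), `|1 - phi (mu + 1) z| < eta.
  have : phi (mu + 1) z @[z --> (0 : R)] --> phi (mu + 1) 0.
    exact: (continuous_phi m1).
  by rewrite phi0 => /cvgrPdist_lt; apply.
move=> /nbhs_ballP[d/= d_gt0 dP].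
have near1 z : 0 <= z -> z < d -> `|1 - phi (mu + 1) z| < eta.
  by move=> z0 zd; apply: dP; rewrite /ball/= sub0r normrN ger0_norm.
pose y := (d / (2 * (2 / a) ^+ 2)) `^ a^-1.
have a20 : 0 < (2 / a) ^+ 2 by rewrite exprn_gt0// divr_gt0.
have y0 : 0 < y by rewrite powR_gt0// divr_gt0// mulr_gt0.
have yP s : 0 <= s -> s <= y -> kvar s ^+ 2 < d.
  move=> s0 sy; rewrite kvar_sqr.
  have : s `^ a <= d / (2 * (2 / a) ^+ 2).
    have -> : d / (2 * (2 / a) ^+ 2) = y `^ a.
      rewrite -powRrM mulVf ?gt_eqF// powRr1// divr_ge0 ?ltW// mulr_gt0//.
    by apply: ge0_ler_powR; rewrite ?nnegrE// ltW.
  rewrite invfM mulrA ler_pdivlMr// mulrC => H; apply: le_lt_trans H _; lra.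
exists (y / 2), ((2 `^ del - 1) / 2 / del); split.
- by rewrite divr_gt0.
- by rewrite !divr_gt0//; lra.
move=> s s0 se; rewrite /kprim powRM ?(ltW s0)//.
have ineq u v : `|1 - u| < eta -> `|1 - v| < eta -> (2 `^ del - 1) / 2 <= 2 `^ del * u - v.
  rewrite !ltr_norml => /andP[u1 u2] /andP[v1 v2].
  have : eta * (2 `^ del + 1) = (2 `^ del - 1) / 2.
    by rewrite /eta; field; rewrite gt_eqF//; lra.
  have gen (e D w z : R) : 1 < D -> 1 - w < e -> - e < 1 - z ->
    e * (D + 1) = (D - 1) / 2 -> (D - 1) / 2 <= D * w - z by nra.
  exact: gen.
have k2 : `|1 - phi (mu + 1) (kvar (2 * s) ^+ 2)| < eta.
  by apply: near1; [exact: sqr_ge0 | apply: yP; lra].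
have k1 : `|1 - phi (mu + 1) (kvar s ^+ 2)| < eta.
  by apply: near1; [exact: sqr_ge0 | apply: yP; lra].
have := ineq _ _ k2 k1.
set u := phi _ (kvar (2 * s) ^+ 2); set v := phi _ (kvar s ^+ 2) => Huv.
rewrite [leLHS](_ : _ = s `^ del / del * ((2 `^ del - 1) / 2)); last by ring.
rewrite [leRHS](_ : _ = s `^ del / del * (2 `^ del * u - v)); last by ring.
by apply: ler_wpM2l => //; rewrite divr_ge0 ?powR_ge0// ltW.
Qed.

Lemma nu_const_gt0 : 0 < nu_const lam a.
Proof.
rewrite /nu_const invr_gt0; exact: (gexp_integral_gt0 a_gt0 hdim_gt0).
Qed.

Lemma nu_densityE r : nu_density lam a r = nu_const lam a * r `^ (del - 1).
Proof. by []. Qed.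

Lemma hankel_kernE rho r : 0 < rho -> 0 < r ->
  bessel_j (2 * lam / a) (2 / a * (rho * r) `^ (a / 2)) = kern (rho * r).
Proof. by move=> ? ?; rewrite -bessel_kern// mulr_gt0. Qed.

(** A primitive in [r] of the kernel of the Hankel transform. *)
Definition hprim rho r : R := nu_const lam a * rho `^ (- del) * kprim (rho * r).

Lemma der_hprim rho r : 0 < rho -> 0 < r ->
  is_derive r 1 (hprim rho) (kern (rho * r) * nu_density lam a r).
Proof.
move=> rho0 r0; have rr : 0 < rho * r by rewrite mulr_gt0.
apply: (is_derive_eq (der_scale _ (der_comp (der_scale rho (der_id r)) (der_kprim rr)))).
rewrite nu_densityE !powRB1// powRM ?(ltW rho0) ?(ltW r0)// powRN.
have q0 : rho `^ del != 0 by rewrite gt_eqF// powR_gt0.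
by field; rewrite q0 !gt_eqF.
Qed.

Lemma hker_cont rho r : 0 < rho -> 0 < r ->
  {for r, continuous (fun r => kern (rho * r) * nu_density lam a r)}.
Proof.
move=> rho0 r0; have rr : 0 < rho * r by rewrite mulr_gt0.
have c1 := for_continuous_comp (der_cont (der_scale rho (der_id r))) (kern_cont rr).
have c2 : {for r, continuous (nu_density lam a)}.
  apply: der_cont (der_scale (nu_const lam a) (is_derive1_powR (del - 1) r0)).
by apply: cvgM; [exact: c1 | exact: c2].
Qed.

End Kernel.

(** * Convolution on the multiplicative group of positive reals *)

Section MultiplicativeConvolution.
Context {R : realType}.
Implicit Types (eta rho s x y u : R).
Notation mu := (@lebesgue_measure R).
Local Notation D0 := (`]0%R, +oo[%classic : set R).

Lemma D0P x : D0 x <-> 0 < x.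
Proof. by rewrite /= in_itv/= andbT. Qed.

Lemma measurable_theta_scale eta rho : measurable_fun setT (fun u => theta eta (rho * u)).
Proof.
apply: (measurableT_comp (measurable_theta eta)); exact: measurable_funM.
Qed.

Lemma measurable_inv_D0 : measurable_fun D0 (fun u : R => u^-1).
Proof. by apply: measurable_continuous_gt0 => x x0; exact: inv_cont. Qed.

(** Tonelli's theorem for the double integral in [rho] and [u]. Integrands are
    extended by zero to the whole line so that the product measure applies. *)
Lemma conv_tonelli (H : R -> R) eta c : 0 < eta -> 0 <= c ->
  measurable_fun D0 H -> (forall u, 0 < u -> 0 <= H u) ->
  (\int[mu]_(rho in D0) (\int[mu]_(u in D0) (c / rho * (H u * theta eta (rho * u)))%:E)
   <= \int[mu]_(u in D0) (c / eta * H u)%:E)%E.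
Proof.
move=> e0 c0 mH H0.
pose W : R -> R := (fun u : R => u^-1) \_ D0.
pose G : R -> R := H \_ D0.
have mD : measurable D0 by exact: measurable_itv.
have mW : measurable_fun setT W.
  exact: ((measurable_restrictT (fun u : R => u^-1) mD).1 measurable_inv_D0).
have mG : measurable_fun setT G by exact: ((measurable_restrictT H mD).1 mH).
have WE rho : 0 < rho -> W rho = rho^-1.
  by move=> /D0P r0; rewrite /W patchE mem_set.
have GE u : 0 < u -> G u = H u by move=> /D0P r0; rewrite /G patchE mem_set.
have W0 rho : ~ 0 < rho -> W rho = 0.
  by move=> r0; rewrite /W patchE memNset// => /D0P.
have G0 u : ~ 0 < u -> G u = 0 by move=> r0; rewrite /G patchE memNset// => /D0P.
have Wge0 rho : 0 <= W rho.
  have [r0|r0] := pselect (0 < rho); last by rewrite W0.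
  by rewrite WE// invr_ge0 ltW.
have Gge0 u : 0 <= G u.
  by have [r0|r0] := pselect (0 < u); [rewrite GE// H0 | rewrite G0].
pose GR : measurableType _ := measurableTypeR R.
pose f (z : GR * GR) : \bar R := (c * W z.1 * (G z.2 * theta eta (z.1 * z.2 : R)))%:E.
have idm : measurable_fun [set: GR] (fun x : GR => x : R) by [].
have m1 : measurable_fun [set: GR * GR] (fun z : GR * GR => z.1 : R).
  exact: (measurableT_comp idm measurable_fst).
have m2 : measurable_fun [set: GR * GR] (fun z : GR * GR => z.2 : R).
  exact: (measurableT_comp idm measurable_snd).
have mf : measurable_fun [set: GR * GR] f.
  apply/measurable_EFinP; apply: measurable_funM.
    by apply: measurable_funM => //; exact: (measurableT_comp mW m1).
  apply: measurable_funM; first exact: (measurableT_comp mG m2).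
  by apply: (measurableT_comp (measurable_theta eta)); exact: measurable_funM.
have f0 z : (0 <= f z)%E.
  by rewrite lee_fin; apply: mulr_ge0; apply: mulr_ge0; rewrite ?theta_ge0.
have -> : (\int[mu]_(rho in D0) (\int[mu]_(u in D0) (c / rho * (H u * theta eta (rho * u)))%:E)
   = \int[mu]_rho \int[mu]_u f (rho, u))%E.
  rewrite [LHS]integral_mkcond; apply: eq_integral => rho _.
  rewrite patchE; case: ifPn => [/set_mem /D0P r0|].
    rewrite integral_mkcond; apply: eq_integral => u _.
    rewrite patchE /f/=; case: ifPn => [/set_mem /D0P u0|]; first by rewrite WE// GE.
    by move=> /negP; rewrite inE => uN; rewrite G0 ?mul0r ?mulr0// => /D0P.
  move=> /negP; rewrite inE => rN.
  transitivity (\int[mu]_(u in [set: R]) (0 : \bar R))%E; first by rewrite integral0.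
  apply: eq_integral => u _.
  by rewrite /f/= W0 ?mulr0 ?mul0r// => /D0P.
rewrite (fubini_tonelli f mf f0) [leRHS]integral_mkcond.
apply: le_integral_ge0 => //= u _; first exact: integral_ge0.
rewrite patchE; case: ifPn => [/set_mem /D0P u0|].
  apply: (@le_trans _ _ (\int[mu]_(rho in D0) ((c * H u)%:E * (theta eta (u * rho) / rho)%:E)))%E.
    rewrite [leRHS]integral_mkcond; apply: le_integral_ge0 => //= rho _.
    rewrite patchE /f/=; case: ifPn => [/set_mem /D0P r0|].
      by rewrite WE// GE// -EFinM lee_fin (mulrC u); apply: eq_leW; ring.
    by move=> /negP; rewrite inE => rN; rewrite W0 ?mulr0 ?mul0r// => /D0P.
  rewrite ge0_integralZl_EFin//; first last.
  - by rewrite mulr_ge0// H0.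
  - apply/measurable_EFinP; apply: measurable_continuous_gt0 => x x0.
    exact: theta_div_cont.
  - by move=> x /D0P x0; rewrite lee_fin divr_ge0 ?theta_ge0// ltW.
  have -> : (c / eta * H u)%:E = ((c * H u)%:E * (eta^-1)%:E)%E.
    by rewrite -EFinM; congr (_%:E); ring.
  by apply: lee_wpmul2l; [rewrite lee_fin mulr_ge0// H0 | exact: integral_theta].
move=> /negP; rewrite inE => uN.
apply: eq_leW; transitivity (\int[mu]_(rho in [set: R]) (0 : \bar R))%E; last by rewrite integral0.
apply: eq_integral => rho _.
by rewrite /f/= G0 ?mul0r ?mulr0// => /D0P.
Qed.

Section Fixed.
Variables (h : R -> R) (p eta : R).
Hypotheses (p1 : 1 < p) (eta0 : 0 < eta).
Hypotheses (mh : measurable_fun D0 h) (h0 : forall u, 0 < u -> 0 <= h u).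

(** The convolution of [h] with the bump, for the Haar measure [du / u] of the
    group of positive reals. *)
Definition mconv rho : \bar R := (\int[mu]_(u in D0) (h u * (theta eta (rho * u) / u))%:E)%E.

Definition mnorm : \bar R := (\int[mu]_(u in D0) (h u `^ p / u)%:E)%E.

Let pweight rho : \bar R := (\int[mu]_(u in D0) (h u `^ p / u * theta eta (rho * u))%:E)%E.

Let mtheta_div rho : 0 < rho -> measurable_fun D0 (fun u => theta eta (rho * u) / u).
Proof. by move=> r0; apply: measurable_continuous_gt0 => x x0; exact: theta_div_cont. Qed.

Let mhp : measurable_fun D0 (fun u => h u `^ p / u).
Proof.
apply: measurable_funM; last exact: measurable_inv_D0.
exact: (measurableT_comp (measurable_powR p) mh).
Qed.

Let mhpt rho : measurable_fun D0 (fun u => h u `^ p / u * theta eta (rho * u)).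
Proof.
apply: measurable_funM => //; apply: measurable_funTS; exact: measurable_theta_scale.
Qed.

Lemma mconv_ge0 rho : (0 <= mconv rho)%E.
Proof.
apply: integral_ge0 => u /D0P u0.
by rewrite lee_fin mulr_ge0 ?h0// divr_ge0 ?theta_ge0// ltW.
Qed.

Let hp_ge0 u : 0 < u -> 0 <= h u `^ p / u.
Proof. by move=> u0; rewrite divr_ge0 ?powR_ge0// ltW. Qed.

(** Weighted Jensen inequality, in the elementary form
    [h <= l + l `^ (1 - p) * h `^ p]. *)
Lemma mconv_le_lambda rho (l : R) : 0 < rho -> 0 < l ->
  (pweight rho <= (l `^ p)%:E)%E -> (mconv rho <= (l * (1 + eta^-1))%:E)%E.
Proof.
move=> r0 l0 wl; pose k := l `^ (1 - p).
apply: (@le_trans _ _ (\int[mu]_(u in D0) (l%:E * (theta eta (rho * u) / u)%:E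
    + k%:E * (h u `^ p / u * theta eta (rho * u))%:E)))%E.
  apply: le_integral_ge0 => // u /D0P u0.
    by rewrite lee_fin mulr_ge0 ?h0// divr_ge0 ?theta_ge0// ltW.
  rewrite -!EFinM -EFinD lee_fin.
  rewrite [leRHS](_ : _ = (l + k * h u `^ p) * (theta eta (rho * u) / u)); last by ring.
  apply: ler_wpM2r; first by rewrite divr_ge0 ?theta_ge0// ltW.
  have [hl|hl] := leP (h u) l; first by rewrite (le_trans hl)// lerDl mulr_ge0 ?powR_ge0.
  have hu : 0 < h u by exact: lt_trans hl.
  apply: (@le_trans _ _ (k * h u `^ p)); last by rewrite lerDr ltW.
  have -> : h u `^ p = h u * h u `^ (p - 1) by rewrite (powRS (r := p) (s := p - 1))//; ring.
  rewrite mulrCA -[leLHS]mulr1; apply: ler_wpM2l; first exact: ltW.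
  rewrite /k -opprB powRN mulrC ler_pdivlMr ?powR_gt0// mul1r.
  by apply: ge0_ler_powR; rewrite ?nnegrE ?subr_ge0 ?ltW//.
rewrite ge0_integralD//; first last.
- by apply: measurable_funeM; apply/measurable_EFinP; exact: mhpt.
- move=> u /D0P u0; rewrite -EFinM lee_fin mulr_ge0 ?powR_ge0// mulr_ge0 ?theta_ge0//.
  exact: hp_ge0.
- by apply: measurable_funeM; apply/measurable_EFinP; exact: mtheta_div.
- move=> u /D0P u0; rewrite -EFinM lee_fin mulr_ge0 ?(ltW l0)//.
  by rewrite divr_ge0 ?theta_ge0// ltW.
rewrite (ge0_integralZl_EFin _ _ _ _ (ltW l0))//; first last.
- by apply/measurable_EFinP; exact: mtheta_div.
- by move=> u /D0P u0; rewrite lee_fin divr_ge0 ?theta_ge0// ltW.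
rewrite ge0_integralZl_EFin// ?powR_ge0//; first last.
- by apply/measurable_EFinP; exact: mhpt.
- by move=> u /D0P u0; rewrite lee_fin mulr_ge0 ?theta_ge0// hp_ge0.
have -> : (l * (1 + eta^-1))%:E = (l%:E * (eta^-1)%:E + k%:E * (l `^ p)%:E)%E.
  rewrite -!EFinM -EFinD; congr (_%:E); rewrite /k -powRD; last by rewrite (gt_eqF l0) implybT.
  by rewrite subrK powRr1 ?ltW//; ring.
apply: leeD.
  by apply: lee_wpmul2l; [rewrite lee_fin ltW | exact: integral_theta].
by apply: lee_wpmul2l => //; rewrite lee_fin powR_ge0.
Qed.

(** The case [l = Y `^ p^-1] of the previous bound; when [Y = 0] any [l > 0] is
    admissible. *)
Lemma mconv_le_root rho (Y : R) : 0 < rho -> 0 <= Y ->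
  (pweight rho <= Y%:E)%E -> (mconv rho <= ((1 + eta^-1) * Y `^ p^-1)%:E)%E.
Proof.
move=> r0; have p0 : 0 < p by exact: lt_trans p1.
have pn : p^-1 != 0 by rewrite invr_neq0// gt_eqF.
have c0 : 0 < 1 + eta^-1 by rewrite addr_gt0// invr_gt0.
rewrite le_eqVlt => /predU1P[<- w0|Y0 wY]; last first.
  rewrite mulrC; apply: mconv_le_lambda => //; first exact: powR_gt0.
  by rewrite -powRrM mulVf ?gt_eqF// powRr1// ltW.
rewrite powR0// mulr0; apply/lee_addgt0Pr => e e_gt0; rewrite add0e.
have -> : e = e / (1 + eta^-1) * (1 + eta^-1) by rewrite divfK// gt_eqF.
apply: mconv_le_lambda => //; first by rewrite divr_gt0.
by rewrite (le_trans w0)// lee_fin powR_ge0.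
Qed.

Lemma pweight_le rho : (pweight rho <= mnorm)%E.
Proof.
apply: le_integral_ge0 => // u /D0P u0.
  by rewrite lee_fin mulr_ge0 ?theta_ge0// hp_ge0.
by rewrite lee_fin ler_piMr ?theta_le1// hp_ge0.
Qed.

Hypothesis Xfin : (mnorm < +oo)%E.

Lemma mnorm_ge0 : (0 <= mnorm)%E.
Proof. by apply: integral_ge0 => u /D0P u0; rewrite lee_fin hp_ge0. Qed.

Lemma mnorm_fin : mnorm \is a fin_num.
Proof. by rewrite ge0_fin_numE ?mnorm_ge0. Qed.

Lemma mconv_unif rho : 0 < rho ->
  (mconv rho <= ((1 + eta^-1) * (fine mnorm) `^ p^-1)%:E)%E.
Proof.
move=> r0; apply: mconv_le_root => //; first by rewrite fine_ge0 ?mnorm_ge0.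
by rewrite fineK ?mnorm_fin ?pweight_le.
Qed.

Lemma mconv_fin rho : 0 < rho -> mconv rho \is a fin_num.
Proof.
move=> r0; rewrite ge0_fin_numE ?mconv_ge0//.
by rewrite (le_lt_trans (mconv_unif r0))// ltry.
Qed.

(** Young's inequality for the convolution with the bump on the
    multiplicative group: it maps [L ^ p (du / u)] to [L ^ q (drho / rho)]. *)
Lemma mconv_Lq (q d : R) : p <= q -> 0 <= d ->
  (\int[mu]_(rho in D0) (d * ((fine (mconv rho)) `^ q / rho))%:E
   <= (d * ((1 + eta^-1) `^ q / eta * (fine mnorm) `^ (q / p)))%:E)%E.
Proof.
move=> pq d0; have p0 : 0 < p by exact: lt_trans p1.
have q0 : 0 < q by exact: lt_le_trans pq.
have qp : 1 <= q / p by rewrite ler_pdivlMr// mul1r.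
set X := fine mnorm; have X0 : 0 <= X by rewrite fine_ge0 ?mnorm_ge0.
pose c := d * ((1 + eta^-1) `^ q * X `^ (q / p - 1)).
have c0 : 0 <= c by rewrite mulr_ge0// mulr_ge0 ?powR_ge0.
apply: (@le_trans _ _ (\int[mu]_(u in D0) (c / eta * (h u `^ p / u))%:E)%E); last first.
  under eq_integral do rewrite EFinM.
  rewrite ge0_integralZl_EFin//; first last.
  - by rewrite divr_ge0// ltW.
  - by apply/measurable_EFinP.
  - by move=> u /D0P u0; rewrite lee_fin hp_ge0.
  rewrite -/mnorm -[mnorm]fineK ?mnorm_fin// -EFinM lee_fin -/X /c.
  have -> : d * ((1 + eta^-1) `^ q * X `^ (q / p - 1)) / eta * X
     = d * ((1 + eta^-1) `^ q / eta * (X * X `^ (q / p - 1))) by ring.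
  by rewrite mulr_powRB1// divr_gt0.
apply: le_trans (conv_tonelli eta0 c0 mhp hp_ge0).
apply: le_integral_ge0 => // rho /D0P r0.
  by rewrite lee_fin mulr_ge0// divr_ge0 ?powR_ge0// ltW.
under eq_integral do rewrite EFinM.
rewrite ge0_integralZl_EFin//; first last.
- by rewrite divr_ge0// ltW.
- by apply/measurable_EFinP; exact: mhpt.
- by move=> u /D0P u0; rewrite lee_fin mulr_ge0 ?theta_ge0// hp_ge0.
rewrite -/(pweight rho); have w0 : (0 <= pweight rho)%E.
  by apply: integral_ge0 => u /D0P u0; rewrite lee_fin mulr_ge0 ?theta_ge0// hp_ge0.
have wX := pweight_le rho.
have wfin : pweight rho \is a fin_num by rewrite ge0_fin_numE// (le_lt_trans wX).
have Tw : fine (mconv rho) <= (1 + eta^-1) * (fine (pweight rho)) `^ p^-1.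
  rewrite -lee_fin fineK ?mconv_fin//; apply: mconv_le_root; rewrite ?fine_ge0// fineK//.
rewrite -[pweight rho]fineK// -EFinM lee_fin [leRHS]mulrAC mulrA ler_pM2r ?invr_gt0//.
set Y := fine (pweight rho).
have Y0 : 0 <= Y by exact: fine_ge0.
have YX : Y <= X by rewrite fine_le ?mnorm_fin.
rewrite /c -(mulrA d); apply: ler_wpM2l => //.
apply: (@le_trans _ _ (((1 + eta^-1) * Y `^ p^-1) `^ q)).
  apply: ge0_ler_powR; [exact: ltW| | |exact: Tw]; rewrite nnegrE.
    exact/fine_ge0/mconv_ge0.
  by rewrite mulr_ge0 ?powR_ge0// addr_ge0// invr_ge0 ltW.
rewrite powRM ?powR_ge0 ?addr_ge0 ?invr_ge0 ?(ltW eta0)// -powRrM -mulrA.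
apply: ler_wpM2l; first exact: powR_ge0.
rewrite (mulrC p^-1) -(@mulr_powRB1 _ Y) ?mulr_gt0 ?invr_gt0// [leRHS]mulrC.
have r1 : 0 <= q / p - 1 by rewrite subr_ge0.
by apply: (ler_wpM2l Y0); apply: (ge0_ler_powR r1 _ _ YX); [exact: Y0 | exact: X0].
Qed.

End Fixed.
End MultiplicativeConvolution.

(** * Integration against functions of bounded variation *)

Section BoundedVariationIntegral.
Context {R : realType}.
Implicit Types (a b A B x y c u r : R).
Notation mu := (@lebesgue_measure R).
Local Notation D0 := (`]0%R, +oo[%classic : set R).

Definition locally_bv (F : R -> R) :=
  forall a b, 0 < a -> a <= b -> (total_variation a b F < +oo)%E.

(** Composing with the projection of the line onto [[a, b]] gives a globally
    monotone function. *)
Lemma nondecreasing_in_measurable (f : R -> R) a b : a <= b ->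
  {in `[a, b] &, nondecreasing_fun f} -> measurable_fun `[a, b] f.
Proof.
move=> ab nf; pose g x := f (Num.max a (Num.min b x)).
have clamp x : Num.max a (Num.min b x) \in `[a, b].
  by rewrite in_itv/= le_max lexx/= ge_max ab ge_min lexx.
have gf : {in `[a, b]%classic, g =1 f}.
  move=> x; rewrite inE/= in_itv/= => /andP[ax xb].
  by rewrite /g (min_idPr xb) (max_idPr ax).
apply: (eq_measurable_fun _ gf); apply: nondecreasing_measurable => // x y xy.
have mm : Num.min b x <= Num.min b y by rewrite le_min !ge_min lexx xy orbT.
by apply: nf => //; rewrite ge_max !le_max lexx/= mm orbT.
Qed.

(** Jordan decomposition. *)
Lemma bv_measurable_itv (F : R -> R) a b : 0 < a -> a <= b -> locally_bv F ->
  measurable_fun `[a, b] F.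
Proof.
move=> a0 ab bvF.
have BVF : bounded_variation a b F.
  apply/bounded_variationP => //; rewrite ge0_fin_numE; first exact: bvF.
  exact: total_variation_ge0.
have E := bounded_variation_pos_neg_tvE BVF.
have E' : {in `[a, b]%classic, (fine \o pos_tv a F) \- (fine \o neg_tv a F) =1 F}.
  by move=> x; rewrite inE => xab; rewrite -E.
apply: (eq_measurable_fun _ E').
apply: measurable_funB; apply: nondecreasing_in_measurable => //.
  by apply: fine_neg_tv_nondecreasing; exact: bounded_variationN.
exact: fine_neg_tv_nondecreasing.
Qed.

Lemma bv_measurable (F : R -> R) : locally_bv F -> measurable_fun D0 F.
Proof.
move=> bvF; rewrite -exhaust_bigcup.
apply/measurable_fun_bigcup; first exact: measurable_exhaust.
move=> n; apply: bv_measurable_itv => //.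
by rewrite (@le_trans _ _ 1)// ?invf_le1// ler1n.
Qed.

Section ByParts.
Variables (F m M : R -> R).
Hypothesis bvF : locally_bv F.
Hypothesis cm : forall x, 0 < x -> {for x, continuous m}.
Hypothesis dM : forall x, 0 < x -> is_derive x 1 M (m x).

Let tv x y := fine (total_variation x y F).

Let tvE x y : 0 < x -> x <= y -> (total_variation x y F = (tv x y)%:E)%E.
Proof.
by move=> x0 xy; rewrite fineK// ge0_fin_numE ?bvF// total_variation_ge0.
Qed.

Let tv_ge0 x y : 0 < x -> x <= y -> 0 <= tv x y.
Proof. by move=> x0 xy; rewrite -lee_fin -tvE// total_variation_ge0. Qed.

Let tvD x c y : 0 < x -> x <= c -> c <= y -> tv x y = tv x c + tv c y.
Proof.
move=> x0 xc cy; have c0 := lt_le_trans x0 xc.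
have := total_variationD F xc cy; rewrite !tvE//; last exact: le_trans cy.
by move=> [].
Qed.

Let tv_ge x y : 0 < x -> x <= y -> `|F y - F x| <= tv x y.
Proof. by move=> x0 xy; rewrite -lee_fin -tvE// total_variation_ge. Qed.

Let tv_mono x y z t : 0 < x -> x <= y -> y <= z -> z <= t -> tv y z <= tv x t.
Proof.
move=> x0 xy yz zt; have y0 := lt_le_trans x0 xy.
rewrite (@tvD x y t) ?(le_trans yz)// (@tvD y z t)//.
have := tv_ge0 x0 xy; have := tv_ge0 (lt_le_trans y0 yz) zt; lra.
Qed.

Lemma continuous_bounded_itv A B : 0 < A -> A <= B -> exists2 K, 0 <= K &
  forall x, A <= x -> x <= B -> `|m x| <= K.
Proof.
move=> A0 AB.
have cn : {within `[A, B], continuous (fun x => `|m x|)}.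
  apply: within_gt0 => // x x0.
  by apply: for_continuous_comp; [exact: cm | exact: norm_continuous].
have [c cAB cP] := EVT_max AB cn.
by exists `|m c| => // x Ax xB; apply: cP; rewrite in_itv/= Ax.
Qed.

Lemma bv_mul_integrable A B : 0 < A -> A <= B ->
  mu.-integrable `[A, B] (EFin \o (fun x => F x * m x)).
Proof.
move=> A0 AB; have [K K0 KP] := continuous_bounded_itv A0 AB.
apply: measurable_bounded_integrable => //.
- rewrite -[X in (X < _)%E]/(lebesgue_measure `[A, B]%classic) lebesgue_measure_itv/=.
  by case: ifP => // _; rewrite -EFinB ltry.
- apply: measurable_funM; first exact: bv_measurable_itv.
  apply: measurable_funS (measurable_continuous_gt0 cm) => //.
  by move=> x /=; rewrite !in_itv/= andbT => /andP[Ax _]; exact: lt_le_trans Ax.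
exists ((`|F B| + tv A B) * K); split; first exact: num_real.
move=> N KN x /=; rewrite in_itv/= => /andP[Ax xB]; apply: le_trans (ltW KN).
rewrite normrM; apply: ler_pM => //; last exact: KP.
have x0 := lt_le_trans A0 Ax.
have H1 := tv_ge x0 xB; have H2 := tv_mono A0 Ax xB (lexx B).
by move: (ler_normB (F B) (F B - F x)); rewrite opprB addrC subrK; lra.
Qed.

Let cint A B := \int[mu]_(x in `[A, B]) (F x * m x).

Lemma bv_integral_split A c B : 0 < A -> A <= c -> c <= B ->
  \int[mu]_(x in `[A, B]) (F x * m x) =
  \int[mu]_(x in `[A, c]) (F x * m x) + \int[mu]_(x in `[c, B]) (F x * m x).
Proof.
move=> A0 Ac cB; have AB := le_trans Ac cB; have c0 := lt_le_trans A0 Ac.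
have I := bv_mul_integrable A0 AB.
have := @Rintegral_itvB _ (fun x => F x * m x) (BLeft A) (BRight B) c I.
rewrite !bnd_simp => /(_ Ac cB) E.
rewrite Rintegral_itv_obnd_cbnd in E; first by rewrite -E addrC subrK.
apply: integrableS I => //; exact: subset_itvr.
Qed.

(* the error of integration by parts with the boundary values of [F M] *)
Let rem x y := cint x y - F y * M y + F x * M x.

Let rem_split x c y : 0 < x -> x <= c -> c <= y -> rem x y = rem x c + rem c y.
Proof. by move=> x0 xc cy; rewrite /rem /cint (bv_integral_split x0 xc cy); ring. Qed.

(* freeze [F] at the right end point: [F] then varies by at most [tv x y] *)
Let rem_bound (S K : R) x y : 0 < x -> x <= y -> `|M x| <= S ->
  (forall z, x <= z -> z <= y -> `|m z| <= K) ->
  `|rem x y| <= tv x y * (S + K * (y - x)).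
Proof.
move=> x0 xy MS mK.
have mi : mu.-integrable `[x, y] (EFin \o m) by exact: continuous_gt0_integrable.
have Fi := bv_mul_integrable x0 xy.
have FyI : mu.-integrable `[x, y] (EFin \o (fun z => F y * m z)).
  apply: continuous_gt0_integrable => // z z0.
  by apply: cvgM; [exact: cvg_cst | exact: cm].
have dI : mu.-integrable `[x, y] (EFin \o (fun z => F z * m z - F y * m z)).
  have -> : EFin \o (fun z => F z * m z - F y * m z)
      = (fun z => (F z * m z)%:E - (F y * m z)%:E)%E.
    by apply/funext => z; rewrite /= EFinB.
  exact: integrableB.
have E : rem x y = \int[mu]_(z in `[x, y]) (F z * m z - F y * m z) - (F y - F x) * M x.
  have FE : \int[mu]_(z in `[x, y]) m z = M y - M x.
    rewrite /Rintegral (FTC2_der xy (fun z xz _ => dM (lt_le_trans x0 xz)) (within_gt0 x0 cm)).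
    by [].
  rewrite RintegralB// RintegralZl// FE /rem /cint; ring.
have K0 : 0 <= K by apply: le_trans (mK x (lexx x) xy).
have B1 : `|\int[mu]_(z in `[x, y]) (F z * m z - F y * m z)| <= tv x y * K * (y - x).
  apply: le_trans (le_normr_Rintegral _ dI) _ => //.
  have cI : mu.-integrable `[x, y] (EFin \o (fun _ : R => tv x y * K)).
    by apply: continuous_gt0_integrable => // z _; exact: cst_continuous.
  apply: (@le_trans _ _ (\int[mu]_(z in `[x, y]) (tv x y * K))).
    apply: le_Rintegral => //.
      by have := integrable_abse dI; apply: eq_integrable => // z _ /=.
    move=> z /=; rewrite in_itv/= => /andP[xz zy].
    rewrite -mulrBl normrM; apply: ler_pM => //; last exact: mK.
    rewrite distrC; apply: le_trans (tv_ge (lt_le_trans x0 xz) zy) _.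
    exact: tv_mono.
  have dk z : x <= z -> z <= y ->
      is_derive z 1 (fun z => tv x y * K * z) (tv x y * K).
    by move=> _ _; apply: (is_derive_eq (der_scale _ (der_id z))); rewrite mulr1.
  have ck : {within `[x, y], continuous (fun=> tv x y * K)}.
    by apply: within_gt0 => // z _; exact: cst_continuous.
  by rewrite /Rintegral (FTC2_der xy dk ck) -mulrBr.
rewrite E; apply: le_trans (ler_normB _ _) _.
have B2 : `|(F y - F x) * M x| <= tv x y * S by rewrite normrM ler_pM// tv_ge.
by rewrite [leLHS]addrC [leRHS]mulrDr (mulrA (tv x y)) lerD.
Qed.

(** Integration by parts against a function of bounded variation. The error
    [rem] is additive over subintervals, as is the total variation, so its
    crude bound improves under repeated bisection. *)
Lemma bv_by_parts (S : R) A B : 0 < A -> A <= B ->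
  (forall x, A <= x -> x <= B -> `|M x| <= S) ->
  `|\int[mu]_(x in `[A, B]) (F x * m x)|
    <= S * (`|F A| + `|F B| + fine (total_variation A B F)).
Proof.
move=> A0 AB MS; have [K K0 KP] := continuous_bounded_itv A0 AB.
have bis k : forall x y, A <= x -> x <= y -> y <= B ->
    `|rem x y| <= tv x y * (S + K * (y - x) / 2 ^+ k).
  elim: k => [|k IH] x y Ax xy yB; have x0 := lt_le_trans A0 Ax.
    rewrite expr0 divr1; apply: rem_bound => //.
      by apply: MS => //; exact: le_trans yB.
    by move=> z xz zy; apply: KP; [exact: le_trans xz | exact: le_trans yB].
  pose c := (x + y) / 2.
  have xc : x <= c by rewrite /c; lra.
  have cy : c <= y by rewrite /c; lra.
  rewrite (rem_split x0 xc cy) (tvD x0 xc cy).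
  apply: le_trans (ler_normD _ _) _; rewrite mulrDl.
  have -> : K * (y - x) / 2 ^+ k.+1 = K * (c - x) / 2 ^+ k.
    by rewrite /c exprS; field; rewrite expf_neq0.
  apply: lerD; first by apply: IH => //; exact: le_trans cy yB.
  have -> : K * (c - x) / 2 ^+ k = K * (y - c) / 2 ^+ k.
    by rewrite /c; field; rewrite expf_neq0.
  by apply: IH => //; exact: le_trans Ax xc.
have S0 : 0 <= S by apply: le_trans (MS A (lexx A) AB).
have t0 := tv_ge0 A0 AB.
have remS : `|rem A B| <= tv A B * S.
  apply/ler_addgt0Pr => e e0.
  pose k := Num.truncn (tv A B * (K * (B - A)) / e).
  have := bis k A B (lexx A) AB (lexx B); rewrite mulrDr => H.
  apply: le_trans H _; rewrite lerD2l mulrA ler_pdivrMr ?exprn_gt0//.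
  rewrite [leRHS]mulrC -ler_pdivrMr//; apply: le_trans (ltW (truncnS_gt _)) _.
  by rewrite -natrX ler_nat; exact: ltn_expl.
have -> : \int[mu]_(x in `[A, B]) (F x * m x) = rem A B + F B * M B - F A * M A.
  by rewrite /rem /cint; ring.
apply: le_trans (ler_normB _ _) _; apply: le_trans (lerD (ler_normD _ _) (lexx _)) _.
rewrite !normrM -/(tv A B).
have HA : `|F A| * `|M A| <= `|F A| * S by apply: ler_wpM2l => //; exact: MS.
have HB : `|F B| * `|M B| <= `|F B| * S by apply: ler_wpM2l => //; exact: MS.
by move: HA HB remS; rewrite !mulrDr ![S * _]mulrC; lra.
Qed.

End ByParts.
End BoundedVariationIntegral.

(** * Dilations of the bump *)

Section Scaling.
Context {R : realType}.
Implicit Types (eta s y : R).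

Lemma theta_mulr eta s y : 0 <= eta -> 1 <= s -> 0 < y ->
  theta eta (y * s) <= s `^ eta * theta eta y.
Proof.
move=> e0 s1 y0; have s0 : 0 < s by exact: lt_le_trans s1.
rewrite /theta powRM ?(ltW y0) ?(ltW s0)//.
have : 1 <= s `^ eta by rewrite -(powRr0 s); apply: ler_powR.
have := powR_gt0 eta y0; move: (y `^ eta) (s `^ eta) => t v t0 v1.
rewrite (mulrC t) -mulrA; apply: ler_wpM2l; first by lra.
apply: ler_wpM2l; first exact: ltW.
have tv : t <= v * t by rewrite ler_peMl// ltW.
by rewrite lef_pV2 ?posrE ?exprn_gt0 ?lerXn2r ?nnegrE; lra.
Qed.

Lemma theta_divr eta s y : 0 <= eta -> 1 <= s -> 0 < y ->
  theta eta (y / s) <= s `^ eta * theta eta y.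
Proof.
move=> e0 s1 y0; have s0 : 0 < s by exact: lt_le_trans s1.
have ys : 0 < y / s by rewrite divr_gt0.
rewrite -{2}(divfK (lt0r_neq0 s0) y) /theta (powRM eta (ltW ys) (ltW s0)).
have : 1 <= s `^ eta by rewrite -(powRr0 s); apply: ler_powR.
have := powR_gt0 eta ys; move: ((y / s) `^ eta) (s `^ eta) => t v t0 v1.
rewrite [leRHS](_ : _ = t * ((v / (1 + t * v)) ^+ 2)); last first.
  by field; rewrite gt_eqF//; nra.
apply: ler_wpM2l; first exact: ltW.
rewrite -exprVn lerXn2r ?nnegrE ?invr_ge0 ?divr_ge0//; [lra|lra|nra|].
rewrite ler_pdivlMr; last by nra.
by rewrite mulrC ler_pdivrMr; nra.
Qed.

End Scaling.

(** * Improper integrals *)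

Section ImproperFilter.
Context {R : realType}.

Lemma near_improper (P Q : R -> Prop) : (\forall x \near (0 : R)^'+, P x) ->
  (\forall x \near +oo, Q x) ->
  improper_filter (fun AB : R * R => P AB.1 /\ Q AB.2).
Proof. by move=> HP HQ; exists (P, Q). Qed.

#[global] Instance improper_filter_proper : ProperFilter (@improper_filter R).
Proof. exact: filter_prod_proper. Qed.

End ImproperFilter.

(** * Pointwise bound for the transform *)

Section Sufficiency.
Context {R : realType}.
Variables (a lam p sig C c0 C1 : R).
Hypotheses (a_gt0 : 0 < a) (lam_a_ge0 : 0 <= 4 * lam + a) (p1 : 1 < p).
Local Notation del := (hdim a lam).
Local Notation kap := (hrate a lam).
Hypotheses (kap_sig : kap < sig) (sig_del : sig < del).
Hypotheses (C_gt0 : 0 < C) (c0_gt1 : 1 < c0).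
Hypotheses (C1_gt0 : 0 < C1) (kb : forall s, 0 < s -> `|kprim a lam s| <= C1 * s `^ kap).
Implicit Types (A B x y u r rho s : R).
Notation mu := (@lebesgue_measure R).
Local Notation D0 := (`]0%R, +oo[%classic : set R).
Local Notation nc := (nu_const lam a).

(** The exponent of the bump: small enough for [theta eta] to dominate the decay
    rates [del - sig] at [0] and [sig - kap] at infinity, with room left in the
    latter for the dyadic sum to converge geometrically. *)
Definition decay : R := Num.min (del - sig) ((sig - kap) / 2).
Local Notation eta := decay.

Lemma decay_gt0 : 0 < eta.
Proof. by rewrite lt_min subr_gt0 sig_del divr_gt0// subr_gt0. Qed.

Lemma decay_le1 : eta <= del - sig.
Proof. by rewrite ge_min lexx. Qed.

Lemma decay_le2 : 2 * eta <= sig - kap.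
Proof.
by rewrite mulrC -ler_pdivlMr// ge_min lexx orbT.
Qed.

Lemma decay_le_sig : eta <= sig.
Proof.
by have := hrate_ge0 lam_a_ge0; have := decay_le2; have := decay_gt0; lra.
Qed.

Variables (F g : R -> R).
Hypotheses (bvF : locally_bv F) (mg : measurable_fun D0 g).
Hypotheses (g_ge0 : forall u, 0 < u -> 0 <= g u) (Fg : forall u, 0 < u -> `|F u| <= g u).
Hypothesis F0 : F x @[x --> +oo] --> (0 : R).
Hypothesis GMF : forall r b, 0 < r -> r <= b -> (total_variation r b F
   <= C%:E * \int[mu]_(u in `[(r / c0)%R, +oo[) (g u / u)%:E)%E.

Definition gweight u : R := g u * u `^ sig.
Hypothesis Xfin : (mnorm gweight p < +oo)%E.

Let h := gweight.
Let mh : measurable_fun D0 h.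
Proof. by apply: measurable_funM => //; apply: measurable_funTS; exact: measurable_powR. Qed.

Let h0 u : 0 < u -> 0 <= h u.
Proof. by move=> u0; rewrite mulr_ge0 ?powR_ge0// g_ge0. Qed.

Definition gconv rho : R := fine (mconv h eta rho).
Local Notation T := gconv.

Let Tfin rho : 0 < rho -> mconv h eta rho \is a fin_num.
Proof. by move=> r0; apply: (mconv_fin p1 decay_gt0 mh h0 Xfin). Qed.

Let T_ge0 rho : 0 <= T rho.
Proof. by apply: fine_ge0; exact: mconv_ge0. Qed.

Let intT (D : set R) (f : R -> R) K rho : measurable D -> D `<=` D0 -> 0 < rho ->
  0 <= K -> (forall u, D u -> 0 <= f u <= K * (h u * (theta eta (rho * u) / u))) ->
  (\int[mu]_(u in D) (f u)%:E <= (K * T rho)%:E)%E.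
Proof.
move=> mD DD r0 K0 fK.
have mth : measurable_fun D0 (fun u => h u * (theta eta (rho * u) / u)).
  by apply: measurable_funM => //; apply: measurable_continuous_gt0 => x x0; exact: theta_div_cont.
apply: (@le_trans _ _ (\int[mu]_(u in D) (K%:E * (h u * (theta eta (rho * u) / u))%:E))%E).
  apply: le_integral_ge0 => // u Du; first by rewrite lee_fin; case/andP: (fK _ Du).
  by rewrite -EFinM lee_fin; case/andP: (fK _ Du).
have th0 u : D0 u -> (0 <= (h u * (theta eta (rho * u) / u))%:E)%E.
  by move=> /D0P u0; rewrite lee_fin mulr_ge0 ?h0// divr_ge0 ?theta_ge0// ltW.
rewrite ge0_integralZl_EFin//; first last.
- by apply/measurable_EFinP; exact: measurable_funS mth.
- by move=> u /DD; exact: th0.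
rewrite EFinM; apply: lee_wpmul2l => //; rewrite /gconv fineK ?Tfin//.
by apply: ge0_subset_integral => //; exact/measurable_EFinP.
Qed.

(* the convolution varies slowly under dilations, as the bump does *)
Let T_scale rho s : 0 < rho -> 1 <= s -> T (rho / s) <= s `^ eta * T rho.
Proof.
move=> r0 s1; have s0 : 0 < s by exact: lt_le_trans s1.
have rs : 0 < rho / s by rewrite divr_gt0.
rewrite -lee_fin {1}/gconv fineK ?Tfin//; apply: intT => //; first exact: powR_ge0.
move=> u /D0P u0.
apply/andP; split.
  by apply: mulr_ge0; [exact: h0 | apply: divr_ge0; [exact: theta_ge0 | exact: ltW]].
rewrite [leRHS]mulrCA (mulrA (s `^ _)); apply: ler_wpM2l; first exact: h0.
rewrite ler_pM2r ?invr_gt0// mulrAC; apply: theta_divr => //; first exact/ltW/decay_gt0.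
by rewrite mulr_gt0.
Qed.

Let T_scale' rho s : 0 < rho -> 1 <= s -> T (rho * s) <= s `^ eta * T rho.
Proof.
move=> r0 s1; have s0 : 0 < s by exact: lt_le_trans s1.
have rs : 0 < rho * s by rewrite mulr_gt0.
rewrite -lee_fin {1}/gconv fineK ?Tfin//; apply: intT => //; first exact: powR_ge0.
move=> u /D0P u0.
apply/andP; split.
  by apply: mulr_ge0; [exact: h0 | apply: divr_ge0; [exact: theta_ge0 | exact: ltW]].
rewrite [leRHS]mulrCA (mulrA (s `^ _)); apply: ler_wpM2l; first exact: h0.
rewrite ler_pM2r ?invr_gt0// mulrAC; apply: theta_mulr => //; first exact/ltW/decay_gt0.
by rewrite mulr_gt0.
Qed.

Let gE u : 0 < u -> g u = h u * u `^ (- sig).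
Proof. by move=> u0; rewrite /h /gweight powRN mulfK// gt_eqF// powR_gt0. Qed.

(* the averages in the general monotonicity condition, in terms of [T] *)
Let tail_int y : 0 < y ->
  (\int[mu]_(u in `[y, +oo[) (g u / u)%:E <= (4 * y `^ (- sig) * T y^-1)%:E)%E.
Proof.
move=> y0; apply: intT => //.
- by move=> u /=; rewrite !in_itv/= !andbT; exact: lt_le_trans.
- by rewrite invr_gt0.
- by rewrite mulr_ge0// powR_ge0.
move=> u /=; rewrite in_itv/= andbT => yu; have u0 := lt_le_trans y0 yu.
rewrite divr_ge0 ?g_ge0 ?(ltW u0)//= gE//.
have : (y^-1 * u) `^ (- sig) <= 4 * theta eta (y^-1 * u).
  apply: theta_large; [exact/ltW/decay_gt0|exact: decay_le_sig|].
  by rewrite ler_pdivlMl// mulr1.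
move=> H; have := ler_wpM2l (powR_ge0 y (- sig)) H.
rewrite -powRM ?mulr_ge0 ?invr_ge0 ?(ltW y0) ?(ltW u0)// mulVKf ?gt_eqF// => H'.
have hu0 : 0 <= h u / u by rewrite divr_ge0 ?h0// ltW.
have := ler_wpM2l hu0 H'.
congr (_ <= _); ring.
Qed.

Let low_int A B : 0 < A -> A <= B ->
  (\int[mu]_(u in `[A, B]) (g u * u `^ (del - 1))%:E
    <= (4 * B `^ (del - sig) * T B^-1)%:E)%E.
Proof.
move=> A0 AB; have B0 := lt_le_trans A0 AB; apply: intT => //.
- by move=> u /=; rewrite !in_itv/= andbT => /andP[Au _]; exact: lt_le_trans Au.
- by rewrite invr_gt0.
- by rewrite mulr_ge0// powR_ge0.
move=> u /=; rewrite in_itv/= => /andP[Au uB]; have u0 := lt_le_trans A0 Au.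
rewrite mulr_ge0 ?g_ge0 ?powR_ge0//= gE//.
have : (B^-1 * u) `^ (del - sig) <= 4 * theta eta (B^-1 * u).
  apply: theta_small; [exact/ltW/decay_gt0|exact: decay_le1|].
  by rewrite mulr_gt0 ?invr_gt0//= ler_pdivrMl// mulr1.
move=> H; have := ler_wpM2l (powR_ge0 B (del - sig)) H.
rewrite -powRM ?mulr_ge0 ?invr_ge0 ?(ltW B0) ?(ltW u0)// mulVKf ?gt_eqF// => H'.
have hu0 : 0 <= h u / u by rewrite divr_ge0 ?h0// ltW.
have := ler_wpM2l hu0 H'.
have -> : h u / u * u `^ (del - sig) = h u * u `^ (- sig) * u `^ (del - 1).
  rewrite powRB1// powRB ?(gt_eqF u0) ?implybT// powRN; ring.
congr (_ <= _); ring.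
Qed.

Definition tvconst : R := 4 * C * c0 `^ (sig + eta).

Let tvconst_ge0 : 0 <= tvconst.
Proof. by rewrite !mulr_ge0 ?powR_ge0// ltW. Qed.

Let tv_bound r b : 0 < r -> r <= b ->
  (total_variation r b F <= (tvconst * (r `^ (- sig) * T r^-1))%:E)%E.
Proof.
move=> r0 rb; apply: le_trans (GMF r0 rb) _.
have c00 : 0 < c0 by exact: lt_trans c0_gt1.
have rc : 0 < r / c0 by rewrite divr_gt0.
apply: (@le_trans _ _ (C%:E * (4 * (r / c0) `^ (- sig) * T (r / c0)^-1)%:E)%E).
  by apply: lee_wpmul2l; [rewrite lee_fin ltW | exact: tail_int].
rewrite -EFinM lee_fin invf_div.
have H : T (c0 / r) <= c0 `^ eta * T r^-1.
  by rewrite mulrC; apply: T_scale'; [rewrite invr_gt0 | exact: ltW].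
have -> : (r / c0) `^ (- sig) = r `^ (- sig) * c0 `^ sig.
  rewrite powRM ?invr_ge0 ?ltW// -(powR_inv1 (ltW c00)) -powRrM mulN1r opprK//.
rewrite /tvconst powRD; last by rewrite (gt_eqF c00) implybT.
have K0 : 0 <= C * 4 * (r `^ (- sig) * c0 `^ sig).
  by apply: mulr_ge0; [rewrite mulr_ge0// ltW | rewrite mulr_ge0 ?powR_ge0].
have := ler_wpM2l K0 H; congr (_ <= _); ring.
Qed.

(* [F] vanishes at infinity, so its variation on the tail bounds its value *)
Let F_bound r : 0 < r -> `|F r| <= tvconst * (r `^ (- sig) * T r^-1).
Proof.
move=> r0; apply/ler_addgt0Pr => e e0.
have [b [rb Fb]] : exists b, r <= b /\ `|F b| < e.
  have /cvgr0Pnorm_lt/(_ _ e0) Fe := F0.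
  have : \forall b \near +oo, r <= b /\ `|F b| < e.
    near=> b; split; last by near: b.
    by near: b; apply: nbhs_pinfty_ge; exact: num_real.
  move=> [N [_ NP]]; exists (N + 1).
  by apply: NP; rewrite ltrDl.
have : `|F b - F r| <= tvconst * (r `^ (- sig) * T r^-1).
  rewrite -lee_fin; apply: le_trans (tv_bound r0 rb); exact: total_variation_ge.
move: (ler_normB (F b) (F b - F r)); rewrite opprB addrC subrK; lra.
Unshelve. all: by end_near. Qed.

Variable rho : R.
Hypothesis rho0 : 0 < rho.

(* the kernel with the density of the measure, and a primitive *)
Let m r := kern a lam (rho * r) * nu_density lam a r.
Let M := hprim a lam rho.

Let cm r : 0 < r -> {for r, continuous m}.
Proof. by move=> r0; exact: hker_cont. Qed.

Let dM r : 0 < r -> is_derive r 1 M (m r).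
Proof. by move=> r0; exact: der_hprim. Qed.

Definition tint A B : R := \int[mu]_(r in `[A, B]) (F r * m r).

Let nc0 : 0 <= nc. Proof. by apply/ltW/nu_const_gt0. Qed.

Lemma tint_low A B : 0 < A -> A <= B ->
  `|tint A B| <= 4 * nc * B `^ (del - sig) * T B^-1.
Proof.
move=> A0 AB; have I := bv_mul_integrable bvF cm A0 AB.
apply: le_trans (le_normr_Rintegral _ I) _ => //.
rewrite -lee_fin /Rintegral fineK; last first.
  by apply: integrable_fin_num => //; exact: integrable_norm.
apply: (@le_trans _ _ (\int[mu]_(u in `[A, B]) (nc%:E * (g u * u `^ (del - 1))%:E))%E).
  apply: le_integral_ge0 => // u; rewrite /= in_itv/= => /andP[Au uB].
  have u0 := lt_le_trans A0 Au.
  rewrite -EFinM lee_fin /m nu_densityE !normrM (ger0_norm nc0) (ger0_norm (powR_ge0 _ _)).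
  rewrite [leLHS](_ : _ = nc * (`|F u| * `|kern a lam (rho * u)| * u `^ (del - 1))); last by ring.
  apply: ler_wpM2l => //.
  apply: ler_wpM2r; first exact: powR_ge0.
  rewrite -[leRHS]mulr1; apply: ler_pM => //; [exact: Fg | exact: kern_le1].
rewrite ge0_integralZl_EFin//; first last.
- apply/measurable_EFinP; apply: measurable_funM.
    apply: measurable_funS mg => //.
    by move=> u /=; rewrite !in_itv/= andbT => /andP[Au _]; exact: lt_le_trans Au.
  by apply: measurable_funTS; exact: measurable_powR.
- move=> u /=; rewrite in_itv/= => /andP[Au _]; rewrite lee_fin mulr_ge0 ?powR_ge0// g_ge0//.
  exact: lt_le_trans Au.
have := lee_wpmul2l (_ : (0 <= nc%:E)%E) (low_int A0 AB) => /(_ _).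
rewrite lee_fin => /(_ nc0) H; apply: le_trans H _.
by rewrite -EFinM lee_fin; apply: eq_leW; ring.
Qed.

(* the ratio of the bounds on consecutive dyadic intervals *)
Let ratio : R := 2 `^ (kap - sig + eta).

Let ratio_bnd : 0 <= ratio < 1.
Proof.
rewrite powR_ge0/= /ratio; have e0 : 0 < sig - kap - eta.
  by have := decay_le2; have := decay_gt0; lra.
have : 1 `^ (sig - kap - eta) < 2 `^ (sig - kap - eta) :> R.
  by apply: gt0_ltr_powR; rewrite ?nnegrE// ltr1n.
rewrite powR1 => H; have -> : kap - sig + eta = - (sig - kap - eta) by ring.
by rewrite powRN invf_lt1// powR_gt0.
Qed.

Definition hconst : R := 4 * nc * C1 * 2 `^ kap * tvconst / (1 - ratio).

Lemma hconst_ge0 : 0 <= hconst.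
Proof.
have /andP[_ r1] := ratio_bnd.
apply: divr_ge0; last by rewrite subr_ge0 ltW.
apply: mulr_ge0 => //; apply: mulr_ge0; last exact: powR_ge0.
by apply: mulr_ge0; [exact: mulr_ge0 | exact: ltW].
Qed.

Let hc_ge0 : 0 <= hconst. Proof. exact: hconst_ge0. Qed.

Let E A := hconst * (rho `^ (kap - del) * A `^ (kap - sig) * T A^-1).

(* one dyadic interval: integration by parts *)
Let tint_block A B : 0 < A -> A <= B -> B <= 2 * A -> `|tint A B| <= (1 - ratio) * E A.
Proof.
move=> A0 AB B2; have B0 := lt_le_trans A0 AB.
pose S := nc * rho `^ (- del) * (C1 * (rho * (2 * A)) `^ kap).
have k0 := hrate_ge0 lam_a_ge0.
have MS x : A <= x -> x <= B -> `|M x| <= S.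
  move=> Ax xB; have x0 := lt_le_trans A0 Ax.
  rewrite /M /hprim normrM ger0_norm ?mulr_ge0 ?powR_ge0//.
  apply: ler_wpM2l; first by rewrite mulr_ge0 ?powR_ge0.
  apply: le_trans (kb _) _; first by rewrite mulr_gt0.
  apply: ler_wpM2l; first exact: ltW.
  apply: ge0_ler_powR; rewrite ?nnegrE ?mulr_ge0 ?(ltW rho0) ?(ltW x0) ?(ltW A0)//.
  by apply: ler_wpM2l; [exact: ltW | exact: le_trans xB B2].
apply: le_trans (bv_by_parts bvF cm dM A0 AB MS) _.
have S0 : 0 <= S by apply: le_trans (MS A (lexx A) AB).
set V := tvconst * (A `^ (- sig) * T A^-1).
have H1 : `|F A| <= V by exact: F_bound.
have H3 : fine (total_variation A B F) <= V.
  rewrite -lee_fin fineK; first exact: tv_bound.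
  by rewrite ge0_fin_numE ?bvF// total_variation_ge0.
have H2 : `|F B| <= V + V.
  have TV : `|F B - F A| <= V.
    by rewrite -lee_fin; apply: le_trans (tv_bound A0 AB); exact: total_variation_ge.
  by have := ler_normD (F A) (F B - F A); rewrite addrC subrK; lra.
apply: (@le_trans _ _ (S * (4 * V))).
  by apply: ler_wpM2l => //; lra.
have /andP[_ r1] := ratio_bnd.
apply: eq_leW; rewrite /S /V /E /hconst.
rewrite (powRM kap (ltW rho0)) ?mulr_ge0 ?(ltW A0)// (powRM kap (ler0n R 2) (ltW A0)).
have -> : rho `^ (kap - del) = rho `^ kap * rho `^ (- del).
  by rewrite -powRD// (gt_eqF rho0) implybT.
have -> : A `^ (kap - sig) = A `^ kap * A `^ (- sig).
  by rewrite -powRD// (gt_eqF A0) implybT.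
by field; rewrite gt_eqF// subr_gt0.
Qed.

Let E_ge0 A : 0 <= E A.
Proof. by apply: mulr_ge0 => //; rewrite mulr_ge0// mulr_ge0 ?powR_ge0. Qed.

Let E_double A : 0 < A -> E (2 * A) <= ratio * E A.
Proof.
move=> A0; have Ai0 : 0 < A^-1 by rewrite invr_gt0.
have H : T (2 * A)^-1 <= 2 `^ eta * T A^-1.
  by rewrite invfM mulrC; apply: T_scale => //; exact: ler1n.
have K0 : 0 <= hconst * rho `^ (kap - del) * (2 `^ (kap - sig) * A `^ (kap - sig)).
  apply: mulr_ge0; last by apply: mulr_ge0; exact: powR_ge0.
  by apply: mulr_ge0; [exact: hconst_ge0 | exact: powR_ge0].
have rE : ratio = 2 `^ (kap - sig) * 2 `^ eta.
  by rewrite -powRD// pnatr_eq0 implybT.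
have := ler_wpM2l K0 H; rewrite rE /E (powRM _ (ler0n R 2) (ltW A0)).
by move: (T _) (T _) => T1 T2; congr (_ <= _); ring.
Qed.

Lemma tint_split A x B : 0 < A -> A <= x -> x <= B -> tint A B = tint A x + tint x B.
Proof. by move=> A0 Ax xB; exact: (bv_integral_split bvF cm A0 Ax xB). Qed.

(** Sum of a geometric series over dyadic intervals, by induction on the number
    of doublings needed to reach [B]. *)
Lemma tint_high A B : 0 < A -> A <= B ->
  `|tint A B| <= hconst * (rho `^ (kap - del) * A `^ (kap - sig) * T A^-1).
Proof.
move=> A0 AB; have /andP[r0 r1] := ratio_bnd.
have ind N : forall A, 0 < A -> A <= B -> B <= 2 ^+ N * A -> `|tint A B| <= E A.
  elim: N => [|N IH] {A0 AB}A A0 AB BN.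
    apply: le_trans (tint_block A0 AB _) _; first by rewrite expr0 in BN; lra.
    by have := E_ge0 A; move: (E A) => e; nra.
  have [B2|B2] := leP B (2 * A).
    apply: le_trans (tint_block A0 AB B2) _.
    by have := E_ge0 A; move: (E A) => e; nra.
  have A2 : A <= 2 * A by lra.
  have A20 : 0 < 2 * A by lra.
  rewrite (tint_split A0 A2 (ltW B2)); apply: le_trans (ler_normD _ _) _.
  have H1 := tint_block A0 A2 (lexx _).
  have H2 : `|tint (2 * A) B| <= ratio * E A.
    apply: le_trans (E_double A0); apply: IH => //; first exact: ltW.
    by rewrite mulrA -exprSr.
  by apply: le_trans (lerD H1 H2) _; rewrite mulrBl mul1r subrK.
pose N := Num.truncn (B / A).
apply: (ind N.+1) => //; rewrite -ler_pdivrMr//.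
apply: le_trans (ltW (truncnS_gt _)) _.
by rewrite -natrX ler_nat ltnW// ltn_expl.
Qed.

(** The oscillation of the kernel is only exploited beyond [1 / rho]. *)
Lemma tint_bound A B : 0 < A -> A <= rho^-1 -> rho^-1 <= B ->
  `|tint A B| <= (4 * nc + hconst) * (rho `^ (sig - del) * T rho).
Proof.
move=> A0 Ar rB; have ri0 : 0 < rho^-1 by rewrite invr_gt0.
rewrite (tint_split A0 Ar rB); apply: le_trans (ler_normD _ _) _.
have H1 := tint_low A0 Ar; have H2 := tint_high ri0 rB.
have pV s : rho^-1 `^ s = rho `^ (- s).
  by rewrite -[rho^-1]powR_inv1 ?(ltW rho0)// -powRrM mulN1r.
apply: le_trans (lerD H1 H2) _; rewrite invrK !pV opprB.
have -> : rho `^ (kap - del) * rho `^ (- (kap - sig)) = rho `^ (sig - del).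
  by rewrite -powRD ?(gt_eqF rho0) ?implybT//; congr (_ `^ _); ring.
by apply: eq_leW; ring.
Qed.

Let TX : R := (1 + eta^-1) * (fine (mnorm h p)) `^ p^-1.

Let T_unif r : 0 < r -> T r <= TX.
Proof.
move=> r0; rewrite -lee_fin /gconv fineK ?Tfin//.
exact: (mconv_unif p1 decay_gt0 mh h0 Xfin).
Qed.

Let TX_ge0 : 0 <= TX.
Proof. by apply: le_trans (T_unif ltr01). Qed.

Lemma hankel_truncE A B : 0 < A -> hankel_trunc lam a F rho (A, B) = tint A B.
Proof.
move=> A0; apply: eq_Rintegral => r; rewrite inE/= in_itv/= => /andP[Ar _].
have r0 := lt_le_trans A0 Ar.
by rewrite hankel_kernE// -mulrA.
Qed.

Lemma tint_low_small e : 0 < e -> \forall x \near (0 : R)^'+,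
  forall A, 0 < A -> A <= x -> `|tint A x| < e.
Proof.
move=> e0; pose K := 4 * nc * TX + 1.
have K0 : 0 < K by rewrite ltr_wpDl// mulr_ge0// mulr_ge0.
have ds : 0 < del - sig by rewrite subr_gt0.
have /cvgr0Pnorm_lt/(_ (e / K)) := powR_cvg0 ds.
rewrite divr_gt0// => /(_ isT) H; near=> x => A A0 Ax.
have x0 := lt_le_trans A0 Ax.
have xe : x `^ (del - sig) < e / K.
  by rewrite -[ltLHS]ger0_norm ?powR_ge0//; near: x.
apply: le_lt_trans (tint_low A0 Ax) _.
apply: (@le_lt_trans _ _ (K * x `^ (del - sig))); last by rewrite mulrC -ltr_pdivlMr.
rewrite mulrAC; apply: ler_wpM2r; first exact: powR_ge0.
apply: (@le_trans _ _ (4 * nc * TX)); last by rewrite lerDl.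
by apply: ler_wpM2l; [exact: mulr_ge0 | apply: T_unif; rewrite invr_gt0].
Unshelve. all: by end_near. Qed.

Lemma tint_high_small e : 0 < e -> \forall x \near +oo,
  forall B, x <= B -> `|tint x B| < e.
Proof.
move=> e0; pose K := hconst * rho `^ (kap - del) * TX + 1.
have K0 : 0 < K by rewrite ltr_wpDl// mulr_ge0// mulr_ge0// powR_ge0.
have ds : 0 < sig - kap by rewrite subr_gt0.
have /cvgr0Pnorm_lt/(_ (e / K)) := powRN_cvgy ds.
rewrite divr_gt0// => /(_ isT) H; near=> x => B xB.
have x0 : 0 < x by near: x; apply: nbhs_pinfty_gt; exact: num_real.
have xe : x `^ (- (sig - kap)) < e / K.
  by rewrite -[ltLHS]ger0_norm ?powR_ge0//; near: x.
apply: le_lt_trans (tint_high x0 xB) _; rewrite opprB in xe.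
apply: (@le_lt_trans _ _ (K * x `^ (kap - sig))); last by rewrite mulrC -ltr_pdivlMr.
rewrite !mulrA mulrAC; apply: ler_wpM2r; first exact: powR_ge0.
apply: (@le_trans _ _ (hconst * rho `^ (kap - del) * TX)); last by rewrite lerDl.
apply: ler_wpM2l; first by rewrite mulr_ge0// powR_ge0.
by apply: T_unif; rewrite invr_gt0.
Unshelve. all: by end_near. Qed.

(** Cauchy's criterion: changing either end point of the truncation costs an
    integral near [0] or near infinity, both of which are small. *)
Lemma hankel_trunc_cvg : cvg (hankel_trunc lam a F rho @ improper_filter).
Proof.
apply/cauchy_cvgP; apply: cauchy_exP => e e0.
have e20 : 0 < e / 2 by rewrite divr_gt0.
have Hl := tint_low_small e20; have Hh := tint_high_small e20.
near (0 : R)^'+ => A0; near +oo_R => B0.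
have A00 : 0 < A0 by [].
have AB0 : A0 <= B0.
  have A1 : A0 <= 1 by near: A0; exact: nbhs_right_le.
  by apply: le_trans A1 _; near: B0; apply: nbhs_pinfty_ge; exact: num_real.
have HA0 : forall A, 0 < A -> A <= A0 -> `|tint A A0| < e / 2 by near: A0.
have HB0 : forall B, B0 <= B -> `|tint B0 B| < e / 2 by near: B0.
exists (tint A0 B0).
have Pl : \forall A \near (0 : R)^'+, 0 < A <= A0.
  near=> A; apply/andP; split; first by [].
  by near: A; exact: nbhs_right_le.
have Ph : \forall B \near +oo, B0 <= B by apply: nbhs_pinfty_ge; exact: num_real.
apply: filterS (near_improper Pl Ph) => -[A B] /= [/andP[A_gt0 AA0] BB0].
rewrite /ball/= hankel_truncE// (tint_split A_gt0 AA0 (le_trans AB0 BB0)).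
rewrite (tint_split A00 AB0 BB0) opprD addrA addrAC.
rewrite [X in `|X|](_ : _ = - (tint A A0 + tint B0 B)); last by ring.
rewrite normrN; apply: le_lt_trans (ler_normD _ _) _.
by rewrite [ltRHS]splitr; apply: ltrD; [exact: HA0 | exact: HB0].
Unshelve. all: by end_near. Qed.

Lemma hankel_trunc_lim_le :
  `|lim (hankel_trunc lam a F rho @ improper_filter)|
    <= (4 * nc + hconst) * (rho `^ (sig - del) * T rho).
Proof.
have ri0 : 0 < rho^-1 by rewrite invr_gt0.
have Pl : \forall A \near (0 : R)^'+, 0 < A <= rho^-1.
  near=> A; apply/andP; split; first by [].
  by near: A; exact: nbhs_right_le.
have Ph : \forall B \near +oo, rho^-1 <= B.
  by apply: nbhs_pinfty_ge; exact: num_real.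
have bnd : \forall AB \near @improper_filter R,
    `|hankel_trunc lam a F rho AB| <= (4 * nc + hconst) * (rho `^ (sig - del) * T rho).
  apply: filterS (near_improper Pl Ph) => -[A B] /= [/andP[A0 Ar] rB].
  by rewrite hankel_truncE//; exact: tint_bound.
rewrite ler_norml; apply/andP; split.
  apply: limr_ge; first exact: hankel_trunc_cvg.
  by apply: filterS bnd => AB; rewrite ler_norml => /andP[].
apply: limr_le; first exact: hankel_trunc_cvg.
by apply: filterS bnd => AB; rewrite ler_norml => /andP[].
Unshelve. all: by end_near. Qed.

End Sufficiency.

(** * Reduction to real and imaginary parts *)

Section ComplexValued.
Context {R : realType}.
Implicit Types (f : R -> R[i]) (z : R[i]) (a b x r : R).
Local Notation D0 := (`]0%R, +oo[%classic : set R).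

Lemma normcE z : normc z = Num.sqrt (complex.Re z ^+ 2 + complex.Im z ^+ 2).
Proof. by case: z. Qed.

Lemma normc_Re_le z : `|complex.Re z| <= normc z.
Proof.
rewrite normcE -sqrtr_sqr; apply: ler_wsqrtr; rewrite lerDl; exact: sqr_ge0.
Qed.

Lemma normc_Im_le z : `|complex.Im z| <= normc z.
Proof.
rewrite normcE -sqrtr_sqr; apply: ler_wsqrtr; rewrite lerDr; exact: sqr_ge0.
Qed.

Lemma normc_ge0 z : 0 <= normc z.
Proof. by rewrite normcE sqrtr_ge0. Qed.

Lemma normc_le_ReIm z : normc z <= `|complex.Re z| + `|complex.Im z|.
Proof.
rewrite normcE -[leRHS]ger0_norm ?addr_ge0// -sqrtr_sqr; apply: ler_wsqrtr.
rewrite -(real_normK (num_real (complex.Re z))) -(real_normK (num_real (complex.Im z))).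
have := mulr_ge0 (normr_ge0 (complex.Re z)) (normr_ge0 (complex.Im z)).
by move: `|_| `|_| => s t; nra.
Qed.

Lemma normc_real (x : R) z : 0 <= x -> normc (real_complex R x * z) = x * normc z.
Proof.
move=> x0; case: z => s t; rewrite !normcE /= !mul0r subr0 addr0.
by rewrite !exprMn -mulrDr sqrtrM ?sqr_ge0// sqrtr_sqr ger0_norm.
Qed.

Section Part.
Variable part : R[i] -> R.
Hypothesis partB : forall z w, part (z - w) = part z - part w.
Hypothesis part_le : forall z, `|part z| <= normc z.

(** A part of a complex number is 1-Lipschitz, hence it does not increase
    variations. *)
Lemma total_variation_part_le a b f :
  (total_variation a b (part \o f) <= ctotal_variation a b f)%E.
Proof.
apply: ge_ereal_sup => _ /= [_ [s abs <-] <-].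
apply: le_ereal_sup_tmp; exists (cvariation a b f s)%:E; first by exists s.
rewrite lee_fin; apply: ler_sum => i _ /=; rewrite -partB; exact: part_le.
Qed.

Lemma locally_bv_part f : locally_BV f -> locally_bv (part \o f).
Proof.
by move=> bvf a b a0 ab; apply: le_lt_trans (bvf _ _ a0 ab); exact: total_variation_part_le.
Qed.

Lemma total_variation_part_tail r b f : r <= b ->
  (total_variation r b (part \o f) <= tail_variation r f)%E.
Proof.
move=> rb; apply: le_trans (total_variation_part_le _ _ _) _.
by apply: ereal_sup_ubound => /=; exists b => //; rewrite in_itv/= rb.
Qed.

Lemma cvg0_part f : normc (f x) @[x --> +oo] --> (0 : R) ->
  (part \o f) x @[x --> +oo] --> (0 : R).
Proof.
move=> f0; apply/cvgr0Pnorm_lt => e e0.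
have /cvgr0Pnorm_lt/(_ _ e0) := f0; apply: filterS => x /=.
by rewrite ger0_norm ?normc_ge0//; exact: le_lt_trans.
Qed.

End Part.

Lemma ReB z w : complex.Re (z - w) = complex.Re z - complex.Re w.
Proof. by case: z; case: w. Qed.

Lemma ImB z w : complex.Im (z - w) = complex.Im z - complex.Im w.
Proof. by case: z; case: w. Qed.

Lemma measurable_normc f : locally_BV f -> measurable_fun D0 (fun x => normc (f x)).
Proof.
move=> bvf; have mR := bv_measurable (locally_bv_part ReB normc_Re_le bvf).
have mI := bv_measurable (locally_bv_part ImB normc_Im_le bvf).
have -> : (fun x => normc (f x)) =
    fun x => (complex.Re (f x) ^+ 2 + complex.Im (f x) ^+ 2) `^ 2^-1.
  by apply/funext => x; rewrite normcE powR12_sqrt// addr_ge0// sqr_ge0.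
apply: (measurableT_comp (measurable_powR _)).
by apply: measurable_funD; apply: measurable_funX.
Qed.

End ComplexValued.

(** * Sufficiency of the conditions *)

Section PittSufficient.
Context {R : realType}.
Variables (a lam p q beta gamma : R).
Hypotheses (a_gt0 : 0 < a) (lam_a_ge0 : 0 <= 4 * lam + a) (p1 : 1 < p) (pq : p <= q).
Local Notation del := (hdim a lam).
Local Notation kap := (hrate a lam).
Local Notation nc := (nu_const lam a).
Notation mu := (@lebesgue_measure R).
Local Notation D0 := (`]0%R, +oo[%classic : set R).

(** The index of homogeneity of the weighted space on the right-hand side. *)
Definition pittidx : R := beta + del / p.
Local Notation sig := pittidx.

Let p0 : 0 < p. Proof. exact: lt_trans p1. Qed.

(** In terms of the Haar measure [du / u] the weights combine into the single
    power [u `^ pittidx]. *)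
Lemma nu_integrand (f : R -> R[i]) u : 0 < u ->
  normc (power_weight beta f u) `^ p * nu_density lam a u
   = nc * (gweight sig (fun x => normc (f x)) u `^ p / u).
Proof.
move=> u0; rewrite /power_weight normc_real ?powR_ge0// nu_densityE /gweight powRB1//.
rewrite !powRM ?powR_ge0 ?normc_ge0// -!powRrM /pittidx.
have -> : (beta + del / p) * p = beta * p + del by field; rewrite gt_eqF.
by rewrite (@powRD _ u (beta * p) del) ?(gt_eqF u0) ?implybT//; ring.
Qed.

Lemma nu_normE (f : R -> R[i]) : measurable_fun D0 (fun x => normc (f x)) ->
  nu_norm lam a p (power_weight beta f)
  = ((nc%:E * mnorm (gweight sig (fun x => normc (f x))) p) `^ p^-1)%E.
Proof.
move=> mf; congr (_ `^ _)%E.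
have nc0 : 0 <= nc by apply/ltW/nu_const_gt0.
rewrite -ge0_integralZl_EFin//.
- by apply: eq_integral => u; rewrite inE => /D0P u0; rewrite nu_integrand// EFinM.
- by move=> u /D0P u0; rewrite lee_fin divr_ge0 ?powR_ge0// ltW.
- apply/measurable_EFinP; apply: measurable_funM; last exact: measurable_inv_D0.
  apply: (measurableT_comp (measurable_powR p)).
  by apply: measurable_funM => //; apply: measurable_funTS; exact: measurable_powR.
Qed.

Lemma nu_norm_lty (X : \bar R) : (0 <= X)%E ->
  ((nc%:E * X) `^ p^-1 < +oo)%E -> (X < +oo)%E.
Proof.
move=> X0 /lty_poweRy; rewrite invr_eq0 gt_eqF// => /(_ isT).
rewrite !ltey; apply: contraNN => /eqP ->.
by rewrite gt0_muley ?lte_fin ?nu_const_gt0.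
Qed.

(** The pointwise bound, applied to the real and imaginary parts, followed by
    Young's inequality. *)
Lemma pitt_sufficient : kap < sig -> sig < del ->
  beta - gamma = del * (1 - 1 / p - 1 / q) -> Pitt_GM lam a p q beta gamma.
Proof.
move=> ks sd scal C c0 C0 c01.
have [C1 C10 kb] := kprim_bound a_gt0 lam_a_ge0.
pose eta := decay a lam sig.
have eta0 : 0 < eta by exact: decay_gt0.
have q0 : 0 < q by exact: lt_le_trans pq.
have ncp : 0 < nc by exact: nu_const_gt0.
pose K := 4 * nc + hconst a lam sig C c0 C1.
pose L := ((2 * K) `^ q * nc) * ((1 + eta^-1) `^ q / eta).
exists (L `^ q^-1 / nc `^ p^-1) => f [bvf f0 GMf] Nf.
set g := fun x => normc (f x).
have mg := measurable_normc bvf.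
have g_ge0 (u : R) : 0 < u -> 0 <= g u by move=> _; exact: normc_ge0.
have X0 := @mnorm_ge0 _ (gweight sig g) p.
have NE := nu_normE mg.
have Xfin : (mnorm (gweight sig g) p < +oo)%E.
  by apply: nu_norm_lty => //; rewrite -NE.
have GMpart (part : R[i] -> R) : (forall z w, part (z - w) = part z - part w) ->
    (forall z, `|part z| <= normc z) -> forall r b : R, 0 < r -> r <= b ->
    (total_variation r b (part \o f) <= C%:E * \int[mu]_(u in `[(r / c0)%R, +oo[) (g u / u)%:E)%E.
  move=> pB ple r b r0 rb; apply: le_trans (GMf r r0).
  exact: total_variation_part_tail.
have cvgP (part : R[i] -> R) (rho : R) : (forall z w, part (z - w) = part z - part w) ->
    (forall z, `|part z| <= normc z) -> 0 < rho ->
    cvg (hankel_trunc lam a (part \o f) rho @ improper_filter).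
  move=> pB ple r0.
  exact: (hankel_trunc_cvg a_gt0 lam_a_ge0 p1 ks sd C0 c01 C10 kb
    (locally_bv_part pB ple bvf) mg g_ge0 (fun u _ => ple (f u)) (cvg0_part ple f0)
    (GMpart _ pB ple) Xfin r0).
have limP (part : R[i] -> R) (rho : R) : (forall z w, part (z - w) = part z - part w) ->
    (forall z, `|part z| <= normc z) -> 0 < rho ->
    `|lim (hankel_trunc lam a (part \o f) rho @ improper_filter)|
     <= K * (rho `^ (sig - del) * gconv a lam sig g rho).
  move=> pB ple r0.
  exact: (hankel_trunc_lim_le a_gt0 lam_a_ge0 p1 ks sd C0 c01 C10 kb
    (locally_bv_part pB ple bvf) mg g_ge0 (fun u _ => ple (f u)) (cvg0_part ple f0)
    (GMpart _ pB ple) Xfin r0).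
split.
  by move=> rho r0; split; [exact: (cvgP _ _ ReB normc_Re_le) | exact: (cvgP _ _ ImB normc_Im_le)].
have Hb (rho : R) : 0 < rho ->
    normc (hankel lam a f rho) <= 2 * K * (rho `^ (sig - del) * gconv a lam sig g rho).
  move=> r0; apply: le_trans (normc_le_ReIm _) _; rewrite /hankel/=.
  have -> (w : R) : 2 * K * w = K * w + K * w by ring.
  by apply: lerD; [exact: (limP _ _ ReB normc_Re_le r0) | exact: (limP _ _ ImB normc_Im_le r0)].
have T0 rho : 0 <= gconv a lam sig g rho.
  by apply: fine_ge0; apply: mconv_ge0 => u u0; rewrite mulr_ge0 ?powR_ge0// g_ge0.
have mgw : measurable_fun D0 (gweight sig g).
  by apply: measurable_funM => //; apply: measurable_funTS; exact: measurable_powR.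
have gw0 (u : R) : 0 < u -> 0 <= gweight sig g u.
  by move=> u0; rewrite mulr_ge0 ?powR_ge0// g_ge0.
have K2 : 0 <= 2 * K.
  rewrite mulr_ge0// addr_ge0//; first by rewrite mulr_ge0// ltW.
  by apply: hconst_ge0.
have d0 : 0 <= (2 * K) `^ q * nc by rewrite mulr_ge0 ?powR_ge0// ltW.
set X := fine (mnorm (gweight sig g) p).
have XE : mnorm (gweight sig g) p = X%:E by rewrite fineK// ge0_fin_numE.
have Xge0 : 0 <= X by exact: fine_ge0.
have L0 : 0 <= L by rewrite mulr_ge0// divr_ge0 ?powR_ge0// ltW.
have main : (\int[mu]_(u in `]0%R, +oo[)
    ((normc (power_weight (- gamma) (hankel lam a f) u)) `^ q * nu_density lam a u)%:E
    <= (L * X `^ (q / p))%:E)%E.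
  have := mconv_Lq p1 eta0 mgw gw0 Xfin pq d0.
  rewrite mulrA -/X -/L; apply: le_trans.
  apply: le_integral_ge0 => // u /D0P u0; rewrite lee_fin.
    by rewrite mulr_ge0 ?powR_ge0// nu_densityE mulr_ge0 ?powR_ge0// ltW.
  rewrite /power_weight normc_real ?powR_ge0// -/(gconv a lam sig g u).
  have H : u `^ (- gamma) * normc (hankel lam a f u)
      <= u `^ (- gamma) * (2 * K * (u `^ (sig - del) * gconv a lam sig g u)).
    by apply: ler_wpM2l; [exact: powR_ge0 | exact: Hb].
  apply: (@le_trans _ _ ((u `^ (- gamma)
      * (2 * K * (u `^ (sig - del) * gconv a lam sig g u))) `^ q * nu_density lam a u)).
    apply: ler_wpM2r; first by rewrite nu_densityE mulr_ge0 ?powR_ge0// ltW.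
    apply: ge0_ler_powR H; rewrite ?nnegrE ?(ltW q0)//.
      by rewrite mulr_ge0 ?powR_ge0 ?normc_ge0.
    by rewrite mulr_ge0 ?powR_ge0// mulr_ge0// mulr_ge0 ?powR_ge0.
  apply: eq_leW; rewrite nu_densityE powRB1//.
  have t0 := T0 u.
  have z1 : 0 <= u `^ (sig - del) * gconv a lam sig g u by rewrite mulr_ge0 ?powR_ge0.
  have z2 := mulr_ge0 K2 z1.
  rewrite (powRM q (powR_ge0 u (- gamma)) z2) (powRM q K2 z1).
  rewrite (powRM q (powR_ge0 u (sig - del)) t0) -!powRrM.
  have e1 : u `^ (- gamma * q) * u `^ ((sig - del) * q) * u `^ del = 1.
    have un : u != 0 by rewrite gt_eqF.
    rewrite -!powRD ?un ?implybT// -[RHS](powRr0 u); congr (_ `^ _).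
    have -> : gamma = beta - del * (1 - 1 / p - 1 / q) by rewrite -scal; ring.
    rewrite /pittidx; field; rewrite !gt_eqF//.
  set T := gconv _ _ _ _ _ `^ q; set k := (2 * K) `^ q; move: e1.
  set u1 := u `^ _; set u2 := u `^ ((sig - del) * q); set u3 := u `^ del => e1.
  rewrite [LHS](_ : _ = k * nc * (T / u) * (u1 * u2 * u3)); last by ring.
  by rewrite e1 mulr1.
have int0 : (0 <= \int[mu]_(u in `]0%R, +oo[)
    ((normc (power_weight (- gamma) (hankel lam a f) u)) `^ q * nu_density lam a u)%:E)%E.
  apply: integral_ge0 => u /D0P u0; rewrite lee_fin mulr_ge0 ?powR_ge0// nu_densityE.
  by rewrite mulr_ge0 ?powR_ge0// ltW.
rewrite NE XE -(EFinM nc X) poweR_EFin -EFinM.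
have -> : L `^ q^-1 / nc `^ p^-1 * (nc * X) `^ p^-1 = (L * X `^ (q / p)) `^ q^-1.
  rewrite powRM ?(ltW ncp)// powRM ?powR_ge0// -powRrM.
  have -> : q / p / q = p^-1 by field; rewrite !gt_eqF.
  by field; rewrite gt_eqF// powR_gt0.
rewrite -poweR_EFin /nu_norm.
have qi : 0 <= q^-1 by rewrite invr_ge0 ltW.
apply: (gt0_ler_poweR qi) main; rewrite in_itv/= ?int0 ?leey//=.
by rewrite lee_fin mulr_ge0 ?powR_ge0.
Qed.

End PittSufficient.

(** * Lower bounds for integrals *)

Section IntegralLowerBounds.
Context {R : realType}.
Implicit Types (A B x y k : R).
Notation mu := (@lebesgue_measure R).
Local Notation D0 := (`]0%R, +oo[%classic : set R).

Lemma integral_cst_itv k x y : x <= y ->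
  (\int[mu]_(u in `[x, y]) k%:E = (k * (y - x))%:E)%E.
Proof.
move=> xy; have dk z : x <= z -> z <= y -> is_derive z 1 (fun z => k * z) k.
  by move=> _ _; apply: (is_derive_eq (der_scale _ (der_id z))); rewrite mulr1.
have ck : {within `[x, y], continuous (fun=> k)}.
  by apply: continuous_subspaceT => z; exact: cst_continuous.
by rewrite (FTC2_der xy dk ck) -mulrBr.
Qed.

Lemma integral_ge_sub (D : set R) (f : R -> R) (h : R -> R) x y :
  measurable D -> measurable_fun D f -> (forall u, D u -> 0 <= f u) ->
  `[x, y] `<=` D -> (forall u, x <= u -> u <= y -> 0 <= h u <= f u) ->
  (\int[mu]_(u in `[x, y]) (h u)%:E <= \int[mu]_(u in D) (f u)%:E)%E.
Proof.
move=> mD mf f0 sD hf.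
apply: (@le_trans _ _ (\int[mu]_(u in `[x, y]) (f u)%:E)%E).
  by apply: le_integral_ge0 => // u /=; rewrite in_itv/= => /andP[xu uy];
     rewrite lee_fin; case/andP: (hf u xu uy).
by apply: ge0_subset_integral => //; exact/measurable_EFinP.
Qed.

(** Comparison of [H] with a primitive of [psi]; [dH] itself need not be
    integrable. *)
Lemma integral_ge_der (H dH psi : R -> R) A B : 0 < A -> A <= B ->
  (forall x, 0 < x -> {for x, continuous psi}) ->
  (forall x, A <= x -> x <= B -> is_derive x 1 H (dH x)) ->
  (forall x, A <= x -> x <= B -> dH x <= psi x) ->
  ((H B - H A)%:E <= \int[mu]_(x in `[A, B]) (psi x)%:E)%E.
Proof.
move=> A0 AB cpsi dHE dHle; pose A' := A / 2; pose B' := B + 1.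
have A'0 : 0 < A' by rewrite divr_gt0.
have A'A : A' < A by rewrite /A'; lra.
have BB' : B < B' by rewrite ltrDl.
pose G x := \int[mu]_(t in `[A', x]) psi t.
have I x : mu.-integrable `[A', x] (EFin \o psi) by exact: continuous_gt0_integrable.
have dG x : A <= x -> x <= B -> is_derive x 1 G (psi x).
  move=> Ax xB; have x0 := lt_le_trans A0 Ax.
  have [] := @continuous_FTC1 R psi (BLeft A') x B' (le_lt_trans xB BB') (I B').
  - by rewrite /= lte_fin; exact: lt_le_trans Ax.
  - exact: cpsi.
  by move=> dG E; apply: DeriveDef; [exact: dG | rewrite -derive1E; exact: E].
have mono : G A - H A <= G B - H B.
  apply: (@der_ge0_le _ (fun x => G x - H x) (fun x => psi x - dH x)) => // x Ax xB.
    by apply: der_sub; [exact: dG | exact: dHE].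
  by rewrite subr_ge0 dHle.
have GE : G B - G A = \int[mu]_(t in `[A, B]) psi t.
  have := @Rintegral_itvB _ psi (BLeft A') (BRight B) A (I B).
  rewrite !bnd_simp => /(_ (ltW A'A) AB) E; rewrite /G E.
  apply: Rintegral_itv_obnd_cbnd; apply: integrableS (I B) => //.
  by move=> z /=; rewrite !in_itv/= => /andP[Az ->]; rewrite andbT ltW// (lt_trans A'A).
have -> : (\int[mu]_(x in `[A, B]) (psi x)%:E)%E = (G B - G A)%:E.
  rewrite GE fineK//; apply: integrable_fin_num => //; exact: continuous_gt0_integrable.
by rewrite lee_fin; lra.
Qed.

Lemma integral_inv A B : 0 < A -> A <= B ->
  (\int[mu]_(x in `[A, B]) (x^-1)%:E = (ln B - ln A)%:E)%E.
Proof.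
move=> A0 AB; apply: FTC2_der => //.
  by move=> x Ax _; apply: is_derive1_ln; exact: lt_le_trans Ax.
by apply: within_gt0 => // x x0; exact: inv_cont.
Qed.

(** A power varies by a bounded factor over a dyadic interval. *)
Lemma powR_dyadic (e x y : R) : 0 < x -> y / 2 <= x -> x <= y ->
  2 `^ (- `|e|) * y `^ e <= x `^ e <= 2 `^ `|e| * y `^ e.
Proof.
move=> x0 yx xy; have y0 := lt_le_trans x0 xy.
have xE : x `^ e = (x / y) `^ e * y `^ e by rewrite -powRM ?divr_ge0 ?ltW// divfK// gt_eqF.
have t0 : 0 < x / y by rewrite divr_gt0.
have t1 : x / y <= 1 by rewrite ler_pdivrMr// mul1r.
have t2 : 2^-1 <= x / y by rewrite ler_pdivlMr// mulrC.
suff : 2 `^ (- `|e|) <= (x / y) `^ e <= 2 `^ `|e|.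
  by move=> /andP[h1 h2]; rewrite xE !ler_pM2r ?powR_gt0// h1.
have half r : 2^-1 `^ r = 2 `^ (- r) :> R by rewrite -powR_inv1// -powRrM mulN1r.
have ge1 r : 0 <= r -> 1 <= 2 `^ r :> R.
  by move=> r0; have := @ler_powR R 2 (ler1n R 2) 0 r r0; rewrite powRr0.
have [e0|e0] := leP 0 e.
  rewrite ger0_norm// -half; apply/andP; split.
    by apply: ge0_ler_powR; rewrite ?nnegrE ?(ltW t0).
  apply: (@le_trans _ _ 1); last exact: ge1.
  by rewrite -(powRr0 (x / y)); apply: ger_powR; rewrite ?t0.
rewrite ltr0_norm// opprK; have ne0 : 0 <= - e by rewrite oppr_ge0 ltW.
apply/andP; split.
  apply: (@le_trans _ _ 1); last first.
    have := @ger_powR R (x / y) _ e 0 (ltW e0).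
    by rewrite powRr0 t0 t1; apply.
  by rewrite -[e]opprK powRN invf_le1 ?powR_gt0// ge1.
have -> : (x / y) `^ e = ((x / y) `^ (- e))^-1 by rewrite -powRN opprK.
have -> : 2 `^ (- e) = (2^-1 `^ (- e))^-1 :> R by rewrite half opprK powRN.
rewrite lef_pV2 ?posrE ?powR_gt0// ?invr_gt0//.
by apply: ge0_ler_powR; rewrite ?nnegrE ?(ltW t0).
Qed.

(** Otherwise a nontrivial power of [s] would be bounded on the half-line. *)
Lemma powR_scale_eq (c K x y : R) : 0 < c ->
  (forall s, 0 < s -> c * s `^ x <= K * s `^ y) -> x = y.
Proof.
move=> c0 H; apply/eqP; rewrite -subr_eq0; apply/negPn/negP => xy.
have H' s : 0 < s -> s `^ (x - y) <= K / c.
  move=> s0; rewrite ler_pdivlMr// -(ler_pM2r (powR_gt0 y s0)).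
  rewrite mulrAC -powRD ?(gt_eqF s0) ?implybT// subrK mulrC; exact: H.
have Kc0 : 0 <= K / c by apply: le_trans (H' 1 ltr01); exact: powR_ge0.
have s0 : 0 < (K / c + 1) `^ (x - y)^-1 by rewrite powR_gt0// ltr_wpDl.
by have := H' _ s0; rewrite -powRrM mulVf// powRr1 ?addr_ge0//; lra.
Qed.

End IntegralLowerBounds.

(** * Indicators of dyadic intervals *)

Section Box.
Context {R : realType}.
Implicit Types (s r x u : R).
Notation mu := (@lebesgue_measure R).
Local Notation D0 := (`]0%R, +oo[%classic : set R).

Definition box s : R -> R := \1_(`]s, 2 * s]%classic : set R).

Lemma boxE s r : box s r = ((s < r) && (r <= 2 * s))%:R.
Proof. by rewrite /box indicE mem_setE in_itv. Qed.

Lemma box_ge0 s r : 0 <= box s r. Proof. by rewrite boxE. Qed.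

Definition cbox s r : R[i] := real_complex R (box s r).

Lemma normc_cbox s r : normc (cbox s r) = box s r.
Proof. by rewrite normcE/= expr0n/= addr0 sqrtr_sqr ger0_norm ?box_ge0. Qed.

Lemma measurable_box s : measurable_fun setT (box s).
Proof. exact: measurable_indic. Qed.

(** A step function is monotone, with one jump of height [1]. *)
Lemma total_variation_step (c a b : R) : a <= b ->
  (total_variation a b (fun r => (c < r)%R%:R) <= 1)%E.
Proof.
move=> ab; rewrite nondecreasing_total_variation//.
  rewrite lee_fin; case: (c < a); case: (c < b) => /=; lra.
by move=> x y _ _ xy; case: ltP => // cx; rewrite (lt_le_trans cx xy).
Qed.

Lemma ctotal_variation_cbox s (a b : R) : 0 < s -> a <= b ->
  (ctotal_variation a b (cbox s) <= 2%:E)%E.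
Proof.
move=> s0 ab; apply: (@le_trans _ _ (total_variation a b (box s))).
  apply: ge_ereal_sup => _ /= [t abt <-].
  apply: le_ereal_sup_tmp; exists (variation a b (box s) t)%:E.
    by exists (variation a b (box s) t) => //; exact: variations_variation.
  rewrite lee_fin; apply: ler_sum => i _ /=.
  by rewrite subrr expr0n/= addr0 sqrtr_sqr.
have -> : box s = (fun r => (s < r)%R%:R) \+ (\- (fun r => (2 * s < r)%R%:R)).
  apply/funext => r; rewrite boxE /=; case: (ltP s r) => sr /=.
    by case: ltP => _ /=; lra.
  by case: ltP => //= h; [lra | rewrite subrr].
apply: le_trans (total_variation_le _ _ ab) _.
rewrite total_variationN (_ : 2%:E = 1 + 1)%E//.
by apply: leeD; exact: total_variation_step.
Qed.

Lemma ctotal_variation_cbox0 s r (b : R) : 2 * s < r ->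
  (ctotal_variation r b (cbox s) <= 0)%E.
Proof.
move=> sr; apply: ge_ereal_sup => _ /= [t [pt lt] <-].
rewrite lee_fin /cvariation big_nat; apply: sumr_le0 => i /andP[_ it].
have z k : (k <= size t)%N -> cbox s (nth b (r :: t) k) = 0.
  move=> kt; have rk : r <= nth b (r :: t) k.
    have : all (>= r) (r :: t).
      rewrite /= lexx /=; have := order_path_min lt_trans pt.
      by apply: sub_all => z /ltW.
    by move=> /all_nthP; apply; rewrite ltnS.
  rewrite /cbox boxE [X in _ && X]leNgt (lt_le_trans sr rk) andbF; exact: rmorph0.
rewrite [_ i.+1]z// [_ i]z 1?ltnW// subrr normcE/= expr0n/= addr0 sqrtr0//.
Qed.

End Box.

Section BoxGeneralMonotone.
Context {R : realType}.
Implicit Types (s r x u : R).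
Notation mu := (@lebesgue_measure R).
Local Notation D0 := (`]0%R, +oo[%classic : set R).

Lemma box1 s u : s < u -> u <= 2 * s -> box s u = 1.
Proof. by move=> su us; rewrite boxE su us. Qed.

Lemma measurable_normc_cbox s (D : set R) : measurable_fun D (fun x => normc (cbox s x)).
Proof.
apply: measurable_funTS; rewrite (_ : (fun x => _) = box s); first exact: measurable_box.
by apply/funext => x; rewrite normc_cbox.
Qed.

(** The total variation is at most [2], and [0] on [[r, oo[] for [r > 2 * s].
    For [r <= 2 * s] the half-line from [r / 2] contains [[3 * s / 2, 2 * s]],
    where [1 / u >= 1 / (2 * s)], so that the integral is at least [1 / 4]:
    hence the constant [8]. *)
Lemma general_monotone_cbox s : 0 < s -> general_monotone 8 2 (cbox s).
Proof.
move=> s0; split.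
- move=> a b a0 ab; apply: le_lt_trans (ctotal_variation_cbox s0 ab) _; exact: ltey.
- apply: cvg_near_cst; near=> x; rewrite normc_cbox boxE [X in _ && X]leNgt.
  have -> : 2 * s < x by near: x; apply: nbhs_pinfty_gt; exact: num_real.
  by rewrite andbF.
move=> r r0; have i0 : (0 <= \int[mu]_(u in `[(r / 2)%R, +oo[) (normc (cbox s u) / u)%:E)%E.
  apply: integral_ge0 => u; rewrite /= in_itv/= andbT => ru.
  by rewrite lee_fin divr_ge0 ?normc_ge0//; apply: le_trans ru; rewrite divr_ge0// ltW.
have [sr|rs] := ltP (2 * s) r.
  apply: (@le_trans _ _ 0%E); last by rewrite mule_ge0// lee_fin.
  by apply: ge_ereal_sup => _ /= [b _ <-]; exact: ctotal_variation_cbox0.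
have H : ((2 * s)^-1 * (2 * s - s * 3 / 2))%:E
    = (\int[mu]_(u in `[(s * 3 / 2)%R, (2 * s)%R]) ((2 * s)^-1)%:E)%E.
  by rewrite integral_cst_itv//; lra.
apply: (@le_trans _ _ 2%:E).
  apply: ge_ereal_sup => _ /= [b rb <-]; apply: ctotal_variation_cbox => //.
  by move: rb; rewrite in_itv/= andbT.
apply: (@le_trans _ _ (8%:E * ((2 * s)^-1 * (2 * s - s * 3 / 2))%:E)%E).
  by rewrite -EFinM lee_fin; apply: eq_leW; field; rewrite gt_eqF.
apply: lee_wpmul2l; first by rewrite lee_fin.
rewrite H; apply: (@integral_ge_sub _ _ (fun u => normc (cbox s u) / u)) => //.
- apply: measurable_funM; first exact: measurable_normc_cbox.
  apply: measurable_funS measurable_inv_D0 => //.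
  by move=> u /=; rewrite !in_itv/= !andbT; apply: lt_le_trans; rewrite divr_gt0.
- move=> u; rewrite /= in_itv/= andbT => ru.
  by rewrite divr_ge0 ?normc_ge0//; apply: le_trans ru; rewrite divr_ge0// ltW.
- move=> u /=; rewrite !in_itv/= andbT => /andP[+ _]; apply: le_trans; lra.
move=> u su us; have u0 : 0 < u by lra.
have s20 : 0 < 2 * s by rewrite mulr_gt0.
rewrite normc_cbox box1//; last by lra.
by rewrite invr_ge0 (ltW s20) mul1r lef_pV2 ?posrE.
Unshelve. all: by end_near. Qed.

End BoxGeneralMonotone.

(** * Transforms of indicators *)

Section BoxTransform.
Context {R : realType}.
Variables (a lam p beta : R).
Hypotheses (a_gt0 : 0 < a) (lam_a_ge0 : 0 <= 4 * lam + a) (p1 : 1 < p).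
Implicit Types (s r x u rho : R).
Local Notation nc := (nu_const lam a).
Local Notation sig := (pittidx a lam p beta).
Local Notation del := (hdim a lam).
Notation mu := (@lebesgue_measure R).
Local Notation D0 := (`]0%R, +oo[%classic : set R).

Lemma theta1_ge (y : R) : 1 <= y -> y <= 2 -> 8^-1 <= theta 1 y.
Proof.
move=> y1 y2; rewrite /theta powRr1 ?(le_trans ler01)// ler_pdivlMr; last by rewrite exprn_gt0; lra.
by rewrite mulrC ler_pdivrMr//; nra.
Qed.

(** The power is dominated on the support by a multiple of the bump at scale
    [s], whose integral does not depend on [s]. *)
Lemma mnorm_box : exists K : R, 0 <= K /\ forall s, 0 < s ->
  (mnorm (gweight sig (fun x => normc (cbox s x))) p <= (K * s `^ (sig * p))%:E)%E.
Proof.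
have p0 : 0 < p by exact: lt_trans p1.
pose K := 8 * (2 `^ `|sig * p| * 2 `^ (sig * p)).
have K0 : 0 <= K by rewrite mulr_ge0// mulr_ge0 ?powR_ge0.
exists K; split=> // s s0; have Ks0 : 0 <= K * s `^ (sig * p) by rewrite mulr_ge0 ?powR_ge0.
have si0 : 0 < s^-1 by rewrite invr_gt0.
apply: (@le_trans _ _ (\int[mu]_(u in D0)
   ((K * s `^ (sig * p))%:E * (theta 1 (s^-1 * u) / u)%:E))%E).
  apply: le_integral_ge0 => // u /D0P u0.
    by rewrite lee_fin divr_ge0 ?powR_ge0// ltW.
  rewrite -EFinM lee_fin mulrA; apply: ler_wpM2r; first by rewrite invr_ge0 ltW.
  rewrite /gweight normc_cbox boxE.
  have [/andP[su us]|_] := boolP ((s < u) && (u <= 2 * s)); last first.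
    by rewrite mul0r powR0 ?gt_eqF// mulr_ge0// theta_ge0.
  rewrite mul1r -powRrM.
  have /andP[_ H] : 2 `^ (- `|sig * p|) * (2 * s) `^ (sig * p) <= u `^ (sig * p)
       <= 2 `^ `|sig * p| * (2 * s) `^ (sig * p).
    by apply: powR_dyadic => //; lra.
  apply: le_trans H _; rewrite (powRM _ (ler0n R 2) (ltW s0)).
  have : 8^-1 <= theta 1 (s^-1 * u).
    by apply: theta1_ge; [rewrite ler_pdivlMl// mulr1 ltW | rewrite ler_pdivrMl// mulrC].
  have := powR_ge0 2 `|sig * p|; have := powR_ge0 2 (sig * p); have := powR_ge0 s (sig * p).
  rewrite /K; move: (2 `^ _) (2 `^ (sig * p)) (s `^ _) (theta _ _) => x y z t z0 y0 x0 t8.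
  have W0 : 0 <= x * y * z by rewrite !mulr_ge0.
  have := ler_wpM2l W0 t8; nra.
rewrite ge0_integralZl_EFin//.
- have := @integral_theta R 1 _ ltr01 si0; rewrite invr1 => H.
  have := lee_wpmul2l (_ : (0 <= (K * s `^ (sig * p))%:E)%E) H.
  by rewrite lee_fin mule1; apply.
- by move=> u /D0P u0; rewrite lee_fin divr_ge0 ?theta_ge0// ltW.
- apply/measurable_EFinP; apply: measurable_continuous_gt0 => x x0; exact: theta_div_cont.
Qed.

Lemma nu_norm_cbox : exists K : R, 0 <= K /\ forall s, 0 < s ->
  (nu_norm lam a p (power_weight beta (cbox s)) <= (K * s `^ sig)%:E)%E.
Proof.
have p0 : 0 < p by exact: lt_trans p1.
have ncp : 0 < nc by exact: nu_const_gt0.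
have [K [K0 HK]] := mnorm_box.
exists ((nc * K) `^ p^-1); split; first exact: powR_ge0.
move=> s s0; rewrite nu_normE//; last exact: measurable_normc_cbox.
have -> : (nc * K) `^ p^-1 * s `^ sig = (nc * (K * s `^ (sig * p))) `^ p^-1.
  rewrite mulrA (@powRM _ (nc * K)) ?powR_ge0 ?mulr_ge0 ?(ltW ncp)// -powRrM.
  by rewrite mulfK// gt_eqF.
rewrite -poweR_EFin.
have pi : 0 <= p^-1 by rewrite invr_ge0 ltW.
have M0 := @mnorm_ge0 _ (gweight sig (fun x => normc (cbox s x))) p.
apply: (gt0_ler_poweR pi).
- by rewrite in_itv/= leey andbT mule_ge0// lee_fin ltW.
- by rewrite in_itv/= leey andbT lee_fin mulr_ge0 ?(ltW ncp)// mulr_ge0 ?powR_ge0.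
by rewrite EFinM; apply: lee_wpmul2l; [rewrite lee_fin ltW | exact: HK].
Qed.

Lemma lim_improper (u : R * R -> R) s c : 0 < s ->
  (forall A B, 0 < A -> A <= s -> 2 * s <= B -> u (A, B) = c) ->
  lim (u @ @improper_filter R) = c.
Proof.
move=> s0 uc; apply: cvg_lim => //; apply: cvg_near_cst.
have Pl : \forall A \near (0 : R)^'+, 0 < A <= s.
  near=> A; apply/andP; split; first by [].
  by near: A; exact: nbhs_right_le.
have Ph : \forall B \near +oo, 2 * s <= B.
  by apply: nbhs_pinfty_ge; exact: num_real.
apply: filterS (near_improper Pl Ph) => -[A B] /= [/andP[A0 As] sB].
by rewrite uc.
Unshelve. all: by end_near. Qed.

Lemma tint_box s rho A B : 0 < s -> 0 < rho -> 0 < A -> A <= s -> 2 * s <= B ->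
  tint a lam (box s) rho A B = hprim a lam rho (2 * s) - hprim a lam rho s.
Proof.
move=> s0 r0 A0 As sB; rewrite /tint.
pose m r := kern a lam (rho * r) * nu_density lam a r.
have cm x : 0 < x -> {for x, continuous m} by move=> x0; exact: hker_cont.
have -> : (fun r => box s r * (kern a lam (rho * r) * nu_density lam a r))
   = m \_ (`]s, 2 * s]%classic : set R).
  apply/funext => r; rewrite boxE patchE mem_setE in_itv/=.
  by case: ifP => _; rewrite ?mul1r ?mul0r.
rewrite -Rintegral_mkcondr.
have -> : `[A, B] `&` `]s, 2 * s] = `]s, 2 * s]%classic.
  apply/seteqP; split => x /=; rewrite !in_itv/=; first by case.
  by move=> /andP[sx xs]; rewrite sx xs (le_trans xs sB) (le_trans As (ltW sx)).
have s2 : s <= 2 * s by lra.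
have I : mu.-integrable `[s, 2 * s] (EFin \o m) by exact: continuous_gt0_integrable.
rewrite Rintegral_itv_obnd_cbnd; last first.
  apply: integrableS I => // x /=; rewrite !in_itv/= => /andP[sx ->].
  by rewrite ltW.
have dm x : s <= x -> x <= 2 * s -> is_derive x 1 (hprim a lam rho) (m x).
  by move=> sx _; apply: der_hprim => //; exact: lt_le_trans sx.
by rewrite /Rintegral (FTC2_der s2 dm (within_gt0 s0 cm)).
Qed.

Lemma hankel_cbox s rho : 0 < s -> 0 < rho ->
  hankel lam a (cbox s) rho = Complex (hprim a lam rho (2 * s) - hprim a lam rho s) 0.
Proof.
move=> s0 r0; congr (Complex _ _).
  apply: (lim_improper s0) => A B A0 As sB.
  rewrite hankel_truncE//; exact: (tint_box s0 r0 A0 As sB).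
apply: (lim_improper s0) => A B A0 As sB.
rewrite /hankel_trunc (_ : (fun r => _) = fun=> 0); last by apply/funext => x; rewrite /= !mul0r.
by rewrite /Rintegral integral0.
Qed.

(** The transform of the indicator of [`]s, 2 * s]] is [kdiff (rho * s)] up to
    a power of [rho]. *)
Definition kdiff y : R := kprim a lam (2 * y) - kprim a lam y.

Lemma normc_hankel_cbox s rho : 0 < s -> 0 < rho ->
  normc (hankel lam a (cbox s) rho) = nc * (rho `^ (- del) * `|kdiff (rho * s)|).
Proof.
move=> s0 r0; rewrite hankel_cbox// normcE/= expr0n/= addr0 sqrtr_sqr /hprim /kdiff.
rewrite -mulrBr normrM ger0_norm ?mulr_ge0 ?powR_ge0//; last exact/ltW/nu_const_gt0.
have -> : rho * (2 * s) = 2 * (rho * s) by ring.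
set w := `|_|; ring.
Qed.

Lemma kdiff_cont y : 0 < y -> {for y, continuous kdiff}.
Proof.
move=> y0; have y20 : 0 < 2 * y by rewrite mulr_gt0.
apply: der_cont; apply: der_sub; last exact: (der_kprim a_gt0 lam_a_ge0 y0).
exact: (der_comp (der_scale 2 (der_id y)) (der_kprim a_gt0 lam_a_ge0 y20)).
Qed.

End BoxTransform.

(** * Necessity of the conditions *)

Section Necessary.
Context {R : realType}.
Variables (a lam p q beta gamma : R).
Hypotheses (a_gt0 : 0 < a) (lam_a_ge0 : 0 <= 4 * lam + a) (p1 : 1 < p) (pq : p <= q).
Implicit Types (s x y u rho : R).
Local Notation nc := (nu_const lam a).
Local Notation sig := (pittidx a lam p beta).
Local Notation del := (hdim a lam).
Local Notation kap := (hrate a lam).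
Notation mu := (@lebesgue_measure R).
Local Notation D0 := (`]0%R, +oo[%classic : set R).

Let p0 : 0 < p. Proof. exact: lt_trans p1. Qed.
Let q0 : 0 < q. Proof. exact: lt_le_trans pq. Qed.

Lemma poweR_root_le (X : \bar R) y : (0 <= X)%E -> 0 <= y ->
  (X `^ q^-1 <= y%:E)%E -> (X <= (y `^ q)%:E)%E.
Proof.
case: X => [x| |]//.
  rewrite poweR_EFin !lee_fin => x0 y0 xy.
  have -> : x = (x `^ q^-1) `^ q by rewrite -powRrM mulVf ?gt_eqF// powRr1.
  by apply: ge0_ler_powR xy; rewrite ?nnegrE ?powR_ge0// ltW.
move=> _ _ H; have := lty_poweRy _ (le_lt_trans H (ltry y)).
by rewrite ltxx invr_eq0 gt_eqF// => /(_ isT).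
Qed.

(** The integrand of the left-hand side for the indicator of [`]s, 2 * s]],
    without its constant factor, is [tbox s]; [texp] collects the powers of
    [rho] coming from the weight, the transform and the measure. *)
Definition texp : R := del - (gamma + del) * q.

Definition tbox s rho : R := `|kdiff a lam (rho * s)| `^ q * (rho `^ texp / rho).

Lemma tbox_ge0 s rho : 0 < rho -> 0 <= tbox s rho.
Proof. by move=> r0; rewrite mulr_ge0 ?powR_ge0// divr_ge0 ?powR_ge0// ltW. Qed.

Lemma measurable_tbox s : 0 < s -> measurable_fun D0 (tbox s).
Proof.
move=> s0; apply: measurable_funM; last first.
  apply: measurable_funM; last exact: measurable_inv_D0.
  by apply: measurable_funTS; exact: measurable_powR.
apply: (measurableT_comp (measurable_powR q)).
apply: (measurableT_comp (@normr_measurable R setT)).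
apply: measurable_continuous_gt0 => x x0.
have sx : 0 < s * x by exact: mulr_gt0.
rewrite (_ : (fun y => kdiff a lam (y * s)) = (fun y => kdiff a lam (s * y))).
  exact: (for_continuous_comp (der_cont (der_scale s (der_id x))) (kdiff_cont a_gt0 lam_a_ge0 sx)).
by apply/funext => y; rewrite (mulrC y s).
Qed.

Lemma nu_tbox s rho : 0 < s -> 0 < rho ->
  normc (power_weight (- gamma) (hankel lam a (cbox s)) rho) `^ q * nu_density lam a rho
   = nc `^ (q + 1) * tbox s rho.
Proof.
move=> s0 r0; have ncp : 0 < nc by exact: nu_const_gt0.
rewrite /power_weight normc_real ?powR_ge0// normc_hankel_cbox// nu_densityE powRB1//.
rewrite /tbox; have := normr_ge0 (kdiff a lam (rho * s)); set w := `|_| => w0.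
have w1 : 0 <= rho `^ (- del) * w by rewrite mulr_ge0 ?powR_ge0.
have w2 : 0 <= nc * (rho `^ (- del) * w) by rewrite mulr_ge0// ltW.
rewrite (powRM q (powR_ge0 rho (- gamma)) w2) (powRM q (ltW ncp) w1).
rewrite (powRM q (powR_ge0 rho (- del)) w0) -!powRrM.
rewrite (@powRD _ nc q 1) ?(gt_eqF ncp) ?implybT// powRr1 ?(ltW ncp)//.
have -> : rho `^ texp = rho `^ (- gamma * q) * rho `^ (- del * q) * rho `^ del.
  rewrite -!powRD ?(gt_eqF r0) ?implybT//; congr (_ `^ _); rewrite /texp; ring.
ring.
Qed.

(** Pitt's inequality for the indicators, whose constants do not depend on
    [s]. *)
Lemma pitt_box : Pitt_GM lam a p q beta gamma -> exists K, forall s, 0 < s ->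
  (\int[mu]_(rho in D0) (tbox s rho)%:E <= (K * s `^ (sig * q))%:E)%E.
Proof.
move=> /(_ 8 2); have e8 : 0 < 8 :> R by []. have e2 : 1 < 2 :> R by rewrite ltr1n.
move=> /(_ e8 e2)[c Hc]; have ncp : 0 < nc by exact: nu_const_gt0.
have [K1 [K10 HK]] := nu_norm_cbox beta a_gt0 lam_a_ge0 p1.
have kp : 0 < nc `^ (q + 1) by exact: powR_gt0.
exists ((nc `^ (q + 1))^-1 * (`|c| * K1) `^ q) => s s0.
have Nf : (nu_norm lam a p (power_weight beta (cbox s)) < +oo)%E.
  by apply: le_lt_trans (HK s s0) _; exact: ltey.
have [_ H] := Hc _ (general_monotone_cbox s0) Nf.
have B0 : 0 <= `|c| * (K1 * s `^ sig) by rewrite mulr_ge0// mulr_ge0 ?powR_ge0.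
have {}H : (nu_norm lam a q (power_weight (- gamma) (hankel lam a (cbox s)))
    <= (`|c| * (K1 * s `^ sig))%:E)%E.
  apply: le_trans H _; rewrite EFinM.
  apply: (@le_trans _ _ (`|c|%:E * nu_norm lam a p (power_weight beta (cbox s)))%E).
    by apply: lee_wpmul2r; [exact: poweR_ge0 | rewrite lee_fin ler_norm].
  by apply: lee_wpmul2l; [rewrite lee_fin | exact: HK].
have := poweR_root_le _ B0 H.
have -> : (`|c| * (K1 * s `^ sig)) `^ q = (`|c| * K1) `^ q * s `^ (sig * q).
  by rewrite mulrA (@powRM _ (`|c| * K1)) ?powR_ge0 ?mulr_ge0// -powRrM.
have -> : (\int[mu]_(u in D0) ((normc (power_weight (- gamma) (hankel lam a (cbox s)) u)) `^ q
      * nu_density lam a u)%:E = (nc `^ (q + 1))%:E * \int[mu]_(u in D0) (tbox s u)%:E)%E.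
  rewrite -ge0_integralZl_EFin ?(ltW kp)//.
  - by apply: eq_integral => u; rewrite inE => /D0P u0; rewrite nu_tbox// EFinM.
  - by move=> u /D0P u0; rewrite lee_fin tbox_ge0.
  - by apply/measurable_EFinP; exact: measurable_tbox.
rewrite -mulrA EFinM -lee_pdivlMl//; apply.
rewrite mule_ge0// ?lee_fin ?(ltW kp)//; apply: integral_ge0 => u /D0P u0.
by rewrite lee_fin tbox_ge0.
Qed.

Section Consequences.
Variable K : R.
Hypothesis HK : forall s, 0 < s ->
  (\int[mu]_(rho in D0) (tbox s rho)%:E <= (K * s `^ (sig * q))%:E)%E.

Lemma sub_itv_D0 x y : 0 < x -> `[x, y] `<=` D0.
Proof. by move=> x0 u; rewrite /= !in_itv/= andbT => /andP[+ _]; exact: lt_le_trans. Qed.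

(** Both sides are compared for [rho] in [[e / (2 * s), e / s]],
    where the transform is of the order of [(rho * s) `^ del]. *)
Lemma pitt_scaling : - texp = sig * q.
Proof.
have [e [c [e0 c0 kc]]] := kprim_small a_gt0 lam_a_ge0.
pose k := (c * (e / 2) `^ del) `^ q * (2 `^ (- `|texp|) * e `^ texp) / e * (e / 2).
have k0 : 0 < k.
  rewrite mulr_gt0 ?divr_gt0 ?mulr_gt0 ?powR_gt0 ?divr_gt0//.
  by rewrite mulr_gt0 ?powR_gt0 ?divr_gt0.
apply: (@powR_scale_eq _ k K) => // s s0; rewrite -lee_fin; apply: le_trans (HK s0).
pose x := e / (2 * s); pose y := e / s.
have x0 : 0 < x by rewrite divr_gt0 ?mulr_gt0.
have y0 : 0 < y by rewrite divr_gt0.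
have yx : y = 2 * x by rewrite /x /y; field; rewrite gt_eqF.
pose h := (c * (e / 2) `^ del) `^ q * (2 `^ (- `|texp|) * y `^ texp / y).
apply: (@le_trans _ _ (\int[mu]_(u in `[x, y]) h%:E)%E).
  rewrite integral_cst_itv; last by lra.
  rewrite lee_fin; apply: eq_leW; rewrite /k /h.
  have -> : y `^ texp = e `^ texp * s `^ (- texp).
    by rewrite /y powRM ?(ltW e0) ?invr_ge0 ?(ltW s0)// -(powR_inv1 (ltW s0)) -powRrM mulN1r.
  by rewrite /x /y; field; rewrite !gt_eqF.
apply: integral_ge_sub => //.
- exact: measurable_tbox.
- by move=> u /D0P u0; exact: tbox_ge0.
- exact: sub_itv_D0.
move=> u xu uy; have u0 : 0 < u by exact: lt_le_trans xu.
have us0 : 0 < u * s by rewrite mulr_gt0.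
have us : u * s <= e by rewrite -ler_pdivlMr.
have us2 : e / 2 <= u * s.
  by move: xu; rewrite /x invfM mulrA ler_pdivrMr.
apply/andP; split.
  apply: mulr_ge0; first exact: powR_ge0.
  by apply: divr_ge0; [apply: mulr_ge0; exact: powR_ge0 | exact: ltW].
have cd0 : 0 <= c * (e / 2) `^ del by rewrite mulr_ge0 ?powR_ge0// ltW.
have h1 : (c * (e / 2) `^ del) `^ q <= `|kdiff a lam (u * s)| `^ q.
  apply: ge0_ler_powR; rewrite ?nnegrE ?(ltW q0)//.
  apply: le_trans (le_trans (kc _ us0 us) (ler_norm _)).
  apply: ler_wpM2l; first exact: ltW.
  apply: ge0_ler_powR us2; rewrite ?nnegrE ?(ltW us0) ?divr_ge0 ?(ltW e0)//.
  exact/ltW/hdim_gt0.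
have h2 : 2 `^ (- `|texp|) * y `^ texp / y <= u `^ texp / u.
  apply: ler_pM; rewrite ?mulr_ge0 ?powR_ge0 ?invr_ge0 ?(ltW y0)//; last by rewrite lef_pV2 ?posrE.
  have : 2 `^ (- `|texp|) * y `^ texp <= u `^ texp <= 2 `^ `|texp| * y `^ texp.
    by apply: powR_dyadic => //; lra.
  by case/andP.
apply: ler_pM h1 h2; first exact: powR_ge0.
by apply: divr_ge0; [apply: mulr_ge0; exact: powR_ge0 | exact: ltW].
Qed.

(** If [sig >= del] then near [rho = 0] the integrand is at least a multiple of
    [1 / rho]. *)
Lemma pitt_upper : sig < del.
Proof.
rewrite ltNge; apply/negP => ds.
have [e' [c [e'0 c0 kc]]] := kprim_small a_gt0 lam_a_ge0.
pose e := Num.min e' 1; have e0 : 0 < e by rewrite lt_min e'0 ltr01.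
have ee : e <= e' by rewrite ge_min lexx.
have e1 : e <= 1 by rewrite ge_min lexx orbT.
have ck : 0 < c `^ q by exact: powR_gt0.
have H X : 0 <= X -> c `^ q * X <= K.
  move=> X0; pose A := e * expR (- X).
  have A0 : 0 < A by rewrite mulr_gt0// expR_gt0.
  have Ae : A <= e by rewrite ler_piMr ?(ltW e0)// expR_le1 oppr_le0.
  have := HK ltr01; rewrite powR1 mulr1 -lee_fin; apply: le_trans.
  apply: (@le_trans _ _ (\int[mu]_(u in `[A, e]) (c `^ q / u)%:E)%E).
    apply: eq_leW; have dl x : A <= x -> x <= e ->
        is_derive x 1 (fun x => c `^ q * ln x) (c `^ q / x).
      by move=> Ax _; apply: der_scale; apply: is_derive1_ln; exact: lt_le_trans Ax.
    have cl x : 0 < x -> {for x, continuous (fun x => c `^ q / x)}.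
      by move=> x0; apply: (der_cont (der_scale _ (der_inv (der_id x) _))); rewrite gt_eqF.
    rewrite (FTC2_der Ae dl (within_gt0 A0 cl)) /A lnM ?posrE ?expR_gt0// expRK.
    by congr (_%:E); ring.
  apply: integral_ge_sub => //.
  - by apply: measurable_tbox.
  - by move=> u /D0P u0; exact: tbox_ge0.
  - exact: sub_itv_D0.
  move=> u Au ue; have u0 : 0 < u by exact: lt_le_trans Au.
  apply/andP; split; first by rewrite divr_ge0 ?powR_ge0// ltW.
  rewrite /tbox mulr1 mulrA; apply: ler_wpM2r; first by rewrite invr_ge0 ltW.
  have h1 : c * u `^ del <= `|kdiff a lam u|.
    by apply: le_trans (ler_norm _); apply: kc => //; exact: le_trans ee.
  have cu : 0 <= c * u `^ del by rewrite mulr_ge0 ?powR_ge0// ltW.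
  have h2 : (c * u `^ del) `^ q <= `|kdiff a lam u| `^ q.
    by apply: ge0_ler_powR h1; rewrite ?nnegrE ?(ltW q0).
  apply: le_trans (ler_wpM2r (powR_ge0 u texp) h2).
  rewrite powRM ?powR_ge0 ?(ltW c0)// -powRrM -mulrA -powRD ?(gt_eqF u0) ?implybT//.
  rewrite ler_peMr ?(ltW ck)//.
  have ht : del * q + texp <= 0.
    have -> : texp = - (sig * q) by rewrite -pitt_scaling opprK.
    by rewrite -mulrBl pmulr_lle0// subr_le0.
  have := @ger_powR R u _ _ _ ht; rewrite powRr0 u0 (le_trans ue e1); exact.
have K0 : 0 <= K by have := H 0 (lexx 0); rewrite mulr0.
have := H ((K + 1) / c `^ q) _; rewrite divr_ge0 ?addr_ge0 ?(ltW ck)// => /(_ isT).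
by rewrite mulrC divfK ?gt_eqF// gerDl ler10.
Qed.

(** Suppose [sig <= kap]. With [t = kvar a x] and [v] the oscillating factor of
    [kdiff], the integrand is at least a multiple of [|v t| `^ q / x] for
    [x >= 1], so the latter has bounded integrals. By decorrelation,
    [F0 <= Q' t + M * |v t|]; dividing by [x], the term with [Q'] is a bounded
    total derivative up to a term of one sign, and the inequality
    [w <= eps + eps `^ (1 - q) * w `^ q] absorbs half of
    [F0 / x]. There remains [F0 / 2 * ln X] below a constant. *)
Lemma pitt_lower : kap < sig.
Proof.
rewrite ltNge; apply/negP => sk.
pose n := 2 * lam / a + 1; pose S := 2 `^ (a / 2) : R; pose A := 2 `^ kap : R.
have n12 : 1 / 2 <= n by have := mu_ge a_gt0 lam_a_ge0; rewrite /n; lra.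
have S1 : 1 < S.
  have : 1 `^ (a / 2) < 2 `^ (a / 2) :> R.
    by apply: gt0_ltr_powR; rewrite ?divr_gt0 ?nnegrE// ltr1n.
  by rewrite powR1.
have [F0 [M [B [F00 M0 [Q [dQ HQ]]]]]] := usol_decorrelation A n12 S1.
pose v t := A * usol n (S * t) - usol n t.
have [kc [kc0 kdE]] : exists k, 0 < k /\
    forall x, 0 < x -> kdiff a lam x = k * x `^ kap * v (kvar a x).
  exists (kconst a lam); split; first exact: kconst_gt0.
  move=> x x0; have x20 : 0 < 2 * x by rewrite mulr_gt0.
  rewrite /kdiff !kprimE// (powRM _ (ler0n R 2) (ltW x0)) -/n /v /A.
  have -> : kvar a (2 * x) = S * kvar a x.
    by rewrite /kvar (powRM _ (ler0n R 2) (ltW x0)) /S; ring.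
  ring.
have t1 : 1 <= tstart n by have := tstart_ge2 n12; lra.
(* beyond [r0] the variable of the kernel exceeds [tstart n] *)
pose r0 := Num.max 1 ((a / 2 * tstart n) `^ (2 / a)).
have r01 : 1 <= r0 by rewrite le_max lexx.
have r0t x : r0 <= x -> tstart n <= kvar a x.
  move=> rx; have a2 : 0 < a / 2 by rewrite divr_gt0.
  have t0 : 0 <= a / 2 * tstart n by rewrite mulr_ge0 ?(ltW a2)// (le_trans ler01).
  have x1 : 0 < x by apply: lt_le_trans rx; exact: lt_le_trans r01.
  have : ((a / 2 * tstart n) `^ (2 / a)) `^ (a / 2) <= x `^ (a / 2).
    apply: ge0_ler_powR; rewrite ?nnegrE ?powR_ge0 ?(ltW a2) ?(ltW x1)//.
    by apply: le_trans rx; rewrite le_max lexx orbT.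
  rewrite -powRrM (_ : 2 / a * (a / 2) = 1); last by field; rewrite gt_eqF.
  rewrite powRr1// => H; have a20 : 0 <= 2 / a by rewrite divr_ge0// ltW.
  have := ler_wpM2l a20 H; rewrite mulrA (_ : 2 / a * (a / 2) = 1) ?mul1r//.
  by field; rewrite gt_eqF.
pose eps := F0 / (2 * M); have eps0 : 0 < eps by rewrite divr_gt0 ?mulr_gt0.
have young w : 0 <= w -> w <= eps + eps `^ (1 - q) * w `^ q.
  move=> w0; have [we|ew] := leP w eps.
    by apply: (le_trans we); rewrite lerDl mulr_ge0 ?powR_ge0.
  have w1 : 0 < w by exact: lt_trans ew.
  apply: (@le_trans _ _ (eps `^ (1 - q) * w `^ q)); last by rewrite lerDr ltW.
  have -> : w `^ q = w `^ (q - 1) * w by rewrite powRB1// divfK ?gt_eqF.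
  rewrite mulrA ler_peMl// ?(ltW w1)//.
  have H : eps `^ (q - 1) <= w `^ (q - 1).
    by apply: ge0_ler_powR; rewrite ?nnegrE ?(ltW eps0) ?(ltW ew) ?w0// subr_ge0 (le_trans (ltW p1)).
  have -> : 1 - q = - (q - 1) by ring.
  by rewrite powRN ler_pdivlMl ?powR_gt0// mulr1.
pose psi x := M * `|v (kvar a x)| / x.
have cpsi x : 0 < x -> {for x, continuous psi}.
  move=> x0; have k0 := kvar_gt0 a_gt0 x0.
  have cv t : 0 < t -> {for t, continuous v}.
    move=> tt; have n1 : -1 < n by lra.
    have St : 0 < S * t by rewrite mulr_gt0// (lt_trans ltr01).
    apply: der_cont; apply: der_sub; last exact: (der_usol n1 tt).
    apply: der_scale; exact: (der_comp (der_scale S (der_id t)) (der_usol n1 St)).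
  have c1 := for_continuous_comp (der_cont (der_kvar a x0)) (cv _ k0).
  have c2 : {for x, continuous (fun x => `|v (kvar a x)|)}.
    by apply: (for_continuous_comp c1); exact: norm_continuous.
  by apply: continuousM; [apply: continuousM => //; exact: cst_continuous | exact: inv_cont].
pose C' := M * eps `^ (1 - q) / kc `^ q.
have C'0 : 0 < C' by rewrite divr_gt0 ?mulr_gt0 ?powR_gt0.
have psi_le x : r0 <= x -> 0 <= psi x <= F0 / 2 / x + C' * tbox 1 x.
  move=> rx; have x1 : 1 <= x by exact: le_trans rx.
  have x0 : 0 < x by exact: lt_le_trans x1.
  apply/andP; split; first by rewrite divr_ge0 ?mulr_ge0 ?(ltW M0) ?(ltW x0).
  rewrite /tbox mulr1 kdE//; set w := v _.
  have -> : texp = - (sig * q) by rewrite -pitt_scaling opprK.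
  have -> : `|kc * x `^ kap * w| `^ q
      = kc `^ q * x `^ (kap * q) * `|w| `^ q.
    rewrite normrM ger0_norm ?mulr_ge0 ?powR_ge0 ?(ltW kc0)//.
    rewrite (@powRM _ (_ * _)) ?mulr_ge0 ?powR_ge0 ?(ltW kc0)//.
    by rewrite powRM ?powR_ge0 ?(ltW kc0)// -powRrM.
  have h1 : M * `|w| <= F0 / 2 + M * eps `^ (1 - q) * `|w| `^ q.
    have := ler_wpM2l (ltW M0) (young `|w| (normr_ge0 w)).
    congr (_ <= _); rewrite /eps; field; rewrite gt_eqF//.
  have h2 : 1 <= x `^ (kap * q) * x `^ (- (sig * q)).
    rewrite -powRD ?(gt_eqF x0) ?implybT// -(powRr0 x); apply: ler_powR => //.
    by rewrite -mulrBl mulr_ge0 ?subr_ge0// ltW.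
  have -> : C' * (kc `^ q * x `^ (kap * q) * `|w| `^ q * (x `^ (- (sig * q)) / x))
      = M * eps `^ (1 - q) * `|w| `^ q * (x `^ (kap * q) * x `^ (- (sig * q))) / x.
    by rewrite /C'; field; rewrite !gt_eqF// powR_gt0.
  rewrite /psi -mulrDl; apply: ler_wpM2r; first by rewrite invr_ge0 ltW.
  apply: (le_trans h1); rewrite lerD2l ler_peMr// !mulr_ge0 ?powR_ge0 ?(ltW M0)//.
(* the factor [2 / a] comes from [t' / t = a / (2 * x)]; the term with [B] makes
   the contribution of the derivative of [1 / t] nonpositive *)
pose H x := F0 * ln x - 2 / a * ((Q (kvar a x) - B) / kvar a x).
have H_der x : r0 <= x -> exists2 dH, is_derive x 1 H dH & dH <= psi x.
  move=> rx; have x0 : 0 < x by apply: lt_le_trans rx; exact: lt_le_trans r01.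
  have [dq qB dqv] := HQ _ (r0t x rx); set t := kvar a x in dq qB dqv.
  have tp : 0 < t by exact: kvar_gt0.
  have dk : is_derive x 1 (kvar a) (a / 2 * t / x) := der_kvar a x0.
  have dQk := der_comp dk dq.
  have dn := der_sub dQk (der_cst B x).
  have tn : t != 0 by rewrite gt_eqF.
  have dd := der_mul dn (der_inv dk tn).
  exists (F0 * x^-1 - 2 / a * ((Q t - B) * (- (a / 2 * t / x) / t ^+ 2)
     + t^-1 * (dQ t * (a / 2 * t / x) - 0))).
    exact: (der_sub (der_scale F0 (is_derive1_ln x0)) (der_scale (2 / a) dd)).
  rewrite /psi -/t.
  rewrite [leLHS](_ : _ = (F0 - dQ t) / x + (Q t - B) / (t * x)); last first.
    by field; rewrite tn !gt_eqF.
  have h1 : (F0 - dQ t) / x <= M * `|v t| / x.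
    by apply: ler_wpM2r; [rewrite invr_ge0 ltW | rewrite lerBlDl].
  have h2 : (Q t - B) / (t * x) <= 0.
    apply: mulr_le0_ge0; last by rewrite invr_ge0 mulr_ge0 ?ltW.
    by rewrite subr_le0; apply: le_trans qB; exact: ler_norm.
  by rewrite -[leRHS]addr0 lerD.
have Hge x : r0 <= x -> F0 * ln x <= H x.
  move=> rx; rewrite lerBrDl gerDr.
  have x0 : 0 < x by apply: lt_le_trans rx; exact: lt_le_trans r01.
  have [_ qB _] := HQ _ (r0t x rx).
  rewrite pmulr_rle0 ?divr_gt0// pmulr_lle0 ?invr_gt0 ?kvar_gt0// subr_le0.
  by apply: le_trans qB; exact: ler_norm.
have main X : r0 <= X -> F0 / 2 * ln X <= H r0 - F0 / 2 * ln r0 + C' * K.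
  move=> rX; have r00 : 0 < r0 by exact: lt_le_trans r01.
  have [dH HdH] : exists dH, forall x, r0 <= x -> is_derive x 1 H (dH x) /\ dH x <= psi x.
    have /choice[dH HdH] : forall x, exists d, r0 <= x -> is_derive x 1 H d /\ d <= psi x.
      move=> x; have [rx|_] := boolP (r0 <= x); last by exists 0.
      by have [d h1 h2] := H_der x rx; exists d.
    by exists dH => x; exact: HdH.
  have Hint := @integral_ge_der _ H dH psi r0 X r00 rX cpsi
    (fun x h _ => proj1 (HdH x h)) (fun x h _ => proj2 (HdH x h)).
  have sD : `[r0, X] `<=` D0 by exact: sub_itv_D0.
  have I1 : (\int[mu]_(x in `[r0, X]) (psi x)%:E <=
      (F0 / 2 * (ln X - ln r0))%:E + (C' * K)%:E)%E.
    apply: (@le_trans _ _ (\int[mu]_(x in `[r0, X])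
      ((F0 / 2)%:E * (x^-1)%:E + C'%:E * (tbox 1 x)%:E))%E).
      apply: le_integral_ge0 => // x /=; rewrite in_itv/= => /andP[rx _].
        by rewrite lee_fin; case/andP: (psi_le x rx).
      by rewrite -!EFinM -EFinD lee_fin; case/andP: (psi_le x rx).
    have mt : measurable_fun `[r0, X] (tbox 1).
      by apply: measurable_funS (measurable_tbox _).
    have mi : measurable_fun `[r0, X] (@GRing.inv R).
      by apply: measurable_funS measurable_inv_D0.
    have t0 x : `[r0, X]%classic x -> (0 <= (tbox 1 x)%:E)%E.
      by move=> /sD/D0P x0; rewrite lee_fin tbox_ge0.
    have i0 x : `[r0, X]%classic x -> (0 <= (x^-1)%:E)%E.
      by move=> /sD/D0P x0; rewrite lee_fin invr_ge0 ltW.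
    have F20 : 0 <= F0 / 2 by rewrite divr_ge0// ltW.
    rewrite ge0_integralD//.
    - rewrite !ge0_integralZl_EFin ?(ltW C'0)//; [|exact/measurable_EFinP..].
      rewrite integral_inv// -EFinM; apply: leeD => //.
      rewrite (EFinM C' K); apply: lee_wpmul2l; first by rewrite lee_fin ltW.
      have := HK ltr01; rewrite powR1 mulr1; apply: le_trans.
      apply: ge0_subset_integral => //.
      + by apply/measurable_EFinP; exact: measurable_tbox.
      + by move=> x /D0P x0; rewrite lee_fin tbox_ge0.
    - by move=> x /i0 ?; rewrite mule_ge0// lee_fin.
    - by apply: emeasurable_funM => //; exact/measurable_EFinP.
    - by move=> x /t0 ?; rewrite mule_ge0// lee_fin ltW.
    - by apply: emeasurable_funM => //; exact/measurable_EFinP.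
  have := le_trans Hint I1; rewrite -EFinD lee_fin => {}I1.
  by have := Hge X rX; lra.
set D := H r0 - F0 / 2 * ln r0 + C' * K in main.
pose Y := Num.max (ln r0) ((D + 1) / (F0 / 2)).
have r00 : 0 < r0 by exact: lt_le_trans r01.
have F20 : 0 < F0 / 2 by rewrite divr_gt0.
have rY : r0 <= expR Y by rewrite -(lnK r00) ler_expR le_max lexx.
have := main _ rY; rewrite expRK => mY.
have : (D + 1) / (F0 / 2) <= Y by rewrite le_max lexx orbT.
by rewrite ler_pdivrMr// mulrC; move: mY; lra.
Qed.

End Consequences.

Lemma pitt_necessary : Pitt_GM lam a p q beta gamma ->
  [/\ kap < sig, sig < del & beta - gamma = del * (1 - 1 / p - 1 / q)].
Proof.
move=> /pitt_box[K HK]; split; [exact: pitt_lower HK | exact: pitt_upper HK |].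
have := pitt_scaling HK; rewrite /texp /pittidx => E.
have {}E : gamma = beta + del / p + del / q - del.
  have -> : gamma = (gamma + del) * q / q - del by field; rewrite gt_eqF.
  have -> : (gamma + del) * q = (beta + del / p) * q + del by rewrite -E; ring.
  by field; rewrite !gt_eqF.
by rewrite E; field; rewrite !gt_eqF.
Qed.

End Necessary.

(** * Pitt's inequality *)

Theorem theorem3p1 (R : realType) (a lam p q beta gamma : R)
    (a_gt0 : 0 < a) (lam_a_ge0 : 0 <= 4 * lam + a)
    (p_gt1 : 1 < p) (p_le_q : p <= q) :
  let p' : R := fine (hoelder_conjugate p%:E) in
  Pitt_GM lam a p q beta gamma <->
  beta - gamma = (2 * lam + a) * (1 / p' - 1 / q) /\
  (1 / 2 - 1 / p) * (2 * lam + a / 2) - a / (2 * p) < beta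
    < (2 * lam + a) / p'.
Proof.
have p0 : 0 < p by exact: lt_trans p_gt1.
have p10 : p - 1 != 0 by rewrite gt_eqF// subr_gt0.
have -> : fine (hoelder_conjugate p%:E) = p / (p - 1).
  rewrite /hoelder_conjugate/= eqe (gt_eqF p0) -EFinB inver (negbTE p10) -EFinM/=.
  by [].
move=> p'; have p'E : 1 / p' = 1 - 1 / p.
  by rewrite /p'; field; rewrite p10 gt_eqF.
have lowE : ((1 / 2 - 1 / p) * (2 * lam + a / 2) - a / (2 * p) < beta)
    = (hrate a lam < pittidx a lam p beta).
  rewrite -subr_gt0 -[RHS]subr_gt0; congr (0 < _).
  by rewrite /pittidx /hrate /hdim; field; rewrite gt_eqF.
have uppE : (beta < (2 * lam + a) / p') = (pittidx a lam p beta < hdim a lam).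
  rewrite -subr_gt0 -[RHS]subr_gt0 -div1r p'E; congr (0 < _).
  by rewrite /pittidx /hdim; field; rewrite gt_eqF.
rewrite p'E lowE uppE; split.
  by move=> /(pitt_necessary a_gt0 lam_a_ge0 p_gt1 p_le_q)[-> -> ->].
move=> [scal /andP[low upp]]; exact: pitt_sufficient.
Qed.
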